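(* Let $(\mathcal R_n)_{n\ge1}$ be an aperiodic renewal sequence of operators acting on a complex Banach space $(\mathcal B,|\cdot|_{\mathcal B})$. Assume that there exist $\beta\in(0,1)$ and a slowly varying function $L$ such that the sequence $\left(\frac{n^{1+\beta}}{L(n)}\mathcal R_n\right)_{n\ge1}$ converges in $(\mathcal L(\mathcal B),\|\cdot\|_{\mathcal B})$ to some bounded operator $\mathcal E$. Then: 1. there exists a strictly positive constant $C$ such that for any $n,\ell\ge1$, $$\|\mathcal R_n^{(\ell)}\|_{\mathcal B}\le C\,\ell^2\,\frac{L(n)}{n^{1+\beta}};$$ 2. for any $\ell\ge1$, the sequence $\left(\frac{n^{1+\beta}}{L(n)}\mathcal R_n^{(\ell)}\right)_{n\ge1}$ converges in $(\mathcal L(\mathcal B),\|\cdot\|_{\mathcal B})$ to the operator $$\mathcal E_\ell:=\sum_{i=0}^{\ell-1}\mathcal R^{(i)}\,\mathcal E\,\mathcal R^{(\ell-i-1)}.$$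
   Context: $\mathcal L(\mathcal B)$ is the space of bounded linear operators on $\mathcal B$ and $\|\cdot\|_{\mathcal B}$ the operator norm. $\overline{\mathbb D}$ is the closed unit disc of $\mathbb C$. An aperiodic renewal sequence of operators is a sequence $(\mathcal R_n)_{n\ge1}$ in $\mathcal L(\mathcal B)$ with $\sum_{n\ge1}\|\mathcal R_n\|_{\mathcal B}<+\infty$ such that the operators $\mathcal R(z):=\sum_{n\ge1}z^n\mathcal R_n$, $z\in\overline{\mathbb D}$, satisfy: - (R1) $\mathcal R(1)$ has a simple eigenvalue at $1$ (with corresponding eigenprojector $\Pi_{\mathcal R}$) and the rest of its spectrum is contained in a disc of radius strictly less than $1$; - (R2) for any $z\in\overline{\mathbb D}\setminus\{1\}$, the spectral radius of $\mathcal R(z)$ is strictly less than $1$; - (R3) for any $n\ge1$, the real number $r_n$ defined by $\Pi_{\mathcal R}\mathcal R_n\Pi_{\mathcal R}=r_n\Pi_{\mathcal R}$ is non-negative. Write $\mathcal R=\mathcal R(1)$, $\mathcal R^{(\ell)}=\mathcal R\circ\cdots\circ\mathcal R$ ($\ell$ times), $\mathcal R^{(0)}=I$, and for $\ell\ge1$, $n\ge1$, $$\mathcal R_n^{(\ell)}:=\sum_{j_1+\dots+j_\ell=n}\mathcal R_{j_1}\cdots\mathcal R_{j_\ell}\qquad(j_1,\dots,j_\ell\ge1).$$ *)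

(* Defs.v *)
From HB Require Import structures.
From mathcomp Require Import all_boot all_order all_algebra.
From mathcomp Require Import all_classical all_reals all_analysis.
From mathcomp.real_closed Require Import complex.

Set Implicit Arguments.
Unset Strict Implicit.
Unset Printing Implicit Defensive.

Import Order.TTheory GRing.Theory Num.Theory.
Import numFieldNormedType.Exports.

Local Open Scope classical_set_scope.
Local Open Scope complex_scope.
Local Open Scope ring_scope.

(* A complex Banach space is a completeNormedModType over R[i]; its norm takes
   values in R[i] (on the nonnegative real axis), so that rnorm is the same
   norm read in R. *)
Definition rnorm (R : realType) (V : normedModType R[i]) (x : V) : R :=
  complex.Re `|x|.

Section rnorm_theory.
Context (R : realType) (V : normedModType R[i]).
Implicit Types x y : V.

Lemma rnormE x : (rnorm x)%:C = `|x|.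
Proof. by apply: RRe_real; exact: normr_real. Qed.

Lemma rnorm_ge0 x : 0 <= rnorm x.
Proof. by rewrite -ler0c rnormE. Qed.

Lemma rnorm0 : rnorm (0 : V) = 0.
Proof. by rewrite /rnorm normr0. Qed.

Lemma rnorm_eq0 x : rnorm x = 0 -> x = 0.
Proof. by move=> x0; apply: normr0_eq0; rewrite -rnormE x0. Qed.

Lemma rnormD x y : rnorm (x + y) <= rnorm x + rnorm y.
Proof. by rewrite -lecR rmorphD/= !rnormE ler_normD. Qed.

Lemma rnormB x y : rnorm (x - y) = rnorm (y - x).
Proof. by rewrite /rnorm distrC. Qed.

Lemma rnormZ (a : R[i]) x : rnorm (a *: x) = complex.Re `|a| * rnorm x.
Proof.
apply: complexI; rewrite rmorphM/= !rnormE normrZ.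
by congr (_ * _); rewrite RRe_real// normr_real.
Qed.

End rnorm_theory.

Section bounded_operators.
Context (R : realType) (V : normedModType R[i]).

Definition bounded_linear (f : V -> V) : Prop :=
  linear f /\ exists M : R, forall x, rnorm (f x) <= M * rnorm x.

Record bop := Bop { bop_fun :> V -> V ; bop_prop : `[< bounded_linear bop_fun >] }.

HB.instance Definition _ := [isSub for bop_fun].
HB.instance Definition _ := [Choice of bop by <:].

Definition MkBop (f : V -> V) (fP : bounded_linear f) : bop :=
  Bop (introT (asboolP _) fP).

Lemma bopP (T : bop) : bounded_linear T.
Proof. exact/asboolP/bop_prop. Qed.

Lemma bop_ext (S T : bop) : (forall x, S x = T x) -> S = T.
Proof. by move=> ST; apply: val_inj; apply/funext => x; exact: ST. Qed.

Let bop_linear (T : bop) : linear T. Proof. by have [] := bopP T. Qed.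

HB.instance Definition _ (T : bop) :=
  @GRing.isLinear.Build _ _ _ _ (bop_fun T) (@bop_linear T).

Lemma bop_bound (T : bop) :
  exists2 M : R, 0 <= M & forall x, rnorm (T x) <= M * rnorm x.
Proof.
have [_ [M TM]] := bopP T; exists `|M| => // x.
by rewrite (le_trans (TM x))// ler_wpM2r ?rnorm_ge0// ler_norm.
Qed.

Let zero_bounded : bounded_linear (fun=> 0).
Proof.
split; first by move=> a x y; rewrite scaler0 addr0.
by exists 0 => x; rewrite mul0r rnorm0.
Qed.

Let opp_bounded (S : bop) : bounded_linear (fun x => - S x).
Proof.
split; first by move=> a x y; rewrite linearP opprD scalerN.
have [M M0 SM] := bop_bound S; exists M => x.
by rewrite (le_trans _ (SM x))// /rnorm normrN.
Qed.

Let add_bounded (S T : bop) : bounded_linear (fun x => S x + T x).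
Proof.
split; first by move=> a x y; rewrite !linearP scalerDr addrACA.
have [M M0 SM] := bop_bound S; have [N N0 TN] := bop_bound T.
exists (M + N) => x; rewrite (le_trans (rnormD _ _))// mulrDl.
by apply: lerD; [exact: SM|exact: TN].
Qed.

Let scale_bounded (a : R[i]) (S : bop) : bounded_linear (fun x => a *: S x).
Proof.
split.
  by move=> b x y; rewrite linearP scalerDr !scalerA [a * b]mulrC.
have [M M0 SM] := bop_bound S; exists (complex.Re `|a| * M) => x.
by rewrite rnormZ -mulrA ler_wpM2l// -ler0c RRe_real ?normr_real.
Qed.

Let one_bounded : bounded_linear (fun x => x).
Proof. by split=> //; exists 1 => x; rewrite mul1r. Qed.

Let mul_bounded (S T : bop) : bounded_linear (fun x => S (T x)).
Proof.
split; first by move=> a x y; rewrite !linearP.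
have [M M0 SM] := bop_bound S; have [N N0 TN] := bop_bound T.
by exists (M * N) => x; rewrite (le_trans (SM _))// -mulrA ler_wpM2l.
Qed.

Let bop0 := MkBop zero_bounded.
Let bopN S := MkBop (opp_bounded S).
Let bopD S T := MkBop (add_bounded S T).

Let bopDA : associative bopD.
Proof. by move=> S T U; apply: bop_ext => x /=; rewrite addrA. Qed.
Let bopDC : commutative bopD.
Proof. by move=> S T; apply: bop_ext => x /=; rewrite addrC. Qed.
Let bop0D : left_id bop0 bopD.
Proof. by move=> S; apply: bop_ext => x /=; rewrite add0r. Qed.
Let bopND : left_inverse bop0 bopN bopD.
Proof. by move=> S; apply: bop_ext => x /=; rewrite addNr. Qed.

HB.instance Definition _ := GRing.isZmodule.Build bop bopDA bopDC bop0D bopND.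

Lemma bop0E x : (0 : bop) x = 0. Proof. by []. Qed.
Lemma bopNE (S : bop) x : (- S) x = - S x. Proof. by []. Qed.
Lemma bopDE (S T : bop) x : (S + T) x = S x + T x. Proof. by []. Qed.

Let bopZ a S := MkBop (scale_bounded a S).

Let bopZA a b S : bopZ a (bopZ b S) = bopZ (a * b) S.
Proof. by apply: bop_ext => x /=; rewrite scalerA. Qed.
Let bop1Z : left_id 1 bopZ.
Proof. by move=> S; apply: bop_ext => x /=; rewrite scale1r. Qed.
Let bopZDr : right_distributive bopZ +%R.
Proof. by move=> a S T; apply: bop_ext => x; rewrite /= scalerDr. Qed.
Let bopZDl S : {morph bopZ^~ S : a b / a + b}.
Proof. by move=> a b; apply: bop_ext => x; rewrite /= scalerDl. Qed.

HB.instance Definition _ :=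
  GRing.Zmodule_isLmodule.Build R[i] bop bopZA bop1Z bopZDr bopZDl.

Lemma bopZE a (S : bop) x : (a *: S) x = a *: S x. Proof. by []. Qed.

(* The product of operators is their composition. *)
Let bop1 := MkBop one_bounded.
Let bopM S T := MkBop (mul_bounded S T).

Let bopMA : associative bopM. Proof. by move=> S T U; exact: bop_ext. Qed.
Let bop1M : left_id bop1 bopM. Proof. by move=> S; exact: bop_ext. Qed.
Let bopM1 : right_id bop1 bopM. Proof. by move=> S; exact: bop_ext. Qed.
Let bopMDl : left_distributive bopM +%R.
Proof. by move=> S T U; exact: bop_ext. Qed.
Let bopMDr : right_distributive bopM +%R.
Proof. by move=> S T U; apply: bop_ext => x /=; rewrite linearD. Qed.

HB.instance Definition _ :=
  GRing.Zmodule_isPzRing.Build bop bopMA bop1M bopM1 bopMDl bopMDr.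

Lemma bop1E x : (1 : bop) x = x. Proof. by []. Qed.
Lemma bopME (S T : bop) x : (S * T) x = S (T x). Proof. by []. Qed.

Lemma bop_scalerAl a (S T : bop) : a *: (S * T) = (a *: S) * T.
Proof. exact: bop_ext. Qed.

Lemma bop_scalerAr a (S T : bop) : a *: (S * T) = S * (a *: T).
Proof. by apply: bop_ext => x; rewrite !(bopME, bopZE) linearZ. Qed.

Definition opnorm (T : bop) : R :=
  sup [set rnorm (T x) | x in [set x | rnorm x <= 1]].

Lemma opnorm_has_sup (T : bop) :
  has_sup [set rnorm (T x) | x in [set x | rnorm x <= 1]].
Proof.
split; first by exists (rnorm (T 0)), 0 => //=; rewrite rnorm0.
have [M M0 TM] := bop_bound T; exists M => _ [x /= x1 <-].
by rewrite (le_trans (TM x))// ler_piMr.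
Qed.

Lemma opnorm_ge0 (T : bop) : 0 <= opnorm T.
Proof.
rewrite (le_trans (rnorm_ge0 (T 0)))//; apply: ub_le_sup.
  by have [] := opnorm_has_sup T.
by exists 0 => //=; rewrite rnorm0.
Qed.

Lemma opnorm_le (T : bop) x : rnorm (T x) <= opnorm T * rnorm x.
Proof.
have [->|x0] := eqVneq x 0; first by rewrite linear0 rnorm0 mulr0.
have x_gt0 : 0 < rnorm x.
  by rewrite lt_neqAle rnorm_ge0 andbT eq_sym; apply: contra_neq x0 => /rnorm_eq0.
rewrite -ler_pdivrMr//.
have nV : complex.Re `|((rnorm x)^-1)%:C| = (rnorm x)^-1.
  by rewrite ger0_norm// ler0c invr_ge0 ltW.
rewrite mulrC -nV -rnormZ -linearZ; apply: ub_le_sup.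
  by have [] := opnorm_has_sup T.
by exists (((rnorm x)^-1)%:C *: x) => //=; rewrite rnormZ nV mulVf// gt_eqF.
Qed.

Lemma opnorm_least (T : bop) (M : R) : 0 <= M ->
  (forall x, rnorm (T x) <= M * rnorm x) -> opnorm T <= M.
Proof.
move=> M0 TM; apply: ge_sup; first by have [] := opnorm_has_sup T.
by move=> _ [x /= x1 <-]; rewrite (le_trans (TM x))// ler_piMr.
Qed.

Lemma opnormM (S T : bop) : opnorm (S * T) <= opnorm S * opnorm T.
Proof.
apply: opnorm_least => [|x]; first by rewrite mulr_ge0// opnorm_ge0.
rewrite bopME (le_trans (opnorm_le _ _))// -mulrA ler_wpM2l ?opnorm_ge0//.
exact: opnorm_le.
Qed.

Let normD (S T : bop) : (opnorm (S + T))%:C <= (opnorm S)%:C + (opnorm T)%:C.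
Proof.
rewrite -rmorphD/= lecR; apply: opnorm_least => [|x].
  by rewrite addr_ge0// opnorm_ge0.
by rewrite bopDE (le_trans (rnormD _ _))// mulrDl lerD// opnorm_le.
Qed.

Let normZ (a : R[i]) (T : bop) : (opnorm (a *: T))%:C = `|a| * (opnorm T)%:C.
Proof.
have le b (S : bop) : opnorm (b *: S) <= complex.Re `|b| * opnorm S.
  have b0 : 0 <= complex.Re `|b| by rewrite -ler0c RRe_real ?normr_real.
  apply: opnorm_least => [|x]; first by rewrite mulr_ge0// opnorm_ge0.
  by rewrite bopZE rnormZ -mulrA ler_wpM2l// opnorm_le.
have -> : `|a| = (complex.Re `|a|)%:C by rewrite RRe_real// normr_real.
rewrite -rmorphM; congr (_%:C); apply/eqP; rewrite eq_le le andTb.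
have [->|a0] := eqVneq a 0.
  by rewrite normr0 mul0r opnorm_ge0.
have an0 : 0 < complex.Re `|a| by rewrite -ltcR RRe_real ?normr_real// normr_gt0.
rewrite -ler_pdivlMl//.
have {1}-> : T = a^-1 *: (a *: T) by rewrite scalerA mulVf// scale1r.
rewrite (le_trans (le _ _))// normfV.
suff -> : complex.Re `|a|^-1 = (complex.Re `|a|)^-1 by [].
by apply: complexI; rewrite fmorphV RRe_real ?normr_real//.
Qed.

Let norm0 (T : bop) : (opnorm T)%:C = 0 -> T = 0.
Proof.
move=> /complexI T0; apply: bop_ext => x; apply: rnorm_eq0; apply/eqP.
by rewrite eq_le rnorm_ge0 andbT (le_trans (opnorm_le _ _))// T0 mul0r.
Qed.

HB.instance Definition _ :=
  Lmodule_isNormed.Build R[i] bop normD normZ norm0.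

Lemma bop_normE (T : bop) : `|T| = (opnorm T)%:C. Proof. by []. Qed.

End bounded_operators.

Section bounded_operators_complete.
Context (R : realType) (V : completeNormedModType R[i]).

Lemma bop_norm_le (T : bop V) x : `|T x| <= `|T| * `|x|.
Proof. by rewrite -!rnormE -rmorphM lecR; exact: opnorm_le. Qed.

Lemma bop_dist_le (S T : bop V) x : `|S x - T x| <= `|S - T| * `|x|.
Proof. exact: (bop_norm_le (S - T)). Qed.

Lemma bop_complete (F : set_system (bop V)) :
  ProperFilter F -> cauchy F -> cvg F.
Proof.
move=> FF Fc.
have Fball (e : R[i]) : 0 < e -> exists T : bop V, F [set S | `|T - S| < e].
  move=> e0; have /cauchyP/(_ _ e0)[T FT] := Fc.
  by exists T; move: FT; rewrite -ball_normE.
have Fx x : cvg ((fun T : bop V => T x) @ F).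
  apply: cauchy_cvg; apply: cauchy_exP => e e0.
  have d0 : 0 < e / (`|x| + 1) by rewrite divr_gt0// ltr_wpDl.
  have [T FT] := Fball _ d0; exists (T x).
  rewrite -ball_normE; change (F [set S : bop V | `|T x - S x| < e]).
  apply: filterS FT => S /= TS.
  rewrite (le_lt_trans (bop_dist_le T S x))//.
  rewrite (@le_lt_trans _ _ (`|T - S| * (`|x| + 1)))//.
    by rewrite ler_wpM2l// lerDl.
  by rewrite -ltr_pdivlMr// ltr_wpDl.
pose g x := lim ((fun T : bop V => T x) @ F).
have Fg x : (fun T : bop V => T x) @ F --> g x by exact: Fx.
have g_linear : linear g.
  move=> a x y; apply: (@cvg_unique _ _ _ _ _ _ (Fg (a *: x + y))) => //.
  have -> : (fun T : bop V => T (a *: x + y)) = (fun T => a *: T x + T y).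
    by apply/funext => T; rewrite linearP.
  by apply: cvgD; [apply: cvgZl_tmp; exact: Fg|exact: Fg].
have Fnear (e : R[i]) : 0 < e ->
    F [set T : bop V | forall x, `|T x - g x| <= e * `|x|].
  move=> e0; have e20 : 0 < e / 2 by rewrite divr_gt0.
  have e40 : 0 < e / 2 / 2 by rewrite divr_gt0.
  have [T0 FT0] := Fball _ e40.
  apply: filterS (FT0) => T /= TT0 x.
  have [->|x0] := eqVneq x 0.
    have g0 : g 0 = 0.
      by have := g_linear (-1) 0 0; rewrite scaler0 addr0 scaleN1r addNr.
    by rewrite linear0 g0 subrr !normr0 mulr0.
  have ex0 : 0 < e / 2 * `|x| by rewrite mulr_gt0// normr_gt0.
  have /cvgrPdist_le/(_ _ ex0) FgS := Fg x.
  have [S [/= ST0 Sg]] := filter_ex (filterI FT0 FgS).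
  rewrite (le_trans (ler_distD (S x) _ _))// (splitr e) mulrDl lerD//.
    rewrite (le_trans (bop_dist_le T S x))//.
    rewrite ler_wpM2r// (le_trans (ler_distD T0 _ _))// (splitr (e / 2)).
    by rewrite lerD//; [rewrite distrC ltW|exact: ltW].
  by rewrite distrC.
have g_bounded : bounded_linear g.
  split=> //; have [T Tg] := filter_ex (Fnear 1 ltr01).
  have [M M0 TM] := bop_bound T; exists (M + 1) => x.
  rewrite -(subrK (T x) (g x)) (le_trans (rnormD _ _))// addrC mulrDl lerD//.
  by rewrite mul1r rnormB -lecR !rnormE -[leRHS]mul1r.
apply/cvg_ex; exists (MkBop g_bounded).
apply/cvgrPdist_le => e e0.
apply: filterS (Fnear e e0) => T Tg.
rewrite distrC bop_normE -[e]RRe_real ?gtr0_real// lecR.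
have eE : (complex.Re e)%:C = e by rewrite RRe_real// gtr0_real.
apply: opnorm_least => [|x]; first by rewrite -ler0c eE ltW.
by rewrite -lecR rmorphM/= !rnormE eE; exact: Tg.
Qed.

HB.instance Definition _ := Uniform_isComplete.Build (bop V) bop_complete.

End bounded_operators_complete.

Section renewal.
Context (R : realType) (V : completeNormedModType R[i]).
Implicit Types (S T P : bop V) (z lam : R[i]).

Definition invertible T : Prop := exists S, S * T = 1 /\ T * S = 1.

Definition spectrum T : set R[i] := [set lam | ~ invertible (lam *: (1 : bop V) - T)].

Definition spectral_radius T : R :=
  sup [set complex.Re `|lam| | lam in spectrum T].

(* lam is an (algebraically) simple eigenvalue of T with eigenprojector P:
   V = ker (lam - T) (+) ker P is a T-invariant decomposition, with projection P
   onto the line ker (lam - T), and lam - T is boundedly invertible on ker P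
   (with inverse S there), i.e. lam is not in the spectrum of T on ker P.
   This determines P: it is the spectral projector of T at lam. *)
Definition simple_eigenvalue T lam P : Prop :=
  [/\ P * P = P,
      P * T = T * P,
      range P = [set x | T x = lam *: x],
      exists2 v : V, v != 0 & range P = [set c *: v | c in [set: R[i]]] &
      exists S, S * (lam *: (1 : bop V) - T) = 1 - P /\ (lam *: (1 : bop V) - T) * S = 1 - P].

(* Sequences indexed by n >= 1 are functions on nat whose value at 0 is
   irrelevant. *)
Implicit Type Rop : nat -> bop V.

Definition renewal_series Rop z : bop V :=
  lim ((fun n => \sum_(1 <= k < n) z ^+ k *: Rop k) @ \oo).

Definition renewal_R1 Rop P : Prop :=
  simple_eigenvalue (renewal_series Rop 1) 1 P /\
  exists2 rho : R, rho < 1 &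
    forall lam, spectrum (renewal_series Rop 1) lam -> lam != 1 ->
      complex.Re `|lam| <= rho.

Definition renewal_R2 Rop : Prop :=
  forall z, `|z| <= 1 -> z != 1 -> spectral_radius (renewal_series Rop z) < 1.

Definition renewal_R3 Rop P : Prop :=
  forall n, (1 <= n)%N ->
    exists2 r : R, 0 <= r & P * Rop n * P = r%:C *: P.

Definition aperiodic_renewal Rop : Prop :=
  [/\ (\sum_(1 <= n <oo) (opnorm (Rop n))%:E < +oo)%E,
      renewal_R2 Rop &
      exists P, renewal_R1 Rop P /\ renewal_R3 Rop P].

(* Rop_n^(l), the sum over j_1, ..., j_l >= 1 with j_1 + ... + j_l = n; each j_i
   is then at most n. *)
Definition renewal_conv Rop (l n : nat) : bop V :=
  \sum_(j : {ffun 'I_l -> 'I_n.+1} |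
        (\sum_i j i == n)%N && [forall i, (1 <= j i)%N])
     \prod_(i < l) Rop (j i).

End renewal.

(* Slowly varying at infinity, in Karamata's sense. *)
Definition slowly_varying (R : realType) (L : R -> R) : Prop :=
  [/\ measurable_fun (`]0, +oo[%classic : set R) L,
      forall x, 0 < x -> 0 < L x &
      forall c, 0 < c -> L (c * x) / L x @[x --> +oo] --> (1 : R)].

(* Main.v *)
(* Put a_n = L(n) / n^(1+beta). Under convolution R_n^(l) is the n-th coefficient of the l-th
   power of x = (R_n), whose generating function is R(z).

   By (R1) and (R2), and by block triangularization of R(z) near z = 1, the powers R(z)^l are
   bounded uniformly on the closed disc and, for some m, |Q R(z)^m Q| <= 1/2 there, where P is
   the eigenprojector and Q = 1 - P. By Wiener's lemma the convolution powers of Q x^m Q then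
   decay geometrically in l^1, and their n-th terms are O(a_n) with summable constants, because
   a_j = O(a_n) for n/2 <= j <= n. Eliminating this block expresses the resolvent
   sum_l w^l x^(ml) through its corner G = P (sum_l w^l x^(ml)) P, which satisfies G = P + G q with q = O(a_n). Since the corner
   consists of multiples of P, Parseval's identity applies to it. If t is the rotation of z by
   exp(i pi/n) then tG - G = tG (tq - q) G, so the square sums of G_i G_j over [n/2, n] are
   O((i+j+1)^2 a_n); inserting this in n G(n) = (G (n q) G)(n) and using Cauchy-Schwarz gives
   |G_l(n)| = O(l^2 a_n), which is the first claim.

   The bound on a_j above, the summability of a_n and a_(n+1) ~ a_n follow from Karamata's uniform
   convergence theorem. For the second claim, if x_n / a_n -> X and y_n / a_n -> Y, then
   (x * y)_n / a_n -> X (sum y) + (sum x) Y, because only the terms having one index near 0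
   contribute; induct on l. *)

Require Import Defs.
From HB Require Import structures.
From mathcomp Require Import all_boot all_order all_algebra.
From mathcomp Require Import all_classical all_reals all_analysis measurable_realfun.
From mathcomp.real_closed Require Import complex.
From mathcomp Require Import zify ring lra.

Set Implicit Arguments.
Unset Strict Implicit.
Unset Printing Implicit Defensive.

Import Order.TTheory GRing.Theory Num.Theory.
Import numFieldNormedType.Exports.

Local Open Scope classical_set_scope.
Local Open Scope complex_scope.
Local Open Scope ring_scope.

(** The obstacle is the eigenvalue 1 at z = 1: the powers of x do not decay in l, and a bound for
    R(z)^l on the circle controls neither an l^1 norm nor a weighted coefficient. (R1) and (R2)
    moreover control spectra, not norms, so the block Q R(z) Q may be large; only a power x^m has a
    small block, and the residue of l modulo m is put back at the end. Eliminating the block is a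
    first-return decomposition: with W = w x^m, the series q = P W (1 - Q W)^-1 P describes the
    excursions away from the range of P, and all growth in l sits in G, whose coefficients are
    multiples of P. There a sup bound on the circle is an operator bound on l^2. Rotation
    differences of G reduce to tq - q, whose square sum is O(a_n) because (m/n)^2 outweighs
    (n/m)^(1+beta), which is where beta < 1 enters; and the rotation by pi/n moves each coefficient
    of index in [n/2, n] by at least its own size. One factor l comes from the free position of tq -
    q between the two copies of G, the other from that of the long jump n q. *)

Definition ser (U : Type) := nat -> U.

(** * Convolution of operator sequences *)

Section ser_ring.
Variable U : pzRingType.
Implicit Types x y z : ser U.

HB.instance Definition _ := GRing.Zmodule.on (ser U).

Definition ser_one : ser U := fun n => (n == 0)%:R.
Definition conv x y : ser U := fun n => \sum_(i < n.+1) x i * y (n - i)%N.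

Lemma conv_rev x y n : conv x y n = \sum_(i < n.+1) x (n - i)%N * y i.
Proof.
rewrite /conv (reindex_inj rev_ord_inj) /=; apply: eq_bigr => i _.
by rewrite subSS subKn// -ltnS.
Qed.

(** Both sides are the double sum of [x i * (y (j - i) * z (n - j))] over [i <= j <= n]. *)
Let convA : associative conv.
Proof.
move=> x y z; apply/funext => n; rewrite [RHS]conv_rev /conv.
transitivity (\sum_(i < n.+1) \sum_(j < n.+1 | (i <= j)%N)
    x i * (y (j - i)%N * z (n - j)%N)).
  apply: eq_bigr => i _; rewrite mulr_sumr.
  rewrite -(big_mkord (fun j => i <= j)%N (fun j => x i * (y (j - i)%N * z (n - j)%N))).
  rewrite -(big_mkord predT (fun k => x i * (y k * z (n - i - k)%N))).
  symmetry; rewrite [LHS](big_cat_nat (n := i))//=; last by rewrite ltnW.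
  rewrite [X in X + _]big_nat_cond [X in X + _]big1 ?add0r; last first.
    by move=> j /andP[/andP[_ ji] ij]; rewrite leqNgt ji in ij.
  rewrite -[X in \sum_(X <= _ < _ | _) _]add0n big_addn.
  rewrite (_ : (n.+1 - i)%N = (n - i).+1); last by rewrite subSn// -ltnS.
  rewrite [LHS]big_nat_cond [RHS]big_nat_cond; apply: eq_big => [j|j _].
    by rewrite leq_addl.
  by rewrite addnK subnDA subnAC.
rewrite (exchange_big_dep predT) //= (reindex_inj rev_ord_inj) /=.
apply: eq_bigr => j _; rewrite mulr_suml subSS.
rewrite -(big_mkord (fun i => i <= n - j)%N
  (fun i => x i * (y (n - j - i)%N * z (n - (n - j))%N))).
rewrite -(big_mkord predT (fun i => x i * y (n - j - i)%N * z j)).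
rewrite [LHS](big_cat_nat (n := (n - j).+1))//=; last by lia.
rewrite [X in _ + X]big_nat_cond [X in _ + X]big1 ?addr0; last first.
  by move=> i /andP[/andP[]]; lia.
rewrite [LHS]big_nat_cond [RHS]big_nat_cond; apply: eq_big => [i|i _].
  by rewrite ltnS; lia.
by rewrite subKn ?mulrA// -ltnS.
Qed.

Let conv1x : left_id ser_one conv.
Proof.
move=> x; apply/funext => n; rewrite /conv big_ord_recl /= mul1r subn0.
by rewrite big1 ?addr0// => i _; rewrite mul0r.
Qed.

Let convx1 : right_id ser_one conv.
Proof.
move=> x; apply/funext => n; rewrite conv_rev big_ord_recl /= mulr1 subn0.
by rewrite big1 ?addr0// => i _; rewrite mulr0.
Qed.

Let convDl : left_distributive conv +%R.
Proof.
move=> x y z; apply/funext => n; rewrite /conv /GRing.add /= -big_split /=.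
by apply: eq_bigr => i _; rewrite mulrDl.
Qed.

Let convDr : right_distributive conv +%R.
Proof.
move=> x y z; apply/funext => n; rewrite /conv /GRing.add /= -big_split /=.
by apply: eq_bigr => i _; rewrite mulrDr.
Qed.

(** The coefficients form an arbitrary ring, so the construction iterates: [ser (ser U)] is a ring
    as well, and resolvents become inverses in it. *)
HB.instance Definition _ :=
  GRing.Zmodule_isPzRing.Build (ser U) convA conv1x convx1 convDl convDr.

Lemma serM x y n : (x * y) n = \sum_(i < n.+1) x i * y (n - i)%N.
Proof. by []. Qed.

Lemma serMr x y n : (x * y) n = \sum_(i < n.+1) x (n - i)%N * y i.
Proof. exact: conv_rev. Qed.

Lemma serD x y n : (x + y) n = x n + y n. Proof. by []. Qed.
Lemma serN x n : (- x) n = - x n. Proof. by []. Qed.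
Lemma serB x y n : (x - y) n = x n - y n. Proof. by []. Qed.
Lemma ser1E n : (1 : ser U) n = (n == 0)%:R. Proof. by []. Qed.

Lemma ser_sum (I : Type) (r : seq I) (P : pred I) (F : I -> ser U) n :
  (\sum_(i <- r | P i) F i) n = \sum_(i <- r | P i) F i n.
Proof. by elim/big_rec2: _ => // i u v _ <-. Qed.

Definition sermono (k : nat) (c : U) : ser U := fun n => if n == k then c else 0.

Lemma sermonoMl k c x n :
  (sermono k c * x) n = if (k <= n)%N then c * x (n - k)%N else 0.
Proof.
rewrite serM; case: leqP => [kn|nk]; last first.
  apply: big1 => i _; rewrite /sermono ifN ?mul0r//.
  by apply/eqP => ik; move: nk; rewrite -ik ltnNge -ltnS ltn_ord.
rewrite (bigD1 (Ordinal (kn : k < n.+1)%N)) //= /sermono eqxx big1 ?addr0//.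
by move=> i ik; rewrite ifN ?mul0r//; apply: contra ik => /eqP ik; apply/eqP/val_inj.
Qed.

Lemma sermonoMr k c x n :
  (x * sermono k c) n = if (k <= n)%N then x (n - k)%N * c else 0.
Proof.
rewrite serMr; case: leqP => [kn|nk]; last first.
  apply: big1 => i _; rewrite /sermono ifN ?mulr0//.
  by apply/eqP => ik; move: nk; rewrite -ik ltnNge -ltnS ltn_ord.
rewrite (bigD1 (Ordinal (kn : k < n.+1)%N)) //= /sermono eqxx big1 ?addr0//.
by move=> i ik; rewrite ifN ?mulr0//; apply: contra ik => /eqP ik; apply/eqP/val_inj.
Qed.

Lemma sermonoM k l c d : sermono k c * sermono l d = sermono (k + l) (c * d).
Proof.
apply/funext => n; rewrite sermonoMl /sermono; case: leqP => kn.
  by rewrite (_ : (n - k == l)%N = (n == k + l)%N); [case: ifP; rewrite ?mulr0|lia].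
by rewrite ifN//; lia.
Qed.

Lemma sermonoD k c d : sermono k (c + d) = sermono k c + sermono k d.
Proof. by apply/funext => n; rewrite serD /sermono; case: ifP; rewrite ?addr0. Qed.

Lemma sermonoN k c : sermono k (- c) = - sermono k c.
Proof. by apply/funext => n; rewrite serN /sermono; case: ifP; rewrite ?oppr0. Qed.

Lemma sermono1 : sermono 0 1 = 1.
Proof. by apply/funext => n; rewrite ser1E /sermono; case: eqP. Qed.

Lemma ser_eq_trunc x x' y y' N :
  (forall n, (n <= N)%N -> x n = x' n) -> (forall n, (n <= N)%N -> y n = y' n) ->
  forall n, (n <= N)%N -> (x * y) n = (x' * y') n.
Proof.
move=> xx' yy' n nN; rewrite !serM; apply: eq_bigr => i _.
by rewrite xx' ?yy'//; have := ltn_ord i; lia.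
Qed.

Lemma ser_eq_truncX x x' k N :
  (forall n, (n <= N)%N -> x n = x' n) ->
  forall n, (n <= N)%N -> (x ^+ k) n = (x' ^+ k) n.
Proof.
move=> xx'; elim: k => [|k IH] n nN; first by rewrite !expr0.
by rewrite !exprS; apply: (ser_eq_trunc xx' IH).
Qed.

End ser_ring.

(** * Real-valued absolute values and operator norms *)

Section complex_abs.
Variable R : realType.
Implicit Types z w : R[i].

Definition cabs z : R := complex.Re `|z|.

Lemma cabsE z : (cabs z)%:C = `|z|.
Proof. by apply: RRe_real; exact: normr_real. Qed.

Lemma cabs_ge0 z : 0 <= cabs z.
Proof. by rewrite -ler0c cabsE. Qed.

Lemma cabsM z w : cabs (z * w) = cabs z * cabs w.
Proof. by apply: complexI; rewrite rmorphM/= !cabsE normrM. Qed.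

Lemma cabsD z w : cabs (z + w) <= cabs z + cabs w.
Proof. by rewrite -lecR rmorphD/= !cabsE ler_normD. Qed.

Lemma cabsN z : cabs (- z) = cabs z.
Proof. by rewrite /cabs normrN. Qed.

Lemma cabsB z w : cabs (z - w) = cabs (w - z).
Proof. by rewrite -opprB cabsN. Qed.

Lemma cabs0 : cabs 0 = 0. Proof. by rewrite /cabs normr0. Qed.
Lemma cabs1 : cabs 1 = 1. Proof. by rewrite /cabs normr1. Qed.

Lemma cabsX z n : cabs (z ^+ n) = cabs z ^+ n.
Proof. by elim: n => [|n IH]; rewrite ?cabs1// !exprS cabsM IH. Qed.

Lemma cabsV z : cabs z^-1 = (cabs z)^-1.
Proof. by apply: complexI; rewrite cabsE normfV -cabsE fmorphV. Qed.

Lemma cabs_real (r : R) : cabs r%:C = `|r|.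
Proof.
by rewrite /cabs normc_def /= expr0n addr0 sqrtr_sqr.
Qed.

Lemma cabs_nat n : cabs (n%:R : R[i]) = n%:R.
Proof. by rewrite -(rmorph_nat (@real_complex R)) cabs_real normr_nat. Qed.

Lemma cabs_eq0 z : (cabs z == 0) = (z == 0).
Proof. by rewrite -[RHS]normr_eq0 -cabsE -(inj_eq (@complexI R)). Qed.

Lemma cabs_sq z : cabs z ^+ 2 = complex.Re z ^+ 2 + complex.Im z ^+ 2.
Proof.
case: z => a b; rewrite /cabs normc_def /= sqr_sqrtr//.
by rewrite addr_ge0// sqr_ge0.
Qed.

Lemma cabs_sub_ge z w : cabs z - cabs w <= cabs (z - w).
Proof. by rewrite lerBlDr; have := cabsD (z - w) w; rewrite subrK. Qed.

Lemma cabs_subX z w n : cabs z <= 1 -> cabs w <= 1 ->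
  cabs (z ^+ n - w ^+ n) <= n%:R * cabs (z - w).
Proof.
move=> z1 w1; elim: n => [|n IH]; first by rewrite !expr0 subrr cabs0 mul0r.
rewrite !exprS (_ : z * z ^+ n - _ = (z - w) * z ^+ n + w * (z ^+ n - w ^+ n));
  last by ring.
rewrite (le_trans (cabsD _ _))// !cabsM cabsX -natr1 mulrDl mul1r addrC.
apply: lerD; last by rewrite ler_piMr ?cabs_ge0// exprn_ile1// cabs_ge0.
by rewrite (le_trans _ IH)// ler_piMl// cabs_ge0.
Qed.

End complex_abs.

Section opnorm_theory.
Context (R : realType) (V : normedModType R[i]).
Implicit Types S T : bop V.

Lemma opnormE T : (opnorm T)%:C = `|T|. Proof. by []. Qed.

Lemma opnormD S T : opnorm (S + T) <= opnorm S + opnorm T.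
Proof. by rewrite -lecR rmorphD/= !opnormE ler_normD. Qed.

Lemma opnorm0 : opnorm (0 : bop V) = 0.
Proof. by apply: complexI; rewrite opnormE normr0. Qed.

Lemma opnormN T : opnorm (- T) = opnorm T.
Proof. by apply: complexI; rewrite !opnormE normrN. Qed.

Lemma opnormB S T : opnorm (S - T) = opnorm (T - S).
Proof. by rewrite -opprB opnormN. Qed.

Lemma opnormZ a T : opnorm (a *: T) = cabs a * opnorm T.
Proof. by apply: complexI; rewrite rmorphM/= cabsE !opnormE normrZ. Qed.

Lemma opnorm_eq0 T : opnorm T = 0 -> T = 0.
Proof. by move=> T0; apply: normr0_eq0; rewrite -opnormE T0. Qed.

Lemma opnorm1_le : opnorm (1 : bop V) <= 1.
Proof. by apply: opnorm_least => // x; rewrite bop1E mul1r. Qed.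

Lemma opnormX T n : opnorm (T ^+ n) <= opnorm T ^+ n.
Proof.
elim: n => [|n IH]; first by rewrite !expr0 opnorm1_le.
by rewrite !exprS (le_trans (opnormM _ _))// ler_wpM2l// opnorm_ge0.
Qed.

Lemma opnorm_sum (I : Type) (r : seq I) (P : pred I) (F : I -> bop V) :
  opnorm (\sum_(i <- r | P i) F i) <= \sum_(i <- r | P i) opnorm (F i).
Proof.
elim/big_rec2: _ => [|i y x _ xy]; first by rewrite opnorm0.
by rewrite (le_trans (opnormD _ _))// lerD2l.
Qed.

Lemma opnorm_dist S T W : opnorm (S - T) <= opnorm (S - W) + opnorm (W - T).
Proof. by have := opnormD (S - W) (W - T); rewrite addrA subrK. Qed.

Lemma opnorm_leD S T : opnorm S <= opnorm T + opnorm (S - T).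
Proof. by have := opnormD T (S - T); rewrite addrC subrK addrC. Qed.

Lemma opnorm_le_mul S T (a b : R) : opnorm S <= a -> opnorm T <= b ->
  opnorm (S * T) <= a * b.
Proof.
move=> Sa Tb; apply: (le_trans (opnormM _ _)).
by apply: ler_pM; rewrite ?opnorm_ge0.
Qed.

Lemma bop_cvgP (F : nat -> bop V) (T : bop V) :
  F @ \oo --> T <->
  (forall e : R, 0 < e -> exists N, forall n, (N <= n)%N -> opnorm (F n - T) <= e).
Proof.
split=> [/cvgrPdist_le FT e e0|FT].
  have /FT : (0 : R[i]) < e%:C by rewrite ltcR.
  move=> [N _ NF]; exists N => n Nn.
  by have := NF n Nn; rewrite /= distrC -opnormE lecR.
apply/cvgrPdist_le => e e0.
have eE : (complex.Re e)%:C = e by rewrite RRe_real// gtr0_real.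
have /FT[N NF] : 0 < complex.Re e by rewrite -ltcR eE.
exists N => // n Nn /=.
by rewrite distrC -opnormE -eE lecR NF.
Qed.

Lemma opnorm_lim_le (F : nat -> bop V) (T : bop V) (B : R) :
  F @ \oo --> T -> (forall n, opnorm (F n) <= B) -> opnorm T <= B.
Proof.
move=> /bop_cvgP FT FB; apply/ler_addgt0Pr => e /FT[N /(_ N (leqnn _)) Ne].
by rewrite (le_trans (opnorm_leD T (F N)))// opnormB lerD.
Qed.

End opnorm_theory.

Lemma bop_cauchy_cvg (R : realType) (V : completeNormedModType R[i])
    (F : nat -> bop V) :
  (forall e : R, 0 < e -> exists N, forall n m, (N <= n)%N -> (N <= m)%N ->
     opnorm (F n - F m) <= e) ->
  exists T : bop V, F @ \oo --> T.
Proof.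
move=> Fc; apply/(@cvg_ex (bop V)).
apply: cauchy_cvg; apply: cauchy_exP => e e0.
have eE : (complex.Re e)%:C = e by rewrite RRe_real// gtr0_real.
have e2 : 0 < complex.Re e / 2 by rewrite divr_gt0// -ltcR eE.
have [N NF] := Fc _ e2; exists (F N); exists N => // n Nn /=.
rewrite -ball_normE /= -opnormE -eE ltcR (le_lt_trans (NF _ _ _ _))//.
by rewrite ltr_pdivrMr// ltr_pMr ?ltr1n// -ltcR eE.
Qed.

Section real_series.
Variable R : realType.
Implicit Types a b : ser R.

Definition psum a n : R := \sum_(i < n) a i.

Lemma psumS a n : psum a n.+1 = psum a n + a n.
Proof. by rewrite /psum big_ord_recr. Qed.

Lemma psum0 a : psum a 0 = 0. Proof. by rewrite /psum big_ord0. Qed.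

Lemma psum_ge0 a n : (forall i, 0 <= a i) -> 0 <= psum a n.
Proof. by move=> a0; apply: sumr_ge0 => i _. Qed.

Lemma le_psum a b n : (forall i, a i <= b i) -> psum a n <= psum b n.
Proof. by move=> ab; apply: ler_sum. Qed.

Lemma psum_mono a m n : (forall i, 0 <= a i) -> (m <= n)%N -> psum a m <= psum a n.
Proof.
move=> a0 /subnKC <-; elim: (n - m)%N => [|k IH]; rewrite ?addn0// addnS psumS.
by rewrite ler_wpDr.
Qed.

Lemma psumM_eq a b n : psum (a * b) n = \sum_(i < n) a i * psum b (n - i)%N.
Proof.
case: n => [|n]; first by rewrite /psum !big_ord0.
have psumE (c : ser R) m : psum c m.+1 = (c * (fun=> 1)) m.
  by rewrite serM /psum; apply: eq_bigr => i _; rewrite mulr1.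
rewrite psumE -mulrA serM; apply: eq_bigr => i _.
by rewrite -psumE -subSn// -ltnS.
Qed.

Lemma psumM a b n : (forall i, 0 <= a i) -> (forall i, 0 <= b i) ->
  psum (a * b) n <= psum a n * psum b n.
Proof.
move=> a0 b0; rewrite psumM_eq {2}/psum mulr_suml; apply: ler_sum => i _.
by rewrite ler_wpM2l// psum_mono// leq_subr.
Qed.

(** The square [[0, n)^2] lies in the triangle [i + j < 2n]. With [psum_tail] this makes the part of
    the square outside the triangle [i + j < n] small, as [tsumM] requires. *)
Lemma psumM_ge a b n : (forall i, 0 <= a i) -> (forall i, 0 <= b i) ->
  psum a n * psum b n <= psum (a * b) (n + n)%N.
Proof.
move=> a0 b0; rewrite psumM_eq big_split_ord /=.
rewrite -[leLHS]addr0 lerD//; last first.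
  by apply: sumr_ge0 => i _; rewrite mulr_ge0// psum_ge0.
rewrite {1}/psum mulr_suml; apply: ler_sum => i _.
by rewrite ler_wpM2l// psum_mono//; have := ltn_ord i; lia.
Qed.

Lemma psum_tail a B : (forall i, 0 <= a i) -> (forall n, psum a n <= B) ->
  forall e, 0 < e -> exists N, forall n m, (N <= n)%N -> (n <= m)%N ->
    psum a m - psum a n <= e.
Proof.
move=> a0 aB e e0; set S := [set psum a n | n in [set: nat]].
have Sup : has_sup S.
  by split; [exists (psum a 0), 0%N|exists B => _ [n _ <-]].
have [_ [N _ <-] SN] := sup_adherent e0 Sup.
exists N => n m Nn nm.
have mS : psum a m <= sup S by apply: ub_le_sup; [case: Sup|exists m].
have := psum_mono a0 Nn; lra.
Qed.

End real_series.

(** * Absolutely summable operator series and their values on the disc *)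

Section operator_series.
Context (R : realType) (V : completeNormedModType R[i]).
Local Notation U := (bop V).
Implicit Types (x y : ser U) (z : R[i]).

Definition nser x : ser R := fun n => opnorm (x n).

Lemma nser_ge0 x n : 0 <= nser x n. Proof. exact: opnorm_ge0. Qed.

Lemma nserM x y n : nser (x * y) n <= (nser x * nser y) n.
Proof.
rewrite /nser serM (le_trans (opnorm_sum _ _ _))//.
by apply: ler_sum => i _; exact: opnormM.
Qed.

Definition l1le x (B : R) := forall n, psum (nser x) n <= B.

Lemma l1le_ge0 x B : l1le x B -> 0 <= B.
Proof. by move=> /(_ 0%N); rewrite psum0. Qed.

Lemma l1leW x A B : A <= B -> l1le x A -> l1le x B.
Proof. by move=> AB xA n; exact: le_trans (xA n) AB. Qed.

Lemma l1leM x y A B : l1le x A -> l1le y B -> l1le (x * y) (A * B).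
Proof.
move=> xA yB n; apply: (le_trans (le_psum n (nserM x y))).
rewrite (le_trans (psumM _ (nser_ge0 x) (nser_ge0 y)))//.
by apply: ler_pM => //; apply: psum_ge0 => i; exact: nser_ge0.
Qed.

Lemma l1leD x y A B : l1le x A -> l1le y B -> l1le (x + y) (A + B).
Proof.
move=> xA yB n; apply: le_trans (lerD (xA n) (yB n)).
by rewrite /psum -big_split/=; apply: ler_sum => i _; exact: opnormD.
Qed.

Lemma l1le_term x B n : l1le x B -> opnorm (x n) <= B.
Proof.
move=> /(_ n.+1); rewrite psumS; apply: le_trans; rewrite lerDr.
by apply: psum_ge0 => i; exact: nser_ge0.
Qed.

Lemma l1le_mono k (T : U) : l1le (sermono k T) (opnorm T).
Proof.
move=> n; rewrite /psum; case: (ltnP k n) => kn; last first.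
  rewrite big1 ?opnorm_ge0// => i _; rewrite /nser /sermono ifN ?opnorm0//.
  by rewrite neq_ltn (leq_trans _ kn).
rewrite (bigD1 (Ordinal kn))//= /nser /sermono eqxx big1 ?addr0// => i ik.
by rewrite ifN ?opnorm0//; apply: contra ik => /eqP ik; apply/eqP/val_inj.
Qed.

Lemma l1le_1 : l1le 1 1.
Proof. by rewrite -sermono1; apply/(l1leW (opnorm1_le _))/l1le_mono. Qed.

Lemma l1leX x A k : l1le x A -> l1le (x ^+ k) (A ^+ k).
Proof.
move=> xA; elim: k => [|k IH]; first by rewrite !expr0; exact: l1le_1.
by rewrite !exprS; exact: l1leM.
Qed.

Definition osum x n : U := \sum_(i < n) x i.

Lemma osum_dist x m n : (m <= n)%N ->
  opnorm (osum x n - osum x m) <= psum (nser x) n - psum (nser x) m.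
Proof.
move=> /subnKC <-; elim: (n - m)%N => [|k IH]; first by rewrite addn0 !subrr opnorm0.
rewrite addnS psumS {1}/osum big_ord_recr/= -/(osum x _) addrAC [leRHS]addrAC.
by rewrite (le_trans (opnormD _ _))// lerD2r.
Qed.

Definition tsum x : U := lim (osum x @ \oo).

Lemma tsum_cvg x B : l1le x B -> osum x @ \oo --> tsum x.
Proof.
move=> xB; have [T FT] : exists T : U, osum x @ \oo --> T.
  apply: bop_cauchy_cvg => e e0.
  have [N HN] := psum_tail (nser_ge0 x) xB e0.
  exists N => n m Nn Nm; case: (leqP n m) => [nm|/ltnW mn].
    by rewrite opnormB (le_trans (osum_dist _ nm))// HN.
  by rewrite (le_trans (osum_dist _ mn))// HN.
by rewrite /tsum (cvg_lim _ FT).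
Qed.

Lemma tsum_eq x T : osum x @ \oo --> T -> tsum x = T.
Proof. by move=> FT; rewrite /tsum (cvg_lim _ FT). Qed.

Lemma osum_norm x B n : l1le x B -> opnorm (osum x n) <= B.
Proof. by move=> xB; rewrite (le_trans (opnorm_sum _ _ _))//; exact: xB. Qed.

Lemma tsum_norm x B : l1le x B -> opnorm (tsum x) <= B.
Proof. by move=> xB; apply: (opnorm_lim_le (tsum_cvg xB)) => n; exact: osum_norm. Qed.

Lemma osumM_eq x y n : osum (x * y) n = \sum_(i < n) x i * osum y (n - i)%N.
Proof.
case: n => [|n]; first by rewrite /osum !big_ord0.
have osumE (c : ser U) m : osum c m.+1 = (c * (fun=> 1)) m.
  by rewrite serM /osum; apply: eq_bigr => i _; rewrite mulr1.
rewrite osumE -mulrA serM; apply: eq_bigr => i _.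
by rewrite -osumE -subSn// -ltnS.
Qed.

Lemma osumM_dist x y n : opnorm (osum x n * osum y n - osum (x * y) n) <=
  psum (nser x) n * psum (nser y) n - psum (nser x * nser y) n.
Proof.
rewrite osumM_eq psumM_eq {1}/osum mulr_suml -sumrB {1}/psum mulr_suml -sumrB.
rewrite (le_trans (opnorm_sum _ _ _))//; apply: ler_sum => i _.
rewrite -!mulrBr (le_trans (opnormM _ _))// ler_wpM2l ?opnorm_ge0//.
by apply: osum_dist; exact: leq_subr.
Qed.

Lemma bop_cvgM (F G : nat -> U) (S T : U) :
  F @ \oo --> S -> G @ \oo --> T -> (fun n => F n * G n) @ \oo --> S * T.
Proof.
move=> /bop_cvgP FS /bop_cvgP GT; apply/bop_cvgP => e e0.
pose d := Num.min 1 (e / (1 + opnorm S + opnorm T)).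
have p0 : 0 < 1 + opnorm S + opnorm T.
  by rewrite -addrA ltr_wpDr// addr_ge0// opnorm_ge0.
have d0 : 0 < d by rewrite lt_min ltr01 divr_gt0.
have [M HM] := FS d d0; have [N HN] := GT d d0.
exists (maxn M N) => n; rewrite geq_max => /andP[/HM Fn /HN Gn].
have -> : F n * G n - S * T = (F n - S) * (G n - T) + (F n - S) * T + S * (G n - T).
  by rewrite -mulrDr subrK mulrBl mulrBr addrA subrK.
rewrite (le_trans (opnormD _ _))//.
rewrite (@le_trans _ _ (d * (1 + opnorm S + opnorm T)))//; last first.
  by rewrite -ler_pdivlMr// ge_min lexx orbT.
rewrite (_ : d * _ = d * 1 + d * opnorm T + opnorm S * d); last by ring.
apply: lerD; last exact: opnorm_le_mul.
rewrite (le_trans (opnormD _ _))// lerD//; last by rewrite opnorm_le_mul.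
by rewrite opnorm_le_mul// (le_trans Gn)// ge_min lexx.
Qed.

Lemma tsumM x y A B : l1le x A -> l1le y B -> tsum (x * y) = tsum x * tsum y.
Proof.
move=> xA yB; apply: tsum_eq.
have /bop_cvgP xy := bop_cvgM (tsum_cvg xA) (tsum_cvg yB).
apply/bop_cvgP => e e0; have e2 : 0 < e / 2 by rewrite divr_gt0.
have [M HM] := xy _ e2.
have ab0 i : 0 <= (nser x * nser y) i.
  by rewrite serM; apply: sumr_ge0 => j _; rewrite mulr_ge0// nser_ge0.
have abAB n : psum (nser x * nser y) n <= A * B.
  rewrite (le_trans (psumM _ (nser_ge0 x) (nser_ge0 y)))//.
  by apply: ler_pM => //; apply: psum_ge0 => i; exact: nser_ge0.
have [N HN] := psum_tail ab0 abAB e2.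
exists (maxn M N) => n; rewrite geq_max => /andP[Mn Nn].
rewrite (le_trans (opnorm_dist _ _ (osum x n * osum y n)))// (splitr e) lerD//; last first.
  exact: HM.
(* Mertens' argument: the product of the partial sums differs from the partial sum of the product by
   at most the terms of [nser x * nser y] with index in [[n, 2n)]. *)
rewrite opnormB (le_trans (osumM_dist x y n))//.
have := psumM_ge n (nser_ge0 x) (nser_ge0 y).
by have := HN n (n + n)%N Nn (leq_addr _ _); lra.
Qed.

Lemma tsum_mono0 T : tsum (sermono 0 T) = T.
Proof.
apply: tsum_eq; apply/bop_cvgP => e e0; exists 1%N => -[//|n] _.
rewrite /osum big_ord_recl big1 ?addr0; first by rewrite subrr opnorm0 ltW.
by move=> i _.
Qed.

Definition twist z x : ser U := fun n => z ^+ n *: x n.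

Lemma twistM z x y : twist z (x * y) = twist z x * twist z y.
Proof.
apply/funext => n; rewrite /twist !serM scaler_sumr; apply: eq_bigr => i _.
rewrite -bop_scalerAl -bop_scalerAr scalerA -exprD subnKC//.
by rewrite -ltnS.
Qed.

Lemma twist_mono0 z T : twist z (sermono 0 T) = sermono 0 T.
Proof.
by apply/funext => -[|n]; rewrite /twist /sermono/= ?expr0 ?scale1r ?scaler0.
Qed.

Lemma nser_twist z x n : nser (twist z x) n = cabs z ^+ n * nser x n.
Proof. by rewrite /nser /twist opnormZ cabsX. Qed.

Lemma nser_twist_le z x n : cabs z <= 1 -> nser (twist z x) n <= nser x n.
Proof.
by move=> z1; rewrite nser_twist ler_piMl ?nser_ge0// exprn_ile1// cabs_ge0.
Qed.

Lemma l1le_twist z x B : cabs z <= 1 -> l1le x B -> l1le (twist z x) B.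
Proof.
by move=> z1 xB n; apply: le_trans (xB n); apply: le_psum => i; exact: nser_twist_le.
Qed.

Definition ev x z : U := tsum (twist z x).

Lemma ev_norm x B z : cabs z <= 1 -> l1le x B -> opnorm (ev x z) <= B.
Proof. by move=> z1 xB; exact/tsum_norm/l1le_twist. Qed.

Lemma evM x y A B z : cabs z <= 1 -> l1le x A -> l1le y B ->
  ev (x * y) z = ev x z * ev y z.
Proof. by move=> z1 xA yB; rewrite /ev twistM; apply: tsumM; exact: l1le_twist. Qed.

Lemma ev_mono0 T z : ev (sermono 0 T) z = T.
Proof. by rewrite /ev twist_mono0 tsum_mono0. Qed.

Lemma ev1 z : ev 1 z = 1.
Proof. by rewrite -sermono1 ev_mono0. Qed.

Lemma evX x A k z : cabs z <= 1 -> l1le x A -> ev (x ^+ k) z = ev x z ^+ k.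
Proof.
move=> z1 xA; elim: k => [|k IH]; first by rewrite !expr0 ev1.
by rewrite !exprS (evM z1 xA (@l1leX x A k xA)) IH.
Qed.

Lemma ev_tail x B N e z : l1le x B -> cabs z <= 1 ->
  (forall m, (N <= m)%N -> psum (nser x) m - psum (nser x) N <= e) ->
  opnorm (ev x z - osum (twist z x) N) <= e.
Proof.
move=> xB z1 HN; have /bop_cvgP cz := tsum_cvg (l1le_twist z1 xB).
apply/ler_addgt0Pr => f /cz[M HM].
have := HM (maxn M N) (leq_maxl _ _).
rewrite opnormB => Mf; rewrite [leRHS]addrC.
rewrite (le_trans (opnorm_dist _ _ (osum (twist z x) (maxn M N))))// lerD//.
rewrite (le_trans (osum_dist _ (leq_maxr _ _)))//.
apply: le_trans (HN _ (leq_maxr M N)).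
rewrite -(subnKC (leq_maxr M N)); elim: (maxn M N - N)%N => [|k IH].
  by rewrite addn0 !subrr.
rewrite addnS !psumS; have := nser_twist_le x (N + k) z1; lra.
Qed.

(** Beyond [N] each series contributes at most [e / 4], uniformly on the disc; the polynomial part
    is Lipschitz with constant [N * B], by [cabs_subX]. *)
Lemma ev_unif x B : l1le x B -> forall e, 0 < e -> exists2 d : R, 0 < d &
  forall z w, cabs z <= 1 -> cabs w <= 1 -> cabs (z - w) <= d ->
    opnorm (ev x z - ev x w) <= e.
Proof.
move=> xB e e0; have e4 : 0 < e / 4 by rewrite divr_gt0.
have [N HN] := psum_tail (nser_ge0 x) xB e4.
have tail z : cabs z <= 1 -> opnorm (ev x z - osum (twist z x) N) <= e / 4.
  by move=> z1; apply: (ev_tail xB z1) => m; exact: HN.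
have B0 := l1le_ge0 xB.
have NB0 : 0 < N%:R * B + 1 by rewrite ltr_wpDl// mulr_ge0.
exists (e / 2 / (N%:R * B + 1)); first by rewrite !divr_gt0.
move=> z w z1 w1 zw.
rewrite (_ : e = e / 4 + (e / 2 + e / 4)); last by field.
rewrite (le_trans (opnorm_dist _ _ (osum (twist z x) N)))// lerD ?tail//.
rewrite (le_trans (opnorm_dist _ _ (osum (twist w x) N)))// lerD//; last first.
  by rewrite opnormB tail.
rewrite /osum -sumrB (le_trans (opnorm_sum _ _ _))//.
apply: (@le_trans _ _ (\sum_(i < N) N%:R * cabs (z - w) * nser x i)).
  apply: ler_sum => i _; rewrite /twist -scalerBl opnormZ ler_wpM2r ?opnorm_ge0//.
  rewrite (le_trans (cabs_subX _ z1 w1))// ler_wpM2r ?cabs_ge0// ler_nat.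
  exact/ltnW/ltn_ord.
rewrite -mulr_sumr mulrAC.
apply: (@le_trans _ _ ((N%:R * B + 1) * cabs (z - w))).
  rewrite ler_wpM2r ?cabs_ge0// ler_wpDr// ler_wpM2l//; exact: xB.
by rewrite mulrC -ler_pdivlMr.
Qed.

End operator_series.

(** * Wiener's lemma *)

Section unit_circle.
Variable R : realType.

Definition expi (t : R) : R[i] := cos t +i* sin t.

Lemma expiD s t : expi (s + t) = expi s * expi t.
Proof. by apply/eqP; rewrite eq_complex /= cosD sinD; apply/andP; split; apply/eqP; ring. Qed.

Lemma expi0 : expi 0 = 1.
Proof. by rewrite /expi cos0 sin0. Qed.

Lemma expiX t n : expi t ^+ n = expi (n%:R * t).
Proof.
elim: n => [|n IH]; first by rewrite expr0 mul0r expi0.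
by rewrite exprS IH -expiD -natr1 mulrDl mul1r addrC.
Qed.

Lemma cabs_expi t : cabs (expi t) = 1.
Proof.
have /eqP := cabs_sq (expi t); rewrite /= cos2Dsin2 sqrf_eq1 => /orP[/eqP//|/eqP h].
by have := cabs_ge0 (expi t); rewrite h; lra.
Qed.

Lemma sin_le_id (x : R) : 0 <= x -> sin x <= x.
Proof.
rewrite le_eqVlt => /predU1P[<-|x0]; first by rewrite sin0.
have [|c _] := @MVT R sin cos 0 x x0 (fun y _ => is_derive_sin y).
  by apply: continuous_subspaceT => y; exact: continuous_sin.
rewrite sin0 !subr0 => ->; by rewrite ler_piMl ?cos_le1// ltW.
Qed.

Lemma cabs_1B_expi t : 0 <= t -> t <= pi -> cabs (1 - expi t) <= t.
Proof.
move=> t0 tpi; have t20 : 0 <= t / 2 by rewrite divr_ge0.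
have E : cabs (1 - expi t) ^+ 2 = (2 * sin (t / 2)) ^+ 2.
  rewrite cabs_sq /= (_ : t = (t / 2) *+ 2); last by rewrite -mulr_natr divfK.
  rewrite (_ : (t / 2 *+ 2) / 2 = t / 2); last by rewrite -mulr_natr mulfK.
  rewrite cos_mulr2n sin_mulr2n sub0r sqrrN.
  have := cos2Dsin2 (t / 2); set c := cos _; set s := sin _ => cs.
  have -> : 1 - (c ^+ 2 *+ 2 - 1) = 2 * s ^+ 2 by rewrite -mulr_natr; lra.
  transitivity (4 * s ^+ 2 * (c ^+ 2 + s ^+ 2)); first by rewrite -mulr_natr; ring.
  by rewrite cs; ring.
have s0 : 0 <= sin (t / 2) by apply: sin_ge0_pi; lra.
have : cabs (1 - expi t) = 2 * sin (t / 2).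
  by apply/eqP; rewrite -(@eqrXn2 _ 2%N) ?cabs_ge0 ?mulr_ge0// E.
by move=> ->; have := sin_le_id t20; lra.
Qed.

Definition zeta (M : nat) : R[i] := expi (2 * pi / M%:R).

Lemma cabs_zetaX M n : cabs (zeta M ^+ n) = 1.
Proof. by rewrite cabsX cabs_expi expr1n. Qed.

Lemma zetaM M : (0 < M)%N -> zeta M ^+ M = 1.
Proof.
move=> M0; rewrite /zeta expiX mulrC divfK ?pnatr_eq0 -?lt0n//.
by rewrite /expi mulrC mulr_natr cos2pi sin2pi.
Qed.

Lemma zetaX_mod M n : (0 < M)%N -> zeta M ^+ (n %% M) = zeta M ^+ n.
Proof.
by move=> M0; rewrite {2}(divn_eq n M) exprD mulnC exprM zetaM// expr1n mul1r.
Qed.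

Lemma zeta_neq0 M n : zeta M ^+ n != 0.
Proof. by rewrite -cabs_eq0 cabs_zetaX oner_eq0. Qed.

Lemma zetaX_neq1 M n : (0 < n < M)%N -> zeta M ^+ n != 1.
Proof.
move=> /andP[n0 nM]; have M0 : (0 < M)%N by exact: ltn_trans nM.
rewrite /zeta expiX; pose t : R := n%:R * pi / M%:R.
have Mr : (0 : R) < M%:R by rewrite ltr0n.
have -> : n%:R * (2 * pi / M%:R) = t *+ 2 :> R by rewrite -mulr_natr /t; field; lra.
have t0 : 0 < t by rewrite divr_gt0// mulr_gt0 ?pi_gt0 ?ltr0n.
have tpi : t < pi by rewrite ltr_pdivrMr// mulrC ltr_pM2l ?pi_gt0// ltr_nat.
have st : 0 < sin t by apply: sin_gt0_pi; rewrite t0.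
apply/eqP => /(congr1 (@complex.Re R)); rewrite /= cos_mulr2n.
have := cos2Dsin2 t; have : 0 < sin t ^+ 2 by rewrite exprn_gt0.
by rewrite mulr2n; lra.
Qed.

Lemma zeta_orth M n m : (n < M)%N -> (m < M)%N ->
  \sum_(j < M) (zeta M ^+ j) ^+ n * (zeta M ^+ j) ^- m = M%:R * (n == m)%:R.
Proof.
move=> nM mM; have M0 : (0 < M)%N by exact: leq_ltn_trans nM.
pose q := zeta M ^+ n / zeta M ^+ m.
have -> : \sum_(j < M) (zeta M ^+ j) ^+ n * (zeta M ^+ j) ^- m = \sum_(j < M) q ^+ j.
  by apply: eq_bigr => j _; rewrite /q expr_div_n -!exprM [(j * n)%N]mulnC [(j * m)%N]mulnC.
have [nm|nm] := eqVneq n m.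
  rewrite (eq_bigr (fun=> 1)); last by move=> j _; rewrite /q nm divff ?zeta_neq0 ?expr1n.
  by rewrite sumr_const card_ord mulr1.
rewrite mulr0.
have q1 : q != 1.
  rewrite /q -subr_eq0 -[X in _ - X](divff (zeta_neq0 M m)) -mulrBl mulf_neq0//;
    last by rewrite invr_eq0 zeta_neq0.
  rewrite subr_eq0; case: (ltngtP n m) nm => // nm _.
    rewrite -(subnKC (ltnW nm)) exprD -{1}[zeta M ^+ n]mulr1.
    rewrite (inj_eq (mulfI (zeta_neq0 M n))) eq_sym zetaX_neq1//; lia.
  rewrite -(subnKC (ltnW nm)) exprD -{2}[zeta M ^+ m]mulr1.
  by rewrite (inj_eq (mulfI (zeta_neq0 M m))) zetaX_neq1//; lia.
have qM : q ^+ M = 1 by rewrite /q expr_div_n -!exprM ![(_ * M)%N]mulnC !exprM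
  zetaM// !expr1n divr1.
have : (q - 1) * (\sum_(j < M) q ^+ j) = 0 by rewrite -subrX1 qM subrr.
by move/eqP; rewrite mulf_eq0 subr_eq0 (negbTE q1) => /eqP.
Qed.

Lemma zeta_orth0 M n : (n < M)%N ->
  \sum_(j < M) (zeta M ^+ j) ^+ n = M%:R * (n == 0)%:R.
Proof.
move=> nM; rewrite -(zeta_orth nM (leq_ltn_trans (leq0n n) nM)).
by apply: eq_bigr => j _; rewrite expr0 invr1 mulr1.
Qed.

Lemma cabs_1B_zeta M : (2 <= M)%N -> cabs (1 - zeta M) <= 8 / M%:R.
Proof.
move=> M2; have Mr : (0 : R) < M%:R by rewrite ltr0n; lia.
have M2r : (2 : R) <= M%:R by rewrite ler_nat.
apply: (@le_trans _ _ (2 * pi / M%:R)).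
  apply: cabs_1B_expi; first by rewrite !mulr_ge0 ?pi_ge0// invr_ge0 ltW.
  by rewrite ler_pdivrMr// mulrC ler_wpM2l ?pi_ge0.
by rewrite ler_pM2r ?invr_gt0//; have := @pihalf_lt2 R; lra.
Qed.

Lemma conj_circle (w : R[i]) : cabs w = 1 -> (w^*)%C = w^-1.
Proof.
move=> w1; have w0 : w != 0 by rewrite -cabs_eq0 w1 oner_eq0.
apply: (mulfI w0); rewrite divff// -sqr_normc -cabsE w1 expr1n//.
Qed.

Lemma cabs_sqC (w : R[i]) : (cabs w ^+ 2)%:C = w * (w^*)%C.
Proof. by rewrite rmorphXn /= cabsE sqr_normc. Qed.

Lemma parseval M (c : nat -> R[i]) :
  \sum_(j < M) cabs (\sum_(n < M) (zeta M ^+ j) ^+ n * c n) ^+ 2 =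
  M%:R * \sum_(n < M) cabs (c n) ^+ 2.
Proof.
apply: complexI; rewrite rmorphM/= !rmorph_sum/= rmorph_nat.
transitivity (\sum_(j < M) \sum_(n < M) \sum_(m < M)
   (c n * (c m)^*%C * ((zeta M ^+ j) ^+ n * (zeta M ^+ j) ^- m))).
  apply: eq_bigr => j _; rewrite cabs_sqC rmorph_sum /= mulr_suml.
  apply: eq_bigr => n _; rewrite mulr_sumr; apply: eq_bigr => m _.
  rewrite rmorphM /= (@conj_circle (zeta M ^+ j ^+ m)).
    by rewrite mulrACA [in RHS]mulrC.
  by rewrite cabsX cabs_zetaX expr1n.
rewrite exchange_big /= mulr_sumr; apply: eq_bigr => n _.
rewrite exchange_big /= (bigD1 n)//= [X in _ + X]big1 ?addr0.
  by rewrite -mulr_sumr zeta_orth// eqxx mulr1 cabs_sqC mulrC.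
move=> m mn; rewrite -mulr_sumr zeta_orth//.
by rewrite (_ : (n == m :> nat)%N = false) ?mulr0//; apply/negbTE; rewrite eq_sym.
Qed.

End unit_circle.

(** * Averages over windows centred at roots of unity *)

Section windows.
Context (R : realType) (V : completeNormedModType R[i]).
Local Notation U := (bop V).
Variables (M : nat) (r : R).
Hypotheses (M0 : (0 < M)%N) (r0 : 0 <= r) (r1 : r < 1).
Implicit Types (x y : nat -> U) (a z : R[i]).
Local Notation zeta := (zeta R M).

Definition pe y z : U := \sum_(n < M) z ^+ n *: y n.

Definition mx y : R := \big[Num.max/0]_(s < M) opnorm (pe y (zeta ^+ s)).

Lemma mx_ge y s : opnorm (pe y (zeta ^+ s)) <= mx y.
Proof.
rewrite -(zetaX_mod R s M0).
exact: (le_bigmax_cond _ (fun s : 'I_M => opnorm (pe y (zeta ^+ s)))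
  (isT : xpredT (Ordinal (ltn_pmod s M0)))).
Qed.

Lemma mx_le y B : 0 <= B -> (forall s, opnorm (pe y (zeta ^+ s)) <= B) -> mx y <= B.
Proof. by move=> B0 yB; apply/bigmax_leP; split=> // s _. Qed.

Lemma mx_ge0 y : 0 <= mx y.
Proof. exact: le_trans (opnorm_ge0 _) (mx_ge y 0). Qed.

Lemma eq_mx x y : (forall n, (n < M)%N -> x n = y n) -> mx x = mx y.
Proof.
move=> xy; apply: eq_bigr => s _; congr opnorm; apply: eq_bigr => n _.
by rewrite xy.
Qed.

Lemma mxD x y : mx (fun n => x n + y n) <= mx x + mx y.
Proof.
apply: mx_le => [|s]; first by rewrite addr_ge0// mx_ge0.
rewrite /pe (eq_bigr (fun n : 'I_M => (zeta ^+ s) ^+ n *: x n + (zeta ^+ s) ^+ n *: y n)).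
  by rewrite big_split /= (le_trans (opnormD _ _))// lerD// mx_ge.
by move=> n _; rewrite scalerDr.
Qed.

Lemma mxZ c x : mx (fun n => c *: x n) <= cabs c * mx x.
Proof.
apply: mx_le => [|s]; first by rewrite mulr_ge0 ?cabs_ge0 ?mx_ge0.
rewrite /pe (eq_bigr (fun n : 'I_M => c *: ((zeta ^+ s) ^+ n *: x n))); last first.
  by move=> n _; rewrite !scalerA mulrC.
by rewrite -scaler_sumr opnormZ ler_wpM2l ?cabs_ge0// mx_ge.
Qed.

Lemma mx_rot x : mx (fun n => zeta ^+ n *: x n) <= mx x.
Proof.
apply: mx_le => [|s]; first exact: mx_ge0.
rewrite (_ : pe _ _ = pe x (zeta ^+ s.+1)) ?mx_ge//.
by apply: eq_bigr => n _; rewrite scalerA exprSr exprMn.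
Qed.

Lemma mx_coef y n : (n < M)%N -> opnorm (y n) <= mx y.
Proof.
move=> nM; have Mr : (0 : R) < M%:R by rewrite ltr0n.
have E : M%:R *: y n = \sum_(j < M) (zeta ^+ j) ^- n *: pe y (zeta ^+ j).
  rewrite (eq_bigr (fun j : 'I_M => \sum_(m < M)
      ((zeta ^+ j) ^+ m * (zeta ^+ j) ^- n) *: y m)); last first.
    move=> j _; rewrite scaler_sumr; apply: eq_bigr => m _.
    by rewrite scalerA mulrC.
  rewrite exchange_big /= (bigD1 (Ordinal nM))//= [X in _ + X]big1 ?addr0.
    by rewrite -scaler_suml zeta_orth// eqxx mulr1.
  move=> m mn; rewrite -scaler_suml zeta_orth//.
  by rewrite (_ : (m == n :> nat)%N = false) ?mulr0 ?scale0r//; apply/negbTE.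
rewrite -(ler_pM2l Mr).
have -> : M%:R * opnorm (y n) = opnorm (M%:R *: y n :> U).
  by rewrite opnormZ cabs_nat.
rewrite E (le_trans (opnorm_sum _ _ _))//.
apply: (@le_trans _ _ (\sum_(j < M) mx y)); last by rewrite sumr_const card_ord mulr_natl.
apply: ler_sum => j _.
by rewrite opnormZ cabsV cabsX cabs_zetaX expr1n invr1 mul1r mx_ge.
Qed.

Definition den a n : R[i] := 1 - r%:C * (zeta ^+ n * a).

Lemma den_shift a n : den (a * zeta) n = den a n.+1.
Proof. by rewrite /den exprSr -mulrA [zeta * a]mulrC. Qed.

Lemma cabs_den_ge a n : cabs a = 1 -> 1 - r <= cabs (den a n).
Proof.
move=> a1; apply: le_trans (cabs_sub_ge _ _).
by rewrite cabs1 !cabsM cabs_real cabs_zetaX a1 !mulr1 ger0_norm.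
Qed.

Lemma den_neq0 a n : cabs a = 1 -> den a n != 0.
Proof.
move=> a1; rewrite -cabs_eq0 gt_eqF//.
by rewrite (lt_le_trans _ (cabs_den_ge n a1))// subr_gt0.
Qed.

(** Multiplication by [(1 - r zeta^n a)^-1] is a geometric sum of rotations, none of which increases
    [mx]. The series is summed implicitly: [y] equals [x] plus [r a] times the rotation of [y],
    whence [mx y <= mx x + r * mx y]. *)
Lemma mx_damp a x : cabs a = 1 ->
  mx (fun n => (den a n)^-1 *: x n) <= mx x / (1 - r).
Proof.
move=> a1; set y := fun n => _.
rewrite ler_pdivlMr ?subr_gt0//.
suff : mx y <= mx x + r * mx y by lra.
apply: mx_le => [|s]; first by rewrite addr_ge0 ?mulr_ge0 ?mx_ge0.
have -> : pe y (zeta ^+ s) = pe x (zeta ^+ s) + (r%:C * a) *: pe y (zeta ^+ s.+1).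
  rewrite /pe scaler_sumr -big_split /=; apply: eq_bigr => n _.
  have -> : x n = den a n *: y n by rewrite /y scalerA divff ?den_neq0// scale1r.
  rewrite !scalerA -scalerDl; congr (_ *: _).
  by rewrite /den exprSr exprMn; ring.
rewrite (le_trans (opnormD _ _))// lerD ?mx_ge//.
by rewrite opnormZ cabsM a1 mulr1 cabs_real ger0_norm// ler_wpM2l ?mx_ge.
Qed.

(** Bounds the relative change of [den] between neighbouring windows. For [1 - r = c / M] it is at
    most [8 / c], uniformly in [M]. *)
Definition eps : R := cabs (1 - zeta) / (1 - r).

Lemma eps_ge0 : 0 <= eps.
Proof. by rewrite divr_ge0 ?cabs_ge0// subr_ge0 ltW. Qed.

Lemma mx_ratio a x : cabs a = 1 ->
  mx (fun n => (den a n / den a n.+1 - 1) *: x n) <= eps * mx x.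
Proof.
move=> a1.
rewrite (@eq_mx _ (fun n => (r%:C * a * (zeta - 1)) *: (zeta ^+ n *: ((den a n.+1)^-1 *: x n)))).
  rewrite (le_trans (mxZ _ _))//.
  have az1 : cabs (a * zeta) = 1 by rewrite cabsM a1 cabs_expi mulr1.
  have h : mx (fun n => (den a n.+1)^-1 *: x n) <= mx x / (1 - r).
    rewrite (le_trans _ (mx_damp x az1))// (@eq_mx _ (fun n => (den (a * zeta) n)^-1 *: x n))// => n _.
    by rewrite den_shift.
  rewrite (@le_trans _ _ (cabs (r%:C * a * (zeta - 1)) * (mx x / (1 - r))))//.
    by apply: ler_wpM2l; rewrite ?cabs_ge0//; exact: le_trans (mx_rot _) h.
  rewrite !cabsM a1 mulr1 cabs_real ger0_norm// cabsB /eps.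
  rewrite (_ : _ / _ * _ = cabs (1 - zeta) * (mx x / (1 - r))); last by ring.
  have p0 : 0 <= cabs (1 - zeta) * (mx x / (1 - r)).
    by rewrite mulr_ge0 ?cabs_ge0// divr_ge0 ?mx_ge0// subr_ge0 ltW.
  by rewrite -mulrA ler_piMl// ltW.
move=> n _; rewrite !scalerA; congr (_ *: _).
rewrite -[X in _ - X](divff (den_neq0 n.+1 a1)) -mulrBl.
congr (_ / _).
by rewrite /den exprSr; ring.
Qed.

(* The window centred at the root of unity a^-1 is n |-> (1 - r zeta^n a)^-2: multiplying
   by a window or by a ratio of two neighbouring windows averages rotations of z. *)
Definition win a x : nat -> U := fun n => (den a n ^- 2) *: x n.

(** If [1 + c n] is the ratio of the two denominators, the difference is the window [a] multiplied
    by [(1 + c)^2 - 1 = c^2 + 2 c], and [mx_ratio] bounds each multiplication by [c]. *)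
Lemma mx_win_shift1 a x : cabs a = 1 ->
  mx (fun n => win (a * zeta) x n - win a x n) <= eps * (eps + 2) * mx (win a x).
Proof.
move=> a1; pose c n := den a n / den a n.+1 - 1.
rewrite (@eq_mx _ (fun n => c n *: (c n *: win a x n) + 2 *: (c n *: win a x n))).
  rewrite (le_trans (mxD _ _))// mulrDr mulrDl lerD//.
    rewrite (le_trans (mx_ratio _ a1))// -mulrA ler_wpM2l ?eps_ge0//.
    exact: mx_ratio.
  rewrite (le_trans (mxZ _ _))// cabs_nat [_ * 2]mulrC -mulrA ler_wpM2l//.
  exact: mx_ratio.
move=> n _; rewrite /win -scalerBl !scalerA -scalerDl; congr (_ *: _).
rewrite den_shift /c; have := den_neq0 n a1; have := den_neq0 n.+1 a1.
move: (den a n) (den a n.+1) => u v v0 u0; field.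
by rewrite u0 v0.
Qed.

Definition S x i : R := mx (win (zeta ^+ i) x).

Lemma S_ge0 x i : 0 <= S x i. Proof. exact: mx_ge0. Qed.

Lemma mx_win_shift x i j :
  mx (fun n => win (zeta ^+ (i + j)) x n - win (zeta ^+ i) x n) <=
  eps * (eps + 2) * \sum_(l < j) S x (i + l)%N.
Proof.
elim: j => [|j IH].
  rewrite big_ord0 mulr0; apply: mx_le => // s; rewrite /pe big1 ?opnorm0// => n _.
  by rewrite addn0 subrr scaler0.
rewrite big_ord_recr /= mulrDr addrC.
rewrite (@eq_mx _ (fun n =>
  (win (zeta ^+ (i + j) * zeta) x n - win (zeta ^+ (i + j)) x n) +
  (win (zeta ^+ (i + j)) x n - win (zeta ^+ i) x n))); last first.
  by move=> n _; rewrite addrA subrK addnS exprSr.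
rewrite (le_trans (mxD _ _))// lerD//.
by apply: mx_win_shift1; rewrite cabs_zetaX.
Qed.

(** A substitute for the l^1 norm that responds to values on the circle: [star_coef] bounds the l^1
    norm by [(1 - r)^2 * star], and by [star1] this loses only a factor of order [M * (1 - r)] at
    the series [1], which stays bounded when [1 - r = c / M]. *)
Definition star x : R := \sum_(i < M) S x i.

Lemma S_period x i : S x (i + M)%N = S x i.
Proof. by rewrite /S exprD zetaM// mulr1. Qed.

Lemma star_shift x j : \sum_(i < M) S x (i + j)%N = star x.
Proof.
elim: j => [|j <-]; first by apply: eq_bigr => i _; rewrite addn0.
case: M M0 (S_period x) => // m _ per.
rewrite big_ord_recr [RHS]big_ord_recl /= addrC; congr (_ + _).
  by rewrite add0n -addSnnS addnC per.
by apply: eq_bigr => i _; rewrite /bump add1n addnS.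
Qed.

Lemma star_ge0 x : 0 <= star x.
Proof. by apply: sumr_ge0 => i _; exact: S_ge0. Qed.

Lemma star_coef x : \sum_(n < M) opnorm (x n) <= (1 - r) ^+ 2 * star x.
Proof.
rewrite -(star_shift x 1) (reindex_inj rev_ord_inj) /= mulr_sumr.
apply: ler_sum => i _; rewrite addn1.
(* The coefficient [n] is read in the window [i.+1 = M - n], where [den] takes its smallest absolute
   value [1 - r]. *)
set n := (M - i.+1)%N.
have nM : (n < M)%N by rewrite /n; have := ltn_ord i; lia.
have := mx_coef (win (zeta ^+ i.+1) x) nM.
have -> : win (zeta ^+ i.+1) x n = (1 - r)%:C ^- 2 *: x n.
  rewrite /win /den -exprD (_ : (n + i.+1)%N = M) ?zetaM ?mulr1 ?rmorphB ?rmorph1//.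
  by rewrite /n; have := ltn_ord i; lia.
rewrite opnormZ cabsV cabsX cabs_real ger0_norm ?subr_ge0 ?(ltW r1)//.
by rewrite ler_pdivrMl// exprn_gt0// subr_gt0.
Qed.

(** The exponent 2 of the windows makes this a Parseval sum: [p j] is the truncated geometric series
    [(1 - r^M) / (1 - r zeta^j)], and the squares of its [M] values sum to at most [M / (1 - r)]. *)
Lemma star1 : star (1 : ser U) <= M%:R / ((1 - r) * (1 - r ^+ M) ^+ 2).
Proof.
have rM : r ^+ M < 1 by rewrite exprn_ilt1// -lt0n.
have r10 : 0 < 1 - r by rewrite subr_gt0.
have rM0 : 0 < 1 - r ^+ M by rewrite subr_gt0.
pose p j := \sum_(n < M) (zeta ^+ j) ^+ n * (r ^+ n)%:C.
have pE j : (1 - r%:C * zeta ^+ j) * p j = (1 - r ^+ M)%:C.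
  have -> : p j = \sum_(n < M) (r%:C * zeta ^+ j) ^+ n.
    by apply: eq_bigr => n _; rewrite exprMn mulrC rmorphXn.
  rewrite -[1 - _]opprB mulNr -subrX1 opprB exprMn -exprM mulnC exprM zetaM//.
  by rewrite expr1n mulr1 rmorphB rmorph1 rmorphXn.
have SE (i : 'I_M) : S (1 : ser U) i <= (1 - r ^+ M) ^- 2 * cabs (p i) ^+ 2.
  have a1 : cabs (zeta ^+ i) = 1 by rewrite cabs_zetaX.
  have d0 := den_neq0 0 a1; rewrite /den expr0 mul1r in d0.
  apply: mx_le => [|s]; first by rewrite mulr_ge0 ?invr_ge0 ?exprn_ge0 ?cabs_ge0// ltW.
  rewrite /pe (bigD1 (Ordinal M0))//= big1 ?addr0; last first.
    by move=> n n0; rewrite /win ser1E (_ : (n == 0 :> nat) = false) ?scaler0 ?scaler0//; apply/negbTE.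
  rewrite expr0 scale1r /win ser1E eqxx opnormZ.
  rewrite -[leRHS]mulr1; apply: ler_pM; rewrite ?cabs_ge0 ?opnorm_ge0 ?opnorm1_le//.
  rewrite /den expr0 mul1r.
  have -> : (1 - r%:C * zeta ^+ i) = (1 - r ^+ M)%:C / p i.
    rewrite -(pE i) mulfK//; apply/eqP => p0.
    by have := pE i; rewrite p0 mulr0 => /(congr1 (@complex.Re R)) /= E0; rewrite -E0 ltxx in rM0.
  rewrite cabsV cabsX cabsM cabsV cabs_real ger0_norm ?(ltW rM0)//.
  by rewrite expr_div_n invf_div mulrC.
rewrite (le_trans (ler_sum _ (fun i _ => SE i)))// -mulr_sumr /p.
rewrite (parseval M (fun n => (r ^+ n)%:C)).
have geo : (1 - r) * (\sum_(n < M) cabs (r ^+ n)%:C ^+ 2) <= 1.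
  rewrite (@le_trans _ _ ((1 - r) * \sum_(n < M) r ^+ n))//; last first.
    by rewrite -[1 - r]opprB mulNr -subrX1 opprB lerBlDr lerDl exprn_ge0.
  rewrite ler_wpM2l ?(ltW r10)//; apply: ler_sum => n _.
  rewrite cabs_real ger0_norm ?exprn_ge0// expr2 ler_piMl ?exprn_ge0//.
  by rewrite exprn_ile1// ltW.
rewrite (_ : M%:R / _ = (1 - r ^+ M) ^- 2 * (M%:R * (1 - r)^-1)); last first.
  by rewrite invfM; ring.
rewrite ler_wpM2l ?invr_ge0 ?exprn_ge0 ?(ltW rM0)// ler_wpM2l//.
by rewrite -[_^-1]mulr1 ler_pdivlMl.
Qed.

(* Multiplication by D is, up to O(eps), multiplication of each window by the values D(z). *)
Lemma star_mul (D x : ser U) (N K : nat) (e0 e1 : R) :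
  (forall n, (N <= n)%N -> D n = 0) -> (forall n, (K <= n)%N -> x n = 0) ->
  (N + K <= M)%N ->
  (forall s, opnorm (\sum_(n < N) (zeta ^+ s) ^+ n *: D n) <= e0) ->
  \sum_(j < N) opnorm (D j) * Num.min 2 (j%:R * (eps * (eps + 2))) <= e1 ->
  star (D * x) <= (e0 + e1) * star x.
Proof.
move=> DN xK NKM De0 De1.
(* As [N + K <= M], the product has all its coefficients below [M] and nothing wraps around. A shift
   by [j] turns the window [i] into the window [i + j]. *)
have mxwin i (s : nat) : pe (win (zeta ^+ i) (D * x)) (zeta ^+ s) =
    \sum_(j < N) (zeta ^+ s) ^+ j *: (D j * pe (win (zeta ^+ (i + j)) x) (zeta ^+ s)).
  transitivity (\sum_(n < M) \sum_(j < N) (if (j <= n)%N then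
      (zeta ^+ s) ^+ n *: (den (zeta ^+ i) n ^- 2 *: (D j * x (n - j)%N)) else 0)).
    apply: eq_bigr => n _; rewrite /win serM scaler_sumr scaler_sumr.
    rewrite -(big_mkord xpredT (fun j => (zeta ^+ s) ^+ n *:
       (den (zeta ^+ i) n ^- 2 *: (D j * x (n - j)%N)))).
    rewrite -(big_mkord xpredT (fun j => if (j <= n)%N then (zeta ^+ s) ^+ n *:
       (den (zeta ^+ i) n ^- 2 *: (D j * x (n - j)%N)) else 0)).
    have ext (m : nat) (F : nat -> U) : (m <= M)%N -> (forall j, (m <= j)%N -> F j = 0) ->
        \sum_(0 <= j < m) F j = \sum_(0 <= j < M) F j.
      move=> mM F0; rewrite [RHS](big_cat_nat (n := m))//= [X in _ + X]big_nat_cond.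
      by rewrite [X in _ + X]big1 ?addr0// => j /andP[/andP[mj _] _]; exact: F0.
    rewrite [RHS]ext; last 2 first.
    - lia.
    - by move=> j Nj; rewrite DN// mul0r !scaler0; case: ifP.
    rewrite [RHS](big_cat_nat (n := n.+1))//= [X in _ = _ + X]big_nat_cond.
    rewrite [X in _ = _ + X]big1 ?addr0; last first.
      by move=> j /andP[/andP[nj _] _]; rewrite leqNgt nj.
    rewrite big_nat_cond [RHS]big_nat_cond; apply: eq_bigr => j.
    by rewrite ltnS => /andP[/andP[_ ->]].
  rewrite exchange_big /=; apply: eq_bigr => j _.
  rewrite /pe mulr_sumr scaler_sumr.
  have jM : (j <= M)%N by have := ltn_ord j; lia.
  rewrite -(big_mkord xpredT (fun n => if (j <= n)%N then (zeta ^+ s) ^+ n *: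
       (den (zeta ^+ i) n ^- 2 *: (D j * x (n - j)%N)) else 0)).
  rewrite (big_cat_nat (n := j))//= big_nat_cond big1 ?add0r; last first.
    by move=> n /andP[/andP[_ nj] _]; rewrite leqNgt nj.
  rewrite -[X in \sum_(X <= _ < _) _]add0n big_addn.
  rewrite -(big_mkord xpredT (fun m => (zeta ^+ s) ^+ j *:
    (D j * ((zeta ^+ s) ^+ m *: win (zeta ^+ (i + j)) x m)))).
  rewrite [RHS](big_cat_nat (n := (M - j)%N))//= ?leq_subr//.
  rewrite [X in _ = _ + X]big_nat_cond [X in _ = _ + X]big1 ?addr0; last first.
    move=> m /andP[/andP[Mjm _] _]; rewrite /win xK ?scaler0 ?mulr0 ?scaler0//.
    by have := ltn_ord j; lia.
  apply: eq_bigr => m _; rewrite leq_addl addnK /win.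
  rewrite -!bop_scalerAr !scalerA; congr (_ *: _).
  rewrite (_ : den _ (m + j) = den (zeta ^+ (i + j)) m); first by rewrite exprD; ring.
  by rewrite /den -!exprD; congr (1 - _ * (_ ^+ _)); lia.
(* Moving every window from [i + j] back to [i] leaves the value of [D] at a root of unity, bounded
   by [e0]. The error of a move is at most two windows and also at most [j] elementary shifts; the
   minimum serves both small and large [j]. *)
have S1 i : S (D * x) i <= e0 * S x i +
    \sum_(j < N) opnorm (D j) * Num.min (S x (i + j)%N + S x i)
       (eps * (eps + 2) * \sum_(l < j) S x (i + l)%N).
  have e00 : 0 <= e0 by exact: le_trans (opnorm_ge0 _) (De0 0%N).
  have ee0 : 0 <= eps * (eps + 2) by rewrite mulr_ge0 ?addr_ge0 ?eps_ge0.
  apply: mx_le => [|s].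
    rewrite addr_ge0 ?mulr_ge0 ?S_ge0//; apply: sumr_ge0 => j _.
    rewrite mulr_ge0 ?opnorm_ge0// le_min addr_ge0 ?S_ge0// mulr_ge0//.
    by apply: sumr_ge0 => l _; rewrite S_ge0.
  rewrite mxwin.
  have -> : \sum_(j < N) (zeta ^+ s) ^+ j *: (D j * pe (win (zeta ^+ (i + j)) x) (zeta ^+ s)) =
    (\sum_(j < N) (zeta ^+ s) ^+ j *: D j) * pe (win (zeta ^+ i) x) (zeta ^+ s) +
    \sum_(j < N) ((zeta ^+ s) ^+ j *: D j) *
      pe (fun n => win (zeta ^+ (i + j)) x n - win (zeta ^+ i) x n) (zeta ^+ s).
    rewrite mulr_suml -big_split /=; apply: eq_bigr => j _.
    rewrite -mulrDr bop_scalerAl; congr (_ * _).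
    rewrite /pe -big_split /=; apply: eq_bigr => n _.
    by rewrite -scalerDr addrC subrK.
  rewrite (le_trans (opnormD _ _))// lerD//.
    by rewrite opnorm_le_mul// mx_ge.
  rewrite (le_trans (opnorm_sum _ _ _))//; apply: ler_sum => j _.
  apply: opnorm_le_mul.
    by rewrite opnormZ cabsX cabs_zetaX expr1n mul1r.
  rewrite le_min; apply/andP; split; last first.
    exact: le_trans (mx_ge _ _) (mx_win_shift x i j).
  apply: le_trans (mx_ge _ _) _.
  apply: (le_trans (mxD (win (zeta ^+ (i + j)) x) (fun n => - win (zeta ^+ i) x n))).
  rewrite lerD2l (@eq_mx _ (fun n => (-1) *: win (zeta ^+ i) x n)).
    by rewrite (le_trans (mxZ _ _))// cabsN cabs1 mul1r.
  by move=> n _; rewrite scaleN1r.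
rewrite /star; apply: (le_trans (ler_sum _ (fun i _ => S1 (nat_of_ord i)))).
rewrite big_split /= -mulr_sumr mulrDl lerD//.
rewrite exchange_big /= (@le_trans _ _ (\sum_(j < N)
   opnorm (D j) * Num.min 2 (j%:R * (eps * (eps + 2))) * star x))//; last first.
  by rewrite -mulr_suml ler_wpM2r// star_ge0.
apply: ler_sum => j _; rewrite -mulr_sumr -mulrA ler_wpM2l ?opnorm_ge0//.
rewrite minr_pMl ?star_ge0// le_min; apply/andP; split.
  rewrite (@le_trans _ _ (\sum_(i < M) (S x (i + j)%N + S x i)))//.
    by apply: ler_sum => i _; rewrite ge_min lexx.
  by rewrite big_split /= star_shift mulr_natl mulr2n.
rewrite (@le_trans _ _ (\sum_(i < M) (eps * (eps + 2) * \sum_(l < j) S x (i + l)%N)))//.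
  by apply: ler_sum => i _; rewrite ge_min lexx orbT.
rewrite -mulr_sumr exchange_big /= (eq_bigr (fun=> star x)); last first.
  by move=> l _; rewrite star_shift.
by rewrite sumr_const card_ord -[star x *+ _]mulr_natl mulrCA -[leRHS]mulrA.
Qed.

End windows.

(** * Geometric decay of convolution powers in l^1 *)

Section power_decay.
Context (R : realType) (V : completeNormedModType R[i]).
Local Notation U := (bop V).
Implicit Types (D x : ser U).

Definition trunc (N : nat) x : ser U := fun n => if (n < N)%N then x n else 0.

Lemma trunc_ge N x n : (N <= n)%N -> trunc N x n = 0.
Proof. by move=> Nn; rewrite /trunc ltnNge Nn. Qed.

Lemma truncX_ge N D k n : (N * k < n)%N -> (trunc N D ^+ k) n = 0.
Proof.
elim: k n => [|k IH] n; first by rewrite muln0 expr0 ser1E; case: n.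
move=> Nkn; rewrite exprS serM big1// => i _.
have [iN|Ni] := ltnP i N; last by rewrite trunc_ge// mul0r.
by rewrite IH ?mulr0//; have := ltn_ord i; rewrite mulnS in Nkn; lia.
Qed.

(** Bernoulli's inequality gives [(1 + c / M)^M >= 1 + c >= 2], and [(1 - t) (1 + t) <= 1]. *)
Lemma pow_le_half (c M : nat) : (1 <= c)%N -> (c <= M)%N ->
  (1 - c%:R / M%:R : R) ^+ M <= 2^-1.
Proof.
move=> c1 cM; have M0 : (0 : R) < M%:R by rewrite ltr0n; lia.
set t : R := c%:R / M%:R.
have t0 : 0 <= t by rewrite divr_ge0.
have t1 : t <= 1 by rewrite ler_pdivrMr// mul1r ler_nat.
have bern n : 1 + n%:R * t <= (1 + t) ^+ n.
  elim: n => [|n IH]; first by rewrite mul0r addr0 expr0.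
  have n0 : (0 : R) <= n%:R by [].
  rewrite exprS -natr1; apply: (@le_trans _ _ ((1 + t) * (1 + n%:R * t))).
    by rewrite -subr_ge0; have := mulr_ge0 n0 (mulr_ge0 t0 t0); lra.
  by rewrite ler_wpM2l// addr_ge0.
have b2 : 2 <= (1 + t) ^+ M.
  apply: le_trans (bern M); rewrite /t mulrC divfK ?gt_eqF//.
  by have : (1 : R) <= c%:R by [rewrite ler1n]; lra.
have p0 : 0 <= (1 - t) ^+ M by rewrite exprn_ge0// subr_ge0.
have : (1 - t) ^+ M * (1 + t) ^+ M <= 1.
  rewrite -exprMn exprn_ile1//; first by rewrite mulr_ge0; lra.
  by rewrite -subr_ge0; have := mulr_ge0 t0 t0; lra.
have := ler_wpM2l p0 b2; lra.
Qed.

(* A quantitative form of Wiener's lemma for operator-valued Fourier series. *)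
Lemma l1_pow_decay D (B e0 kap : R) : l1le D B ->
  (forall z, cabs z = 1 -> opnorm (ev D z) <= e0) -> e0 < kap ->
  exists2 C : R, 0 <= C & forall k, l1le (D ^+ k) (C * kap ^+ k).
Proof.
move=> DB De0 e0k; pose del := kap - e0.
have del0 : 0 < del by rewrite subr_gt0.
have e00 : 0 <= e0 by apply: le_trans (opnorm_ge0 _) (De0 1 (cabs1 R)).
have kap0 : 0 <= kap by rewrite (le_trans e00)// ltW.
have B0 := l1le_ge0 DB.
have d4 : 0 < del / 4 by rewrite divr_gt0.
have [N0 HN0] := psum_tail (nser_ge0 D) DB d4.
(* [c] is fixed before [k] and [n]. It makes [E <= 24 / c] so small that the first [N0] coefficients
   of [D] add at most [del / 4] to the error; the tail adds at most [2 * (del / 4)], and the last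
   quarter of [del] is spent on truncating [D]. *)
have [c c8n cB] : exists2 c : nat, (8 <= c)%N & 96 * N0%:R * B / del <= c%:R.
  have p0 : 0 <= 96 * N0%:R * B / del by rewrite divr_ge0 ?mulr_ge0// ltW.
  exists (Num.bound (96 * N0%:R * B / del) + 8)%N; first exact: leq_addl.
  by rewrite (le_trans (ltW (archi_boundP p0)))// ler_nat leq_addr.
have c8 : (8 : R) <= c%:R by rewrite ler_nat.
exists (4 * c%:R) => [|k n]; first by rewrite mulr_ge0// ler0n.
have [N N0N nN] : exists2 N, (N0 <= N)%N & (n <= N)%N.
  by exists (maxn N0 n); rewrite ?leq_maxl ?leq_maxr.
pose D' := trunc N D.
(* [D'^k] has degree at most [N * k], so [M] exceeds all degrees met on the way. Since
   [M * (1 - r) = c], the final constant [4 * c] depends on neither [k] nor [n]. *)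
pose M := (N * k.+1 + c + 1)%N.
have M0 : (0 < M)%N by rewrite /M addn1.
have Mr : (0 : R) < M%:R by rewrite ltr0n.
have cM : (c < M)%N by rewrite /M addn1 ltnS leq_addl.
pose r : R := 1 - c%:R / M%:R.
have cM1 : c%:R / M%:R < 1 :> R by rewrite ltr_pdivrMr// mul1r ltr_nat.
have c0 : 0 < c%:R :> R by rewrite (lt_le_trans _ c8).
have cM0 : 0 < c%:R / M%:R :> R by rewrite divr_gt0.
have r0 : 0 <= r by rewrite subr_ge0 ltW.
have r1 : r < 1 by rewrite /r ltrBlDr ltrDl.
have rE : 1 - r = c%:R / M%:R by rewrite /r; ring.
pose E := eps M r * (eps M r + 2).
have epsc : eps M r <= 8 / c%:R.
  rewrite /eps rE ler_pdivrMr//.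
  rewrite mulrA divfK ?gt_eqF//; apply: cabs_1B_zeta.
  by rewrite (leq_ltn_trans _ cM)// (leq_trans _ c8n).
have eps0 := eps_ge0 M r1.
have E0 : 0 <= E by rewrite mulr_ge0 ?addr_ge0.
have Ec : E <= 24 / c%:R.
  rewrite (_ : 24 / c%:R = 8 / c%:R * 3); last by ring.
  rewrite /E; apply: ler_pM; rewrite ?addr_ge0//.
  have : eps M r <= 1 by rewrite (le_trans epsc)// ler_pdivrMr// mul1r.
  lra.
have N0E : N0%:R * E * B <= del / 4.
  apply: (@le_trans _ _ (N0%:R * (24 / c%:R) * B)).
    by rewrite ler_wpM2r// ler_wpM2l.
  rewrite (_ : N0%:R * _ * B = 24 * N0%:R * B / c%:R); last by ring.
  rewrite ler_pdivrMr//.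
  by move: cB; rewrite ler_pdivrMr//; lra.
have D'0 m : (N <= m)%N -> D' m = 0 by exact: trunc_ge.
have D'E (m : nat) : (m < N)%N -> D' m = D m by rewrite /D' /trunc => ->.
have De0' s : opnorm (\sum_(m < N) (zeta R M ^+ s) ^+ m *: D' m) <= e0 + del / 4.
  have z1 : cabs (zeta R M ^+ s) = 1 by rewrite cabs_zetaX.
  rewrite (eq_bigr (fun m : 'I_N => twist (zeta R M ^+ s) D m)); last first.
    by move=> m _; rewrite D'E.
  rewrite -/(osum _ _) (le_trans (opnorm_leD _ (ev D (zeta R M ^+ s))))//.
  rewrite lerD ?De0// opnormB (ev_tail DB)// ?z1// => m Nm.
  exact: HN0.
have De1 : \sum_(j < N) opnorm (D' j) * Num.min 2 (j%:R * E) <= 3 / 4 * del.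
  pose b : ser R := fun j => if (j < N0)%N then 0 else nser D j.
  have bE m : psum b (N0 + m)%N = psum (nser D) (N0 + m)%N - psum (nser D) N0.
    elim: m => [|m IH].
      rewrite addn0 subrr /psum big1// => i _.
      by rewrite /b ltn_ord.
    by rewrite addnS !psumS IH /b ltnNge leq_addr /= addrAC.
  apply: (@le_trans _ _ (\sum_(j < N) (N0%:R * E * nser D j + 2 * b j))).
    apply: ler_sum => j _; rewrite D'E// /b -/(nser D j).
    have nj := nser_ge0 D j.
    case: ltnP => jN0; last first.
      apply: ler_wpDl; first by apply: mulr_ge0 => //; exact: mulr_ge0.
      by rewrite mulrC ler_wpM2r// ge_min lexx.
    rewrite mulr0 addr0 mulrC ler_wpM2r// ge_min; apply/orP; right.
    by rewrite ler_wpM2r// ler_nat ltnW.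
  rewrite big_split /= -!mulr_sumr -/(psum _ _) -/(psum _ _).
  have -> : N = (N0 + (N - N0))%N by rewrite subnKC.
  rewrite bE.
  have h1 := HN0 N0 (N0 + (N - N0))%N (leqnn _) (leq_addr _ _).
  have h2 : N0%:R * E * psum (nser D) (N0 + (N - N0))%N <= N0%:R * E * B.
    by apply: ler_wpM2l; [exact: mulr_ge0|exact: DB].
  by move: h1 h2 N0E; lra.
have starX j : (j <= k)%N -> star M r (D' ^+ j) <= kap ^+ j * star M r (1 : ser U).
  elim: j => [|j IH] jk; first by rewrite !expr0 mul1r.
  rewrite !exprS.
  have K0 m : (N * j + 1 <= m)%N -> (D' ^+ j) m = 0.
    by rewrite addn1; exact: truncX_ge.
  have NKM : (N + (N * j + 1) <= M)%N.
    have : (N * j <= N * k)%N by rewrite leq_mul2l ltnW ?orbT.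
    by rewrite /M mulnS; move: (N * j)%N (N * k)%N => a b; clear; lia.
  have := star_mul M0 r0 r1 D'0 K0 NKM De0' De1.
  rewrite (_ : e0 + del / 4 + 3 / 4 * del = kap); last by rewrite /del; field.
  move=> h; rewrite (le_trans h)// -mulrA ler_wpM2l//.
  by apply: IH; exact: ltnW.
have nM : (n <= M)%N by rewrite (leq_trans nN)// /M mulnS -!addnA leq_addr.
have -> : psum (nser (D ^+ k)) n = psum (nser (D' ^+ k)) n.
  apply: eq_bigr => i _; congr opnorm.
  apply: (@ser_eq_truncX _ _ _ _ i) => // m mi.
  by rewrite D'E// (leq_ltn_trans mi)// (leq_trans (ltn_ord i)).
rewrite (le_trans (psum_mono (nser_ge0 _) nM))//.
rewrite (le_trans (star_coef M0 r0 r1 _))//.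
have h := le_trans (starX k (leqnn _)) (ler_wpM2l (exprn_ge0 k kap0) (star1 V M0 r0 r1)).
have half : r ^+ M <= 2^-1.
  by apply: pow_le_half; [exact: leq_trans c8n|exact: ltnW].
rewrite (le_trans (ler_wpM2l (exprn_ge0 2 _) h))//; first by rewrite subr_ge0 ltW.
rewrite rE.
set q := 1 - r ^+ M.
have q2 : 2^-1 <= q by rewrite /q; lra.
have q0 : 0 < q by rewrite (lt_le_trans _ q2).
have -> : (c%:R / M%:R) ^+ 2 * (kap ^+ k * (M%:R / (c%:R / M%:R * q ^+ 2))) =
   c%:R * kap ^+ k / q ^+ 2.
  by field; rewrite !gt_eqF.
rewrite ler_pdivrMr ?exprn_gt0//.
rewrite (_ : 4 * c%:R * kap ^+ k * q ^+ 2 = c%:R * kap ^+ k * (4 * q ^+ 2)); last by ring.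
rewrite ler_peMr ?mulr_ge0 ?exprn_ge0//.
have := ler_pM (_ : 0 <= 2^-1) (_ : 0 <= 2^-1) q2 q2; rewrite !invr_ge0 !ler0n => /(_ isT isT).
by rewrite -expr2; lra.
Qed.

End power_decay.

(** * Resolvents and perturbation *)

Section compactness.
Variable R : realType.

Lemma cabs_le_ReIm (z : R[i]) : cabs z <= `|complex.Re z| + `|complex.Im z|.
Proof.
rewrite -(@ler_pXn2r _ 2%N) ?nnegrE ?cabs_ge0 ?addr_ge0//.
rewrite cabs_sq sqrrD !real_normK ?num_real// -addrA lerD2l addrC lerDl.
by rewrite mulrn_wge0// mulr_ge0.
Qed.

Lemma norm_Re_le (z : R[i]) : `|complex.Re z| <= cabs z.
Proof.
rewrite -(@ler_pXn2r _ 2%N) ?nnegrE ?cabs_ge0//.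
by rewrite cabs_sq real_normK ?num_real// lerDl sqr_ge0.
Qed.

Lemma norm_Im_le (z : R[i]) : `|complex.Im z| <= cabs z.
Proof.
rewrite -(@ler_pXn2r _ 2%N) ?nnegrE ?cabs_ge0//.
by rewrite cabs_sq real_normK ?num_real// lerDr sqr_ge0.
Qed.

(** Compactness of the disc for eventual properties, taken from the square [[-1, 1]^2]: a point
    outside the disc has a neighbourhood disjoint from it, where nothing is to be shown. *)
Lemma disc_unif (P : nat -> R[i] -> Prop) :
  (forall z, cabs z <= 1 -> exists N, exists2 d : R, 0 < d &
     forall w, cabs (z - w) <= d -> cabs w <= 1 -> forall n, (N <= n)%N -> P n w) ->
  exists N, forall w, cabs w <= 1 -> forall n, (N <= n)%N -> P n w.
Proof.
move=> loc; pose K : set (R * R) := `[-1, 1] `*` `[-1, 1].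
have cK : compact K by apply: compact_setX; exact: segment_compact.
move/compact_near_coveringP in cK.
pose cx (p : R * R) : R[i] := p.1 +i* p.2.
have := cK nat \oo (fun i p => cabs (cx p) <= 1 -> P i (cx p)) _.
case=> [p Kp|N _ HN].
  have key (e : R) (N : nat) : 0 < e ->
      (forall w, cabs (cx p - w) <= e -> cabs w <= 1 -> forall n, (N <= n)%N -> P n w) ->
      \forall p' \near p & i \near \oo, cabs (cx p') <= 1 -> P i (cx p').
    move=> e0 H; have e2 : 0 < e / 2 by rewrite divr_gt0.
    exists (ball p.1 (e / 2) `*` ball p.2 (e / 2), [set n | (N <= n)%N]).
      split; last by exists N.
      by exists (ball p.1 (e / 2), ball p.2 (e / 2)) => //; split; exact: nbhsx_ballx.
    case=> -[s t] n /= [[]]; rewrite -!ball_normE /= => sp tp Nn c1.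
    apply: (H _ _ c1 _ Nn); rewrite (le_trans (cabs_le_ReIm _))// (splitr e).
    by rewrite lerD// ltW.
  have [p1|p1] := lerP (cabs (cx p)) 1.
    by have [N [d d0 H]] := loc _ p1; exact: (key d N).
  apply: (key ((cabs (cx p) - 1) / 2) 0%N); first by rewrite divr_gt0// subr_gt0.
  move=> w pw w1; have := cabs_sub_ge (cx p) w; lra.
exists N => w w1 n Nn.
have := HN n Nn (complex.Re w, complex.Im w); rewrite /cx /=.
have -> : complex.Re w +i* complex.Im w = w by case: w {w1}.
apply=> //; split => /=; rewrite in_itv /= -ler_norml.
  exact: le_trans (norm_Re_le w) w1.
exact: le_trans (norm_Im_le w) w1.
Qed.

Lemma expr_small (q : R) : 0 <= q -> q < 1 -> forall e, 0 < e ->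
  exists N, forall n, (N <= n)%N -> q ^+ n <= e.
Proof.
move=> q0 q1 e e0; have : `|q| < 1 by rewrite ger0_norm.
move=> /cvg_expr /cvgrPdist_le /(_ _ e0) [N _ HN]; exists N => n Nn.
by have := HN n Nn; rewrite /= sub0r normrN ger0_norm// exprn_ge0.
Qed.

End compactness.

Section resolvent.
Context (R : realType) (V : completeNormedModType R[i]).
Local Notation U := (bop V).
Implicit Types (A B C T X : U) (w z : R[i]).

Definition inverse_of A B := A * B = 1 /\ B * A = 1.

(** The identity holds formally in [ser U] between the series of powers and [1 - sermono 1 X];
    [tsum], multiplicative on l^1, carries it over to operators. *)
Lemma neumann X : opnorm X <= 2^-1 -> exists2 Y, inverse_of (1 - X) Y & opnorm Y <= 2.
Proof.
move=> X2; pose s : ser U := fun n => X ^+ n.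
have half n : \sum_(i < n) (2^-1 : R) ^+ i <= 2.
  have := subrX1 (2^-1 : R) n; set S := \sum_(i < n) _ => h.
  by have : (0 : R) <= 2^-1 ^+ n by []; lra.
have sB : l1le s 2.
  move=> n; apply: le_trans (half n); apply: ler_sum => i _.
  by rewrite (le_trans (opnormX _ _))// lerXn2r// ?nnegrE ?opnorm_ge0.
have sX : s * (1 - sermono 1 X) = 1.
  apply/funext => n; rewrite mulrBr mulr1 serB sermonoMr ser1E /s.
  by case: n => [|n]; rewrite /= ?expr0 ?subr0// subn1/= -exprSr subrr.
have Xs : (1 - sermono 1 X) * s = 1.
  apply/funext => n; rewrite mulrBl mul1r serB sermonoMl ser1E /s.
  by case: n => [|n]; rewrite /= ?expr0 ?subr0// subn1/= -exprS subrr.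
have mB : l1le (1 - sermono 1 X) (1 + opnorm X).
  apply: l1leD; first exact: l1le_1.
  by move=> n; rewrite -sermonoN -opnormN; exact: l1le_mono.
have mE : tsum (1 - sermono 1 X) = 1 - X.
  apply: tsum_eq; apply/bop_cvgP => e e0; exists 2%N => -[|[|n]]// _.
  rewrite /osum !big_ord_recl big1 ?addr0.
    by rewrite !serB !ser1E /sermono /= subr0 sub0r subrr opnorm0 ltW.
  by move=> i _; rewrite serB ser1E /sermono subrr.
have t1 : tsum (1 : ser U) = 1 by rewrite -sermono1 tsum_mono0.
exists (tsum s); last exact: tsum_norm.
by split; rewrite -mE -?(tsumM mB sB) -?(tsumM sB mB) ?sX ?Xs.
Qed.

(** [A - C = A (1 - B C)] with [|B C| <= 2^-1]. *)
Lemma perturb A B C (b : R) : inverse_of A B -> opnorm B <= b ->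
  opnorm C * b <= 2^-1 ->
  exists B', [/\ inverse_of (A - C) B', opnorm B' <= 2 * b &
    opnorm (B' - B) <= 2 * b * opnorm C * b].
Proof.
move=> [AB BA] Bb Cb.
have b0 : 0 <= b by rewrite (le_trans (opnorm_ge0 B)).
have BC : opnorm (B * C) <= b * opnorm C by rewrite opnorm_le_mul.
have [|Y [BY YB] Y2] := @neumann (B * C); first by rewrite (le_trans BC)// mulrC.
have E : A - C = A * (1 - B * C) by rewrite mulrBr mulr1 mulrA AB mul1r.
exists (Y * B); split.
- split; first by rewrite E -mulrA [_ * (Y * B)]mulrA BY mul1r.
  by rewrite E -mulrA [B * (A * _)]mulrA BA mul1r YB.
- exact: opnorm_le_mul.
have -> : Y * B - B = Y * (B * C) * B.
  have : Y - Y * (B * C) = 1 by rewrite -[X in X - _]mulr1 -mulrBr YB.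
  move=> /eqP; rewrite subr_eq addrC -subr_eq => /eqP <-.
  by rewrite mulrBl mul1r.
rewrite -[2 * b * _]mulrA; apply: opnorm_le_mul => //; exact: opnorm_le_mul.
Qed.

(* (1 - w^n T^n)^-1 = (1/n) sum_j (1 - w zeta_n^j T)^-1. *)
Lemma resolvent_mean T (g : nat -> U) w n : (0 < n)%N ->
  (forall j, g j * (1 - (zeta R n ^+ j * w) *: T) = 1) ->
  (n%:R^-1 *: \sum_(j < n) g j) * (1 - w ^+ n *: T ^+ n) = 1.
Proof.
move=> n0 resT; have scX (c : R[i]) k : (c *: T) ^+ k = c ^+ k *: T ^+ k.
  elim: k => [|k IH]; first by rewrite !expr0 scale1r.
  by rewrite !exprS IH -bop_scalerAl -bop_scalerAr scalerA.
have resE (j : 'I_n) : g j * (1 - w ^+ n *: T ^+ n) =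
    \sum_(i < n) (zeta R n ^+ j) ^+ i *: (w ^+ i *: T ^+ i).
  set x := (zeta R n ^+ j * w) *: T.
  have -> : 1 - w ^+ n *: T ^+ n = (1 - x) * (\sum_(i < n) x ^+ i).
    rewrite -[1 - x]opprB mulNr -subrX1 opprB /x scX exprMn -exprM mulnC exprM.
    by rewrite zetaM// expr1n mul1r.
  rewrite mulrA resT mul1r; apply: eq_bigr => i _.
  by rewrite /x scX exprMn scalerA.
rewrite -bop_scalerAl mulr_suml (eq_bigr _ (fun j _ => resE j)) exchange_big /=.
rewrite (bigD1 (Ordinal n0))//= [X in _ + X]big1 ?addr0.
  rewrite -scaler_suml zeta_orth0// eqxx mulr1 !expr0 scale1r scalerA mulVf ?scale1r//.
  by rewrite pnatr_eq0 -lt0n.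
move=> i i0; rewrite -scaler_suml zeta_orth0// (_ : (i == 0 :> nat) = false).
  by rewrite mulr0 scale0r.
exact/negbTE.
Qed.

Definition decays T (r : R) :=
  forall e, 0 < e -> exists N, forall n, (N <= n)%N -> r ^+ n * opnorm (T ^+ n) <= e.

(** The means [f] and [f'] of the resolvents over [n]-th roots of unity are left inverses of
    [1 - r^n T^n] and [1 - r'^n T^n]. If [r^n T^n] is small, then [f], hence also [f'], is close to
    1, which bounds [r'^n T^n] by 1; the smaller radius [r + del / 2] then decays geometrically. *)
Lemma decays_step T (del : R) (r : R) : 0 <= r -> 0 < del ->
  (forall w w', cabs w = r -> cabs (w - w') <= del ->
     exists B B', [/\ B * (1 - w *: T) = 1, B' * (1 - w' *: T) = 1 &
       opnorm (B' - B) <= 4^-1]) ->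
  decays T r -> decays T (r + del / 2).
Proof.
move=> r0 del0 H Tr; pose r' := r + del.
have r'0 : 0 < r' by rewrite ltr_wpDl.
have bound : exists N, forall n, (N <= n)%N -> r' ^+ n * opnorm (T ^+ n) <= 1.
  have e8 : (0 : R) < 8^-1 by [].
  have [N HN] := Tr _ e8; exists (maxn N 1) => n; rewrite geq_max => /andP[Nn n1].
  have Hj j : exists BB : U * U, [/\ BB.1 * (1 - (zeta R n ^+ j * r%:C) *: T) = 1,
      BB.2 * (1 - (zeta R n ^+ j * r'%:C) *: T) = 1 & opnorm (BB.2 - BB.1) <= 4^-1].
    have c1 : cabs (zeta R n ^+ j * r%:C) = r.
      by rewrite cabsM cabs_zetaX mul1r cabs_real ger0_norm.
    have [|B [B' [h1 h2 h3]]] := H _ (zeta R n ^+ j * r'%:C) c1.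
      rewrite -mulrBr cabsM cabs_zetaX mul1r -rmorphB cabs_real /r' opprD addrA subrr.
      by rewrite sub0r normrN gtr0_norm.
    by exists (B, B').
  have [F HF] := choice Hj.
  pose f := n%:R^-1 *: \sum_(j < n) (F j).1; pose f' := n%:R^-1 *: \sum_(j < n) (F j).2.
  have f1 : f * (1 - r%:C ^+ n *: T ^+ n) = 1.
    by apply: (resolvent_mean (g := fun j => (F j).1)) => // j; have [] := HF j.
  have f1' : f' * (1 - r'%:C ^+ n *: T ^+ n) = 1.
    by apply: (resolvent_mean (g := fun j => (F j).2)) => // j; have [] := HF j.
  have ff' : opnorm (f' - f) <= 4^-1.
    rewrite /f /f' -scalerBr -sumrB opnormZ cabsV cabs_nat ler_pdivrMl ?ltr0n//.
    rewrite (le_trans (opnorm_sum _ _ _))//.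
    apply: (@le_trans _ _ (\sum_(j < n) 4^-1)); last first.
      by rewrite sumr_const card_ord mulr_natl.
    by apply: ler_sum => j _; have [] := HF j.
  set X := r%:C ^+ n *: T ^+ n in f1; set X' := r'%:C ^+ n *: T ^+ n in f1'.
  have nX : opnorm X <= 8^-1.
    by rewrite opnormZ cabsX cabs_real ger0_norm// HN.
  have fE : f - 1 = f * X.
    by rewrite -[Y in f - Y]f1 mulrBr mulr1 opprB addrC subrK.
  have fX : opnorm (f - 1) <= opnorm f * 8^-1 by rewrite fE opnorm_le_mul.
  have fn : opnorm f <= opnorm (1 : U) + opnorm (f - 1) by exact: opnorm_leD.
  have f'1 : opnorm (f' - 1) <= 2^-1.
    have := opnorm_dist f' 1 f; have := opnorm1_le V; lra.
  have X'E : - X' = - ((f' - 1) * (1 - X')).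
    by rewrite mulrBl f1' mul1r opprB [RHS]addrC addKr.
  have X'1 : opnorm X' <= 2^-1 * opnorm (1 - X').
    by rewrite -[leLHS]opnormN {1}X'E opnormN opnorm_le_mul.
  have : opnorm (1 - X') <= 1 + opnorm X'.
    by rewrite (le_trans (opnormD _ _))// opnormN lerD2r opnorm1_le.
  have <- : opnorm X' = r' ^+ n * opnorm (T ^+ n).
    by rewrite opnormZ cabsX cabs_real gtr0_norm.
  by move: X'1; move: (opnorm X') (opnorm (1 - X')) => a b; clear; lra.
have [N HN] := bound => e e0.
set r2 := r + del / 2.
have r20 : 0 <= r2 by rewrite addr_ge0// ltW// divr_gt0.
have q0 : 0 <= r2 / r' by rewrite divr_ge0// ltW.
have q1 : r2 / r' < 1 by rewrite ltr_pdivrMr// mul1r /r2 /r'; lra.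
have [N' HN'] := expr_small q0 q1 e0.
exists (maxn N N') => n; rewrite geq_max => /andP[/HN Nn /HN' Nn'].
have -> : r2 ^+ n = (r2 / r') ^+ n * r' ^+ n by rewrite -exprMn divfK// gt_eqF.
rewrite -mulrA -[leRHS]mulr1; apply: ler_pM => //; first by rewrite exprn_ge0.
by rewrite mulr_ge0 ?opnorm_ge0// exprn_ge0// ltW.
Qed.

(** A substitute for the spectral radius formula, without contour integrals: compactness bounds the
    resolvent on the whole closed disc, so the step of [decays_step] can be the same at every
    radius, and finitely many steps climb from radius 0 to radius 1. *)
Lemma powers_to_0 T : (forall w, cabs w <= 1 -> exists B, inverse_of (1 - w *: T) B) ->
  forall e, 0 < e -> exists N, forall n, (N <= n)%N -> opnorm (T ^+ n) <= e.
Proof.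
move=> invT.
have [M HM] : exists M : nat, forall w, cabs w <= 1 ->
    forall m, (M <= m)%N -> exists2 B, inverse_of (1 - w *: T) B & opnorm B <= m%:R.
  apply: (@disc_unif _ (fun m w => exists2 B, inverse_of (1 - w *: T) B & opnorm B <= m%:R)).
  move=> z z1; have [B invB] := invT z z1.
  pose b := opnorm B + 1; have b0 : 0 < b by rewrite ltr_wpDl// opnorm_ge0.
  have Bb : opnorm B <= b by rewrite lerDl.
  pose q := opnorm T + 1; have q0 : 0 < q by rewrite ltr_wpDl// opnorm_ge0.
  exists (Num.bound (2 * b)), (2 * b * q)^-1; first by rewrite invr_gt0 !mulr_gt0.
  move=> w zw w1 m Nm.
  have Cb : opnorm ((w - z) *: T) * b <= 2^-1.
    rewrite opnormZ cabsB mulrAC.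
    apply: (@le_trans _ _ ((2 * b * q)^-1 * b * q)).
      apply: ler_pM; rewrite ?mulr_ge0 ?cabs_ge0 ?opnorm_ge0// ?(ltW b0)//.
        by rewrite ler_wpM2r// ltW.
      by rewrite lerDl.
    by rewrite (_ : (2 * b * q)^-1 * b * q = 2^-1)//; field; rewrite !gt_eqF.
  have [B' [hB' nB' _]] := perturb invB Bb Cb.
  exists B'; first by move: hB'; rewrite -addrA -opprD -scalerDl [z + _]addrC subrK.
  rewrite (le_trans nB')//.
  have b20 : 0 <= 2 * b by rewrite mulr_ge0// ltW.
  by rewrite (le_trans (ltW (archi_boundP b20)))// ler_nat.
pose m := maxn M 1; have m1 : (1 : R) <= m%:R by rewrite ler1n leq_maxr.
pose q := opnorm T + 1; have q1 : 1 <= q by rewrite lerDr opnorm_ge0.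
(* Resolvents at distance at most [del] differ by at most [2 * m^2 * del * |T| <= 4^-1], as
   [decays_step] asks. *)
pose del : R := (8 * m%:R ^+ 2 * q)^-1.
have m0 : 0 < (m%:R : R) by rewrite (lt_le_trans _ m1).
have q0 : 0 < q by rewrite (lt_le_trans _ q1).
have del0 : 0 < del by rewrite invr_gt0 !mulr_gt0 ?exprn_gt0.
have step r : 0 <= r -> r <= 1 -> decays T r -> decays T (r + del / 2).
  move=> r0 r1; apply: decays_step => // w w' wr ww'.
  have w1 : cabs w <= 1 by rewrite wr.
  have [B invB Bm] := HM w w1 m (leq_maxl _ _).
  have Cm : opnorm ((w' - w) *: T) <= (8 * m%:R ^+ 2)^-1.
    rewrite opnormZ cabsB (@le_trans _ _ (del * q))//.
      by apply: ler_pM; rewrite ?cabs_ge0 ?opnorm_ge0// lerDl.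
    by rewrite /del invfM -mulrA mulVf ?mulr1 ?gt_eqF.
  have Cm1 : opnorm ((w' - w) *: T) * m%:R <= 8^-1.
    apply: (@le_trans _ _ ((8 * m%:R ^+ 2)^-1 * m%:R)).
      by rewrite ler_wpM2r// ltW.
    rewrite invfM -mulrA ler_piMr// expr2 invfM -mulrA mulVf ?gt_eqF// mulr1.
    by rewrite invf_le1.
  have Cm2 : opnorm ((w' - w) *: T) * m%:R * m%:R <= 8^-1.
    rewrite -mulrA -expr2 -ler_pdivlMr ?exprn_gt0//.
    by rewrite (le_trans Cm)// invfM.
  have [|B' [[h1 h2] _ h3]] := perturb invB Bm (C := (w' - w) *: T).
    by rewrite (le_trans Cm1)//; lra.
  exists B, B'; split; first by case: invB.
    by move: h2; rewrite -addrA -opprD -scalerDl [w + _]addrC subrK.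
  rewrite (le_trans h3)// (_ : _ * _ * _ = 2 * (opnorm ((w' - w) *: T) * m%:R * m%:R)); last by ring.
  lra.
have decW r r' : 0 <= r -> r <= r' -> decays T r' -> decays T r.
  move=> r0 rr' h e e0; have [N HN] := h e e0; exists N => n Nn.
  rewrite (le_trans _ (HN n Nn))// ler_wpM2r ?opnorm_ge0//.
  by rewrite lerXn2r// nnegrE// (le_trans r0).
have d20 : 0 < del / 2 by rewrite divr_gt0.
have all k : decays T (Num.min 1 (k%:R * (del / 2))).
  elim: k => [|k IH].
    rewrite mul0r min_r// => e e0; exists 1%N => -[//|n] _.
    by rewrite expr0n mul0r ltW.
  have k0 : (0 : R) <= k%:R by [].
  have kd : 0 <= k%:R * (del / 2) by rewrite mulr_ge0// ltW.
  have m00 : 0 <= Num.min 1 (k%:R * (del / 2)) by rewrite le_min ler01.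
  have m01 : Num.min 1 (k%:R * (del / 2)) <= 1 by rewrite ge_min lexx.
  apply: decW (step _ m00 m01 IH); first by rewrite le_min ler01 mulr_ge0// ltW.
  rewrite -natr1 mulrDl mul1r ge_min; apply/orP.
  have [h|h] := lerP 1 (k%:R * (del / 2)); last by right.
  by left; rewrite lerDl ltW.
have dp : 0 <= (del / 2)^-1 by rewrite invr_ge0 ltW.
have := all (Num.bound (del / 2)^-1).
rewrite min_l => [h e /h[N HN]|]; last first.
  rewrite -ler_pdivrMr// mul1r; apply/ltW/archi_boundP => //.
by exists N => n /HN; rewrite expr1n mul1r.
Qed.

End resolvent.

(** * Perturbation of a simple eigenvalue *)

Section perturbation.
Context (R : realType) (V : completeNormedModType R[i]).
Local Notation U := (bop V).
Implicit Types (A B D E J T X Y P : U) (z w : R[i]).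

(** Banach's theorem on the closed unit ball, with the iterates written as partial sums of a series
    dominated by powers of [2^-1]. *)
Lemma contraction_fixpoint (Phi : U -> U) :
  (forall X, opnorm X <= 1 -> opnorm (Phi X) <= 1) ->
  (forall X Y, opnorm X <= 1 -> opnorm Y <= 1 ->
    opnorm (Phi X - Phi Y) <= 2^-1 * opnorm (X - Y)) ->
  exists2 X, opnorm X <= 1 & Phi X = X.
Proof.
move=> P1 PL; pose it n := iter n Phi 0.
have it1 n : opnorm (it n) <= 1.
  by elim: n => [|n IH]; [rewrite opnorm0|exact: P1].
pose x : ser U := fun n => it n.+1 - it n.
have xn n : nser x n <= 2^-1 ^+ n.
  elim: n => [|n IH].
    by rewrite expr0 /nser /x /it /= subr0; apply: P1; rewrite opnorm0.
  rewrite exprS (le_trans (PL _ _ (it1 n.+1) (it1 n)))//.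
  by rewrite ler_wpM2l.
have xB : l1le x 2.
  move=> n; apply: le_trans (le_psum n xn) _.
  have := subrX1 (2^-1 : R) n; rewrite /psum; set S := \sum_(i < n) _ => h.
  by have : (0 : R) <= 2^-1 ^+ n by []; lra.
have osx n : osum x n = it n.
  by rewrite /osum -(big_mkord xpredT x) /x telescope_sumr// subr0.
have itX : it @ \oo --> tsum x.
  by have := tsum_cvg xB; rewrite (_ : osum x = it)//; apply/funext.
set X := tsum x in itX.
have X1 : opnorm X <= 1 by exact: opnorm_lim_le itX it1.
exists X => //; apply/eqP; rewrite -subr_eq0; apply/eqP/opnorm_eq0/eqP.
rewrite eq_le opnorm_ge0 andbT; apply/ler_addgt0Pr => e e0; rewrite add0r.
move/bop_cvgP : itX => /(_ (e / 2)) []; first by rewrite divr_gt0.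
move=> N HN; rewrite (le_trans (opnorm_dist _ _ (it N.+1)))// (splitr e) lerD//.
  rewrite (le_trans (PL _ _ X1 (it1 N)))// opnormB.
  rewrite (le_trans _ (HN N (leqnn N)))// ler_piMl ?opnorm_ge0//; lra.
exact: HN.
Qed.

Lemma opnormX_dist X Y (c : R) k : 1 <= c -> opnorm X <= c -> opnorm Y <= c ->
  opnorm (X ^+ k - Y ^+ k) <= k%:R * c ^+ k * opnorm (X - Y).
Proof.
move=> c1 Xc Yc; have c0 : 0 <= c by rewrite (le_trans _ c1).
elim: k => [|k IH]; first by rewrite !expr0 subrr opnorm0 !mul0r.
rewrite !exprS.
have -> : X * X ^+ k - Y * Y ^+ k = (X - Y) * X ^+ k + Y * (X ^+ k - Y ^+ k).
  by rewrite mulrBl mulrBr addrA subrK.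
have h1 : opnorm ((X - Y) * X ^+ k) <= opnorm (X - Y) * (c * c ^+ k).
  apply: opnorm_le_mul => //.
  rewrite (le_trans (opnormX _ _))// (@le_trans _ _ (c ^+ k))//.
    by rewrite lerXn2r// nnegrE opnorm_ge0.
  by rewrite ler_peMl// exprn_ge0.
have h2 := opnorm_le_mul Yc IH.
rewrite (le_trans (opnormD _ _))// (le_trans (lerD h1 h2))//.
by rewrite le_eqVlt; apply/orP; left; apply/eqP; rewrite -natr1; ring.
Qed.

Lemma pow_block X (c : R) k q i : 1 <= c -> opnorm X <= c ->
  opnorm (X ^+ k) <= 2^-1 -> (i < k)%N ->
  opnorm (X ^+ (q * k + i)) <= 2^-1 ^+ q * c ^+ k.
Proof.
move=> c1 Xc Xk ik; rewrite exprD; apply: opnorm_le_mul.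
  by rewrite mulnC exprM (le_trans (opnormX _ _))// lerXn2r// nnegrE ?opnorm_ge0.
rewrite (le_trans (opnormX _ _))// (@le_trans _ _ (c ^+ i))//.
  by rewrite lerXn2r// nnegrE ?opnorm_ge0// (le_trans _ c1).
by rewrite ler_weXn2l// ltnW.
Qed.

Lemma pow_sum X (c : R) k n : 1 <= c -> opnorm X <= c -> (0 < k)%N ->
  opnorm (X ^+ k) <= 2^-1 ->
  \sum_(j < n) opnorm (X ^+ j) <= 2 * k%:R * c ^+ k.
Proof.
move=> c1 Xc k0 Xk.
pose a : ser R := fun j => opnorm (X ^+ j).
have a0 j : 0 <= a j by exact: opnorm_ge0.
have c0 : 0 <= c ^+ k by rewrite exprn_ge0// (le_trans _ c1).
have nnk : (n <= n * k)%N by rewrite leq_pmulr.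
apply: (le_trans (psum_mono a0 nnk)).
have blk q : psum a (q * k)%N <= (2 - 2 * 2^-1 ^+ q) * (k%:R * c ^+ k).
  elim: q => [|q IH]; first by rewrite mul0n psum0 expr0 mulr1 subrr mul0r.
  rewrite mulSn addnC /psum big_split_ord /= -/(psum a (q * k)).
  have : \sum_(i < k) a (q * k + i)%N <= 2^-1 ^+ q * (k%:R * c ^+ k).
    apply: (@le_trans _ _ (\sum_(i < k) (2^-1 ^+ q * c ^+ k))).
      by apply: ler_sum => i _; exact: pow_block.
    by rewrite sumr_const card_ord -[_ *+ k]mulr_natl mulrCA.
  rewrite exprS; lra.
rewrite (le_trans (blk n))// -mulrA ler_wpM2r// ?mulr_ge0//.
by rewrite gerBl mulr_ge0// exprn_ge0// invr_ge0.
Qed.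

Section simple_eigenvalue_perturbation.
Variables (T P : U) (v : V).
Hypotheses (PP : P * P = P) (PT : P * T = P) (TP : T * P = P).
Hypothesis rk : forall X, exists c : R[i], P * X * P = c *: P.
Hypotheses (v0 : v != 0) (Pv : P v = v).
Hypothesis invN : forall w, cabs w <= 1 -> exists B, inverse_of (1 - w *: (T - P)) B.

Local Notation Q := (1 - P).
Local Notation N := (T - P).

Let PQ : P * Q = 0. Proof. by rewrite mulrBr mulr1 PP subrr. Qed.
Let QP : Q * P = 0. Proof. by rewrite mulrBl mul1r PP subrr. Qed.
Let QQ : Q * Q = Q. Proof. by rewrite mulrBr mulr1 QP subr0. Qed.
Let QTQ : Q * T * Q = N.
Proof. by rewrite mulrBl mul1r PT mulrBr mulr1 mulrBl TP PP subrr subr0. Qed.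
Let QN : Q * N = N. Proof. by rewrite mulrBl mul1r mulrBr PT PP subrr subr0. Qed.
Let NQ : N * Q = N. Proof. by rewrite mulrBr mulr1 mulrBl TP PP subrr subr0. Qed.

Let subACA (a b c d : U) : a - b - (c - d) = a - c - (b - d).
Proof. by rewrite !opprB addrACA [- b - c]addrC -addrACA. Qed.

(* The perturbed operator A = T + E is made block triangular by conjugation with 1 + X,
   where X solves the Riccati equation of the fixed point. *)
Lemma triangularize : exists2 b : R, 1 <= b & forall E, 8 * b * opnorm E <= 1 ->
  exists X, [/\ opnorm X <= 4 * b * opnorm E, Q * X * P = X &
    Q * ((1 - X) * (T + E) * (1 + X)) * P = 0].
Proof.
have [|S1] := @invN 1; first by rewrite cabs1.
rewrite scale1r => -[NS SN].
have S1Q : S1 * Q = Q * S1.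
  have E1 : (1 - N) * Q = Q * (1 - N) by rewrite mulrBl mul1r NQ mulrBr mulr1 QN.
  by rewrite -[LHS]mulr1 -[X in _ * X = _]NS mulrA -[S1 * Q * _]mulrA -E1 mulrA SN mul1r.
pose b := opnorm (S1 * Q) * opnorm P + 1.
have b1 : 1 <= b by rewrite lerDr mulr_ge0 ?opnorm_ge0.
have b0 : 0 <= b by rewrite (le_trans _ b1).
have SQP (Z : U) (a : R) : opnorm Z <= a -> opnorm (S1 * Q * Z * P) <= b * a.
  move=> Za; have a0 : 0 <= a by rewrite (le_trans (opnorm_ge0 _) Za).
  apply: (@le_trans _ _ (opnorm (S1 * Q) * a * opnorm P)).
    by do 2 apply: opnorm_le_mul => //.
  by rewrite mulrAC ler_wpM2r// lerDl.
exists b => // E Eb.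
(* Because [Q T P = 0], [P T = P] and [P X = 0], the block below the diagonal vanishes when
   [(1 - N) X = Q (E + E X - X E - X E X) P]; [S1] inverts [1 - N]. On the unit ball each of the
   four terms has norm at most [|E|], which gives the 4 in the bounds. *)
pose Phi X := S1 * Q * (E + E * X - X * E - X * E * X) * P.
set e := opnorm E.
have e0 : 0 <= e by exact: opnorm_ge0.
have Phi4 X : opnorm X <= 1 -> opnorm (Phi X) <= b * (4 * e).
  move=> X1; apply: SQP.
  have h1 : opnorm (E * X) <= e * 1 by exact: opnorm_le_mul.
  have h2 : opnorm (X * E) <= 1 * e by exact: opnorm_le_mul.
  have h3 : opnorm (X * E * X) <= 1 * e * 1 by exact: opnorm_le_mul.
  rewrite (le_trans (opnormD _ _))// opnormN.
  have := opnormD (E + E * X) (- (X * E)); rewrite opnormN.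
  have := opnormD E (E * X); rewrite -/e; lra.
have [|X Y X1 Y1|X X1 XE] := @contraction_fixpoint Phi.
- by move=> X X1; apply: le_trans (Phi4 X X1) _; rewrite mulrCA; move: Eb; rewrite -/e; lra.
- have GE : E + E * X - X * E - X * E * X - (E + E * Y - Y * E - Y * E * Y) =
      E * (X - Y) - (X - Y) * E - ((X - Y) * E * X + Y * E * (X - Y)).
    rewrite subACA [E + _ - _ - _]subACA opprD addrACA subrr add0r.
    by rewrite !mulrBr !mulrBl addrA subrK.
  rewrite /Phi -mulrBl -mulrBr GE.
  set d := opnorm (X - Y).
  apply: le_trans (_ : b * (4 * e * d) <= _); last first.
    have d0 : 0 <= d by exact: opnorm_ge0.
    by have := ler_wpM2r d0 Eb; rewrite -/e; lra.
  have g1 : opnorm (E * (X - Y)) <= e * d by exact: opnorm_le_mul.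
  have g2 : opnorm ((X - Y) * E) <= d * e by exact: opnorm_le_mul.
  have g3 : opnorm ((X - Y) * E * X) <= d * e * 1 by exact: opnorm_le_mul.
  have g4 : opnorm (Y * E * (X - Y)) <= 1 * e * d by do 2 apply: opnorm_le_mul => //.
  apply: SQP.
  have := opnormD (E * (X - Y) - (X - Y) * E) (- ((X - Y) * E * X + Y * E * (X - Y))).
  have := opnormD (E * (X - Y)) (- ((X - Y) * E)).
  have := opnormD ((X - Y) * E * X) (Y * E * (X - Y)).
  by rewrite !opnormN; lra.
have QXP : Q * X * P = X.
  have gen Z : Q * (S1 * Q * Z * P) * P = S1 * Q * Z * P.
    by rewrite -!mulrA PP !mulrA -S1Q -[S1 * Q * Q]mulrA QQ.
  by rewrite -XE; exact: gen.
have QX : Q * X = X by rewrite -QXP !mulrA QQ.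
have XP : X * P = X by rewrite -{1}QXP -[_ * P * P]mulrA PP QXP.
have PX : P * X = 0 by rewrite -QX mulrA PQ mul0r.
exists X; split=> //; first by rewrite -{1}XE [4 * b]mulrC -mulrA; exact: Phi4.
have X0 : X * T * X = 0 by rewrite -{1}XP -[X * P * T]mulrA PT -mulrA PX mulr0.
have QX1 : Q * (1 - X) = Q - X by rewrite mulrBr mulr1 QX.
have XP1 : (1 + X) * P = P + X by rewrite mulrDl mul1r XP.
have -> : Q * ((1 - X) * (T + E) * (1 + X)) * P = (Q - X) * (T + E) * (P + X).
  by rewrite !mulrA QX1 -!mulrA XP1.
have TE : (Q - X) * T * (P + X) = N * X - X.
  have XTP : X * T * P = X by rewrite -mulrA TP.
  have QTP : Q * T * P = 0 by rewrite -mulrA TP.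
  have QTX : Q * T * X = N * X by rewrite -{1}QX mulrA QTQ.
  have TY Y : (Q - X) * T * Y = Q * T * Y - X * T * Y.
    by rewrite [(Q - X) * T]mulrBl [LHS]mulrBl.
  by rewrite mulrDr !TY QTP XTP QTX X0 subr0 sub0r addrC.
have EE : (Q - X) * E * (P + X) = (1 - N) * X.
  have -> : (1 - N) * X = Q * (E + E * X - X * E - X * E * X) * P.
    by rewrite -{1}XE /Phi !mulrA NS mul1r.
  rewrite -QX1 -XP1 !mulrA; congr (_ * _).
  rewrite -!mulrA; congr (_ * _).
  by rewrite mulrBl mul1r !mulrDr !mulr1 opprD addrA.
by rewrite [(Q - X) * _]mulrDr mulrDl TE EE [(1 - N) * X]mulrBl mul1r -[X - _]opprB subrr.
Qed.

Let XX_0 X : Q * X * P = X -> X * X = 0.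
Proof.
move=> QXP; have XQ : X * Q = 0 by rewrite -[Y in Y * _]QXP -[LHS]mulrA PQ mulr0.
have QX : Q * X = X by rewrite -QXP !mulrA QQ.
by rewrite -{2}QX mulrA XQ mul0r.
Qed.

(** After triangularization the corner is a scalar [lam]. It is an eigenvalue of [T + E] with
    eigenvector [(1 + X) v], so the hypothesis on eigenvalues gives [|lam| <= 1]. The other diagonal
    block [D] is close to [N], so the norms of its powers are summable, and the off-diagonal block,
    a convolution of powers of [lam] and of [D], is bounded by their sum. [C] comes before [eps]
    since it depends on [T] and [P] alone. *)
Lemma perturbed_powers : exists C : R, forall eps, 0 < eps ->
  exists2 del : R, 0 < del & exists m0, forall E, opnorm E <= del ->
    (forall (mu : R[i]) (x : V), x != 0 -> (T + E) x = mu *: x -> cabs mu <= 1) ->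
    (forall l, opnorm ((T + E) ^+ l) <= C) /\
    (forall m, (m0 <= m)%N -> opnorm (Q * (T + E) ^+ m * Q) <= eps).
Proof.
have [b b1 Hb] := triangularize.
pose p := opnorm P; pose q := opnorm Q; pose t := opnorm T.
pose c := opnorm N + 1.
have c1 : 1 <= c by rewrite lerDr opnorm_ge0.
have [k k0 Nk] : exists2 k, (0 < k)%N & opnorm (N ^+ k) <= 4^-1.
  have [|k Hk] := powers_to_0 invN (e := 4^-1); first by [].
  by exists (maxn k 1); rewrite ?leq_maxr ?Hk ?leq_maxl.
pose C2 := 2 * k%:R * c ^+ k; pose Cb := p * (4 * (t + 1)) * q.
pose C1 := Cb * C2 * q.
have p0 : 0 <= p by exact: opnorm_ge0.
have q0 : 0 <= q by exact: opnorm_ge0.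
have t0 : 0 <= t by exact: opnorm_ge0.
have c0 : 0 <= c by rewrite (le_trans _ c1).
have ck0 : 0 <= c ^+ k by exact: exprn_ge0.
have C20 : 0 <= C2 by rewrite !mulr_ge0.
have Cb0 : 0 <= Cb by rewrite !mulr_ge0// addr_ge0.
have C10 : 0 <= C1 by apply: mulr_ge0 => //; exact: mulr_ge0.
have b0 : 0 <= b by rewrite (le_trans _ b1).
exists (4 * (p + (C1 + C2 * q))) => eps eps0.
(* One summand for each smallness condition on [E] used below; [part] extracts them. *)
pose K := 8 * b + 1 + (q + 1) * q + 4 * k%:R * c ^+ k * ((q + 1) * q) + 8 * b * C1.
have q10 : 0 <= (q + 1) * q by rewrite mulr_ge0// addr_ge0.
have kq0 : 0 <= 4 * k%:R * c ^+ k * ((q + 1) * q).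
  by do 2 (apply: mulr_ge0 => //); exact: mulr_ge0.
have bC0 : 0 <= 8 * b * C1 by apply: mulr_ge0 => //; exact: mulr_ge0.
have K0 : 0 < K by rewrite /K; lra.
have m10 : 0 < Num.min 1 eps by rewrite lt_min ltr01.
exists (Num.min 1 eps / K); first by rewrite divr_gt0.
have [j Hj] : exists j, forall n, (j <= n)%N -> (2^-1 : R) ^+ n * (c ^+ k * q) <= eps / 2.
  have e1 : 0 < eps / 2 / (c ^+ k * q + 1).
    by rewrite !divr_gt0// ltr_wpDl// mulr_ge0.
  have [||j Hj] := expr_small (q := 2^-1 : R) _ _ e1; [by []|lra|].
  exists j => n /Hj; rewrite ler_pdivlMr ?ltr_wpDl ?mulr_ge0// mulrDr mulr1.
  by apply: le_trans; rewrite lerDl.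
exists (j * k)%N => E Edel eigE.
have KE : K * opnorm E <= Num.min 1 eps.
  by rewrite mulrC -ler_pdivlMr.
have e0 : 0 <= opnorm E by exact: opnorm_ge0.
have part (a : R) : a <= K -> a * opnorm E <= 1 /\ a * opnorm E <= eps.
  move=> aK; have := le_trans (ler_wpM2r e0 aK) KE.
  by rewrite le_min => /andP[].
have [|Eb _] := part (8 * b); first by rewrite /K; lra.
have [X [Xb QXP QAP]] := Hb E Eb.
have [A2 A2E] : exists A, A = (1 - X) * (T + E) * (1 + X) by eexists.
rewrite -A2E in QAP.
have XP : X * P = X by rewrite -{1}QXP -[_ * P * P]mulrA PP QXP.
have QX : Q * X = X by rewrite -QXP !mulrA QQ.
have PX : P * X = 0 by rewrite -QX mulrA PQ mul0r.
have XQ : X * Q = 0 by rewrite -XP -mulrA PQ mulr0.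
have XX : X * X = 0 by exact: XX_0.
have JJ' : (1 + X) * (1 - X) = 1 by rewrite mulrDl mul1r mulrBr mulr1 XX subr0 subrK.
have J'J : (1 - X) * (1 + X) = 1 by rewrite mulrBl mul1r mulrDr mulr1 XX addr0 addrK.
have PQ1 : P + Q = 1 by rewrite addrC subrK.
have TJ : (T + E) * (1 + X) = (1 + X) * A2 by rewrite A2E !mulrA JJ' mul1r.
have [lam lamE] := rk A2.
have A2P : A2 * P = lam *: P.
  by rewrite -lamE -[LHS]mul1r -{1}PQ1 mulrDl !mulrA QAP addr0.
have lam1 : cabs lam <= 1.
  apply: (eigE lam ((1 + X) v)).
    apply: contra v0 => /eqP JE; rewrite -Pv -[P]addr0 -PX -{1}[P]mulr1 -mulrDr.
    by rewrite bopME JE linear0.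
  rewrite -bopME TJ bopME -linearZ; congr (bop_fun _ _).
  by rewrite -{1}Pv -bopME A2P bopZE Pv.
have X1 : opnorm X <= 1 by rewrite (le_trans Xb)//; lra.
have J2 : opnorm (1 + X) <= 2.
  by have := opnormD 1 X; have := opnorm1_le V; lra.
have J'2 : opnorm (1 - X) <= 2.
  by have := opnormD 1 (- X); have := opnorm1_le V; rewrite opnormN; lra.
have E1 : opnorm E <= 1.
  by have [|h _] := part 1; [rewrite /K; lra|rewrite mul1r in h].
have A2n : opnorm A2 <= 4 * (t + 1).
  rewrite (_ : 4 * (t + 1) = 2 * (t + 1) * 2); last by ring.
  rewrite A2E; do 2 apply: opnorm_le_mul => //.
  by rewrite (le_trans (opnormD _ _))// lerD2l.
have [D DE] : exists D, D = Q * A2 * Q by eexists.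
have QA2 : Q * A2 = D.
  by rewrite DE mulrBr mulr1 QAP subr0.
have QA2X l : Q * A2 ^+ l = D ^+ l * Q.
  elim: l => [|l IH]; first by rewrite !expr0 mulr1 mul1r.
  rewrite !exprS mulrA QA2 -mulrA -IH DE.
  by rewrite -[LHS]mulrA -[RHS]mulrA [Q * (Q * _)]mulrA QQ.
have DN : D - N = (Q - X) * E * Q.
  have -> : D = (Q - X) * (T + E) * Q.
    rewrite DE A2E !mulrA [Q * (1 - X)]mulrBr mulr1 QX -!mulrA; congr (_ * (_ * _)).
    by rewrite mulrDl mul1r XQ addr0.
  have XTQ : X * T * Q = 0 by rewrite -XP -[X * P * T]mulrA PT -mulrA PQ mulr0.
  rewrite [(Q - X) * (T + E)]mulrDr [LHS]addrC mulrDl.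
  have -> : (Q - X) * T * Q = N by rewrite [(Q - X) * T]mulrBl [LHS]mulrBl QTQ XTQ subr0.
  by rewrite addrA addNr add0r.
have QXn : opnorm (Q - X) <= q + 1 by rewrite (le_trans (opnormD _ _))// opnormN lerD2l.
have DNn : opnorm (D - N) <= (q + 1) * q * opnorm E.
  by rewrite DN mulrAC; do 2 apply: opnorm_le_mul => //.
have Dc : opnorm D <= c.
  have [|h _] := part ((q + 1) * q); first by rewrite /K; lra.
  by have := opnorm_leD D N; rewrite /c; lra.
have Nc : opnorm N <= c by rewrite lerDl.
have Dk : opnorm (D ^+ k) <= 2^-1.
  have [|h _] := part (4 * k%:R * c ^+ k * ((q + 1) * q)); first by rewrite /K; lra.
  have := opnorm_leD (D ^+ k) (N ^+ k); have := opnormX_dist k c1 Dc Nc.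
  have kc : 0 <= k%:R * c ^+ k by rewrite mulr_ge0.
  have := ler_wpM2l kc DNn; lra.
have sumD n : \sum_(i < n) opnorm (D ^+ i) <= C2 by exact: pow_sum.
have Dn n : opnorm (D ^+ n) <= C2.
  rewrite (le_trans _ (sumD n.+1))// big_ord_recr /= lerDr.
  by apply: sumr_ge0 => i _; exact: opnorm_ge0.
have Bn : opnorm (P * A2 * Q) <= Cb by do 2 apply: opnorm_le_mul => //.
have A2PX l : A2 ^+ l * P = lam ^+ l *: P.
  elim: l => [|l IH]; first by rewrite !expr0 mul1r scale1r.
  by rewrite exprSr -mulrA A2P -bop_scalerAr IH scalerA exprS.
have PA2Q l : opnorm (P * A2 ^+ l * Q) <= Cb * (\sum_(i < l) opnorm (D ^+ i)) * q.
  elim: l => [|l IH]; first by rewrite expr0 mulr1 PQ opnorm0 big_ord0 mulr0 mul0r.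
  have -> : P * A2 ^+ l.+1 * Q = lam *: (P * A2 ^+ l * Q) + P * A2 * Q * D ^+ l * Q.
    have e : P * A2 = P * A2 * P + P * A2 * Q by rewrite -mulrDr PQ1 mulr1.
    have hQ : Q * (D ^+ l * Q) = D ^+ l * Q by rewrite -QA2X mulrA QQ.
    rewrite exprS mulrA {1}e 2!mulrDl lamE -!bop_scalerAl; congr (_ + _).
    by rewrite -[P * A2 * Q * A2 ^+ l]mulrA QA2X -!mulrA QQ hQ.
  apply: (@le_trans _ _ (Cb * (\sum_(i < l) opnorm (D ^+ i)) * q + Cb * opnorm (D ^+ l) * q)).
    2: by rewrite big_ord_recr /= -mulrDl -mulrDr.
  rewrite (le_trans (opnormD _ _))// lerD//.
    by rewrite opnormZ (le_trans _ IH)// ler_piMl ?opnorm_ge0.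
  by do 2 apply: opnorm_le_mul => //.
have PA2C l : opnorm (P * A2 ^+ l * Q) <= C1.
  by rewrite (le_trans (PA2Q l))// ler_wpM2r// ler_wpM2l.
have QA2Q l : Q * A2 ^+ l * Q = D ^+ l * Q by rewrite QA2X -mulrA QQ.
have AX l : (T + E) ^+ l = (1 + X) * A2 ^+ l * (1 - X).
  elim: l => [|l IH]; first by rewrite !expr0 mulr1 JJ'.
  by rewrite !exprS IH !mulrA TJ.
have A2Q l : A2 ^+ l * Q = P * A2 ^+ l * Q + Q * A2 ^+ l * Q.
  by rewrite -!mulrDl PQ1 mul1r.
split=> [l|m jkm].
  rewrite AX (_ : 4 * _ = 2 * (p + (C1 + C2 * q)) * 2); last by ring.
  do 2 apply: opnorm_le_mul => //.
  rewrite -[A2 ^+ l]mulr1 -PQ1 mulrDr (le_trans (opnormD _ _))// lerD//.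
    by rewrite A2PX opnormZ cabsX ler_piMl ?opnorm_ge0// exprn_ile1// cabs_ge0.
  rewrite A2Q (le_trans (opnormD _ _))// lerD// QA2Q.
  exact: opnorm_le_mul.
have J'Q : (1 - X) * Q = Q by rewrite mulrBl mul1r XQ subr0.
have QJ : Q * (1 + X) = Q + X by rewrite mulrDr mulr1 QX.
(* The conjugation leaves the term [X * (P * A2 ^+ m * Q)], which need not decay in [m]; it is small
   because [X] is of the order of [E]. *)
have -> : Q * (T + E) ^+ m * Q = Q * A2 ^+ m * Q + X * (P * A2 ^+ m * Q).
  rewrite AX !mulrA QJ -[_ * (1 - X) * Q]mulrA J'Q XP.
  by rewrite 2!mulrDl.
rewrite (le_trans (opnormD _ _))// (splitr eps) lerD//.
  rewrite QA2Q (le_trans _ (Hj (m %/ k)%N _))//; last by rewrite leq_divRL.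
  rewrite mulrA; apply: opnorm_le_mul => //.
  rewrite {1}(divn_eq m k); apply: pow_block => //.
  by rewrite ltn_mod.
have [|_ h] := part (8 * b * C1); first by rewrite /K; lra.
apply: (@le_trans _ _ (4 * b * opnorm E * C1)).
  exact: opnorm_le_mul.
lra.
Qed.

End simple_eigenvalue_perturbation.
End perturbation.

(** * From spectra to uniform bounds on the closed disc *)

Section spectral_bounds.
Context (R : realType) (V : completeNormedModType R[i]).
Local Notation U := (bop V).
Implicit Types (T P S : U) (lam w z : R[i]).

Let quarter_half (a b d : R) : d <= 4^-1 -> b <= 4^-1 -> a <= b + d -> a <= 2^-1.
Proof. lra. Qed.

(** A crude bound, which makes the [sup] in [spectral_radius] meaningful; the 2 reflects the radius
    [2^-1] of [neumann]. *)
Lemma spectrum_bounded T lam : spectrum T lam -> cabs lam <= 2 * opnorm T.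
Proof.
move=> sp; rewrite leNgt; apply/negP => lamT.
have T0 := opnorm_ge0 T.
have l0 : 0 < cabs lam by rewrite (le_lt_trans _ lamT)// mulr_ge0.
have lam0 : lam != 0 by rewrite -cabs_eq0 gt_eqF.
have [|Y [TY YT] _] := @neumann _ _ (lam^-1 *: T).
  by rewrite opnormZ cabsV mulrC ler_pdivrMr//; lra.
have E : lam *: (1 : U) - T = lam *: (1 - lam^-1 *: T).
  by rewrite scalerBr scalerA divff// scale1r.
apply: sp; exists (lam^-1 *: Y); rewrite E.
by rewrite -!bop_scalerAl -!bop_scalerAr !scalerA mulVf// divff// !scale1r TY YT.
Qed.

Lemma spectrum_le_radius T lam : spectrum T lam -> cabs lam <= spectral_radius T.
Proof.
move=> sp; apply: ub_le_sup; last by exists lam.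
by exists (2 * opnorm T) => _ [mu smu <-]; exact: spectrum_bounded.
Qed.

Lemma eigenvalue_spectrum T lam (x : V) : x != 0 -> T x = lam *: x -> spectrum T lam.
Proof.
move=> x0 Tx [S [ST TS]]; move/eqP: x0; apply.
rewrite -[x](bop1E (V := V)) -ST bopME bopDE bopNE bopZE bop1E Tx subrr.
exact: linear0.
Qed.

Lemma radius_inverse T w : spectral_radius T < 1 -> cabs w <= 1 ->
  exists B, inverse_of (1 - w *: T) B.
Proof.
move=> T1 w1; have [->|w0] := eqVneq w 0.
  by exists 1; rewrite scale0r subr0; split; rewrite mulr1.
have [S [ST TS]] : invertible (w^-1 *: (1 : U) - T).
  apply: contrapT => /spectrum_le_radius; rewrite cabsV; apply/negP.
  rewrite -ltNge (lt_le_trans T1)// -[leLHS]invr1 lef_pV2 ?posrE//.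
  by rewrite lt_neqAle cabs_ge0 andbT eq_sym cabs_eq0.
have E : 1 - w *: T = w *: (w^-1 *: (1 : U) - T).
  by rewrite scalerBr scalerA divff// scale1r.
exists (w^-1 *: S); rewrite E.
split; rewrite -bop_scalerAl -bop_scalerAr scalerA; last by rewrite mulVf// scale1r.
by rewrite divff// scale1r.
Qed.

Lemma inverse_lr (A L S : U) : L * A = 1 -> A * S = 1 -> inverse_of A L.
Proof. by move=> LA AS; split=> //; rewrite -[L]mulr1 -AS mulrA LA mul1r. Qed.

Section simple.
Variables (T P : U) (rho : R).
Hypotheses (sT : simple_eigenvalue T 1 P) (rho1 : rho < 1).
Hypothesis spT : forall lam, spectrum T lam -> lam != 1 -> complex.Re `|lam| <= rho.

Lemma simple_proj : [/\ P * P = P, P * T = P & T * P = P].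
Proof.
have [PP PT rg _ _] := sT.
have TP : T * P = P.
  apply: bop_ext => x; rewrite bopME.
  have : range P (P x) by exists x.
  by rewrite rg /= scale1r.
by split=> //; rewrite PT.
Qed.

Lemma simple_vector : exists2 v : V, v != 0 & P v = v.
Proof.
have [PP _ _ [v v0 rg] _] := sT; exists v => //.
have [x _ <-] : range P v by rewrite rg; exists 1; rewrite ?scale1r.
by rewrite -bopME PP.
Qed.

Lemma simple_rank X : exists c : R[i], P * X * P = c *: P.
Proof.
have [PP _ _ [v v0 rg] _] := sT.
have [d Pd] : exists d : R[i], P (X v) = d *: v.
  have : range P (P (X v)) by exists (X v).
  by rewrite rg => -[d _ <-]; exists d.
exists d; apply: bop_ext => x; rewrite !bopME bopZE.
have : range P (P x) by exists x.
by rewrite rg => -[c _ <-]; rewrite !linearZ /= Pd !scalerA mulrC.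
Qed.

(** On the range of [P] the operator is the identity; on that of [1 - P] it is [1 - w T], inverted
    by the resolvent for [w] other than 1 and by the reduced resolvent in [simple_eigenvalue] for
    [w = 1]. The inverse glues the two pieces. *)
Lemma simple_inverse w : cabs w <= 1 -> exists B, inverse_of (1 - w *: (T - P)) B.
Proof.
move=> w1; have [PP PT TP] := simple_proj.
have QP : (1 - P) * P = 0 by rewrite mulrBl mul1r PP subrr.
have PQ : P * (1 - P) = 0 by rewrite mulrBr mulr1 PP subrr.
have QQ : (1 - P) * (1 - P) = 1 - P by rewrite mulrBr mulr1 QP subr0.
have NP : (T - P) * P = 0 by rewrite mulrBl TP PP subrr.
have PN : P * (T - P) = 0 by rewrite mulrBr PT PP subrr.
have PQ1 : P + (1 - P) = 1 by rewrite addrC subrK.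
have [->|w0] := eqVneq w 0.
  by exists 1; rewrite scale0r subr0; split; rewrite mulr1.
have key L S : L * (1 - w *: T) = 1 - P -> (1 - w *: T) * S = 1 - P ->
    exists B, inverse_of (1 - w *: (T - P)) B.
  move=> LT TS.
  have QN : (1 - P) * (1 - w *: (T - P)) = (1 - w *: T) * (1 - P).
    have h : (1 - P) * (T - P) = T - P by rewrite mulrBl mul1r PN subr0.
    rewrite [LHS]mulrBr mulr1 -bop_scalerAr h.
    rewrite [RHS]mulrBl mul1r -bop_scalerAl; congr (_ - _ *: _).
    by rewrite mulrBr mulr1 TP.
  have NQ : (1 - w *: (T - P)) * (1 - P) = (1 - P) * (1 - w *: T).
    have h : (T - P) * (1 - P) = T - P by rewrite mulrBr mulr1 NP subr0.
    rewrite [LHS]mulrBl mul1r -bop_scalerAl h.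
    rewrite [RHS]mulrBr mulr1 -bop_scalerAr; congr (_ - _ *: _).
    by rewrite mulrBl mul1r PT.
  have PN1 : P * (1 - w *: (T - P)) = P.
    by rewrite mulrBr mulr1 -bop_scalerAr PN scaler0 subr0.
  have NP1 : (1 - w *: (T - P)) * P = P.
    by rewrite mulrBl mul1r -bop_scalerAl NP scaler0 subr0.
  exists (P + L * (1 - P)); apply: (@inverse_lr _ _ (P + (1 - P) * S)).
    by rewrite mulrDl PN1 -mulrA QN mulrA LT QQ.
  by rewrite mulrDr NP1 mulrA NQ -mulrA TS QQ.
have [we|w1'] := eqVneq w 1.
  have [_ _ _ _ [S [ST TS]]] := sT.
  by move: ST TS; rewrite scale1r => ST TS; apply: (key S S); rewrite we scale1r.
have [S [ST TS]] : invertible (w^-1 *: (1 : U) - T).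
  apply: contrapT => /spT; rewrite invr_eq1 w1' => /(_ isT); apply/negP.
  rewrite -ltNge (lt_le_trans rho1)// -/(cabs _) cabsV -[leLHS]invr1 lef_pV2 ?posrE//.
  by rewrite lt_neqAle cabs_ge0 andbT eq_sym cabs_eq0.
have E : 1 - w *: T = w *: (w^-1 *: (1 : U) - T).
  by rewrite scalerBr scalerA divff// scale1r.
apply: (key ((1 - P) * (w^-1 *: S)) ((w^-1 *: S) * (1 - P))).
  have h : (w^-1 *: S) * (1 - w *: T) = 1.
    by rewrite E -bop_scalerAl -bop_scalerAr scalerA ST mulVf// scale1r.
  by rewrite -mulrA h mulr1.
have h : (1 - w *: T) * (w^-1 *: S) = 1.
  by rewrite E -bop_scalerAl -bop_scalerAr scalerA TS mulfV// scale1r.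
by rewrite mulrA h mul1r.
Qed.

Lemma simple_eigen_le1 (mu : R[i]) (x : V) : x != 0 -> T x = mu *: x -> cabs mu <= 1.
Proof.
move=> x0 Tx; have [->|mu1] := eqVneq mu 1; first by rewrite cabs1.
have := spT (eigenvalue_spectrum x0 Tx) mu1; rewrite -/(cabs mu).
by move=> h; rewrite (le_trans h)// ltW.
Qed.

End simple.

Section circle.
Variables (x : ser U) (P : U) (B rho : R).
Hypotheses (xB : l1le x B).
Hypotheses (sT : simple_eigenvalue (ev x 1) 1 P) (rho1 : rho < 1).
Hypothesis spT : forall lam, spectrum (ev x 1) lam -> lam != 1 -> complex.Re `|lam| <= rho.
Hypothesis rad : forall z, cabs z <= 1 -> z != 1 -> spectral_radius (ev x z) < 1.

(** Decay at each point comes from [powers_to_0]. Once a [k]-th power is below [4^-1] at [z], it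
    stays below [2^-1] nearby, and blocks of length [k] decay geometrically there; compactness does
    the rest. Around 1 the condition [d <= cabs (1 - z)] leaves no point. *)
Lemma circle_away (d eps : R) : 0 < d -> 0 < eps -> exists N, forall z, cabs z <= 1 ->
  d <= cabs (1 - z) -> forall n, (N <= n)%N -> opnorm (ev x z ^+ n) <= eps.
Proof.
move=> d0 eps0.
have [|N HN] := @disc_unif _ (fun n z => d <= cabs (1 - z) -> opnorm (ev x z ^+ n) <= eps).
  move=> z z1; have [->|zn1] := eqVneq z 1.
    exists 0%N, (d / 2) => [|w wd _ n _ dw]; first by rewrite divr_gt0.
    by have := le_trans dw wd; lra.
  have [|k0 Hk] := powers_to_0 (fun w => @radius_inverse _ w (rad z1 zn1)) (e := 4^-1); first by [].
  pose k := maxn k0 1; have k1 : (0 < k)%N by rewrite leq_maxr.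
  pose c := B + 1; have B0 := l1le_ge0 xB.
  have c1 : 1 <= c by rewrite lerDr.
  have c0 : 0 < c by rewrite (lt_le_trans _ c1).
  have ck0 : 0 < c ^+ k by rewrite exprn_gt0.
  have kc0 : 0 < 4 * (k%:R * c ^+ k) by rewrite !mulr_gt0// ltr0n.
  have evc w : cabs w <= 1 -> opnorm (ev x w) <= c.
    by move=> w1; rewrite (le_trans (ev_norm w1 xB))// lerDl.
  have e1 : 0 < (4 * (k%:R * c ^+ k))^-1 by rewrite invr_gt0.
  have [dd dd0 Hdd] := ev_unif xB e1.
  have e2 : 0 < eps / c ^+ k by rewrite divr_gt0.
  have [||j Hj] := expr_small (q := 2^-1 : R) _ _ e2; [by []|lra|].
  exists (j * k)%N, dd => // w zw w1 n jkn _.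
  have Ek : opnorm (ev x w ^+ k) <= 2^-1.
    have h1 := opnormX_dist k c1 (evc w w1) (evc z z1).
    have h2 : opnorm (ev x w - ev x z) <= (4 * (k%:R * c ^+ k))^-1.
      by apply: Hdd => //; rewrite cabsB.
    have h3 : opnorm (ev x w ^+ k - ev x z ^+ k) <= 4^-1.
      rewrite (le_trans h1)// (le_trans (ler_wpM2l _ h2))//.
        by rewrite mulr_ge0// ltW.
      by rewrite invfM mulrCA mulfV ?mulr1// mulf_neq0 ?pnatr_eq0 -?lt0n// gt_eqF.
    exact: quarter_half h3 (Hk k (leq_maxl _ _)) (opnorm_leD _ _).
  rewrite {1}(divn_eq n k) (le_trans (pow_block _ c1 (evc w w1) Ek _))//.
    by rewrite ltn_mod.
  by rewrite -ler_pdivlMr// Hj// leq_divRL.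
by exists N => z z1 dz n Nn; exact: HN.
Qed.

(** Near 1 the operator [ev x z] is a small perturbation of [ev x 1], and its eigenvalues lie in the
    closed disc, by (R2) or, at [z = 1] itself, by (R1). The rest of the disc is left to
    [circle_away]. *)
Lemma circle_powers : exists C : R,
  (forall z l, cabs z <= 1 -> opnorm (ev x z ^+ l) <= C) /\
  (forall eps, 0 < eps -> exists m0, forall m z, (m0 <= m)%N -> cabs z <= 1 ->
     opnorm ((1 - P) * ev x z ^+ m * (1 - P)) <= eps).
Proof.
have [PP PT TP] := simple_proj sT; have [v v0 Pv] := simple_vector sT.
have [C1 HC1] := perturbed_powers PP PT TP (simple_rank sT) v0 Pv
  (simple_inverse sT rho1 spT).
have near eps : 0 < eps -> exists2 d : R, 0 < d & exists m0, forall z, cabs z <= 1 ->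
    cabs (1 - z) <= d -> (forall l, opnorm (ev x z ^+ l) <= C1) /\
    (forall m, (m0 <= m)%N -> opnorm ((1 - P) * ev x z ^+ m * (1 - P)) <= eps).
  move=> eps0; have [del del0 [m0 H]] := HC1 eps eps0.
  have [d d0 Hd] := ev_unif xB del0; exists d => //; exists m0 => z z1 zd.
  have E : ev x z = ev x 1 + (ev x z - ev x 1) by rewrite addrC subrK.
  rewrite E; apply: H; first by apply: Hd; rewrite ?cabs1// cabsB.
  rewrite -E => mu y y0 zy.
  have [z1e|zn1] := eqVneq z 1.
    by rewrite z1e in zy; exact: (simple_eigen_le1 rho1 spT y0 zy).
  rewrite (le_trans (spectrum_le_radius (eigenvalue_spectrum y0 zy)))// ltW//.
  exact: rad.
have [d d0 [m1 H1]] := near 1 ltr01.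
have [N HN] := circle_away d0 ltr01.
have B0 := l1le_ge0 xB.
have B1 : 1 <= B + 1 by rewrite lerDr.
exists (Num.max C1 ((B + 1) ^+ N)); split=> [z l z1|eps eps0].
  rewrite le_max; apply/orP.
  have [dz|dz] := lerP d (cabs (1 - z)); last by left; apply: (H1 z z1 (ltW dz)).1.
  right; have [Nl|lN] := leqP N l.
    by rewrite (le_trans (HN z z1 dz l Nl))// exprn_ege1.
  rewrite (le_trans (opnormX _ _))// (@le_trans _ _ ((B + 1) ^+ l))//.
    rewrite lerXn2r// ?nnegrE ?opnorm_ge0//; first by rewrite (le_trans _ B1).
    by rewrite (le_trans (ev_norm z1 xB))// lerDl.
  by rewrite ler_weXn2l// ltnW.
have [d' d'0 [m2 H2]] := near eps eps0.
pose q := opnorm (1 - P) + 1.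
have q0 : 0 < q by rewrite ltr_wpDl// opnorm_ge0.
have e1 : 0 < eps / (q * q) by rewrite divr_gt0// mulr_gt0.
have [N' HN'] := circle_away d'0 e1.
exists (maxn m2 N') => m z; rewrite geq_max => /andP[m2m N'm] z1.
have [dz|dz] := lerP d' (cabs (1 - z)); last exact: (H2 z z1 (ltW dz)).2.
have qq : opnorm (1 - P) <= q by rewrite lerDl.
apply: (@le_trans _ _ (q * (eps / (q * q)) * q)).
  by do 2 apply: opnorm_le_mul => //; exact: HN'.
by rewrite (_ : q * (eps / (q * q)) * q = eps)//; field; rewrite gt_eqF.
Qed.

End circle.

End spectral_bounds.

(** * Weighted bounds for convolution powers *)

Section cauchy_schwarz.
Variable R : realType.
Implicit Types (A B : R).

Lemma sum_sq0 (n : nat) (a : nat -> R) : \sum_(i < n) a i ^+ 2 <= 0 ->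
  forall i, (i < n)%N -> a i = 0.
Proof.
move=> h i ni; apply/eqP; rewrite -sqrf_eq0 eq_le sqr_ge0 andbT.
apply: le_trans h; rewrite (bigD1 (Ordinal ni))//= lerDl.
by apply: sumr_ge0 => j _; exact: sqr_ge0.
Qed.

Lemma cauchy_schwarz (n : nat) (a b : nat -> R) A B : 0 <= A -> 0 <= B ->
  \sum_(i < n) a i ^+ 2 <= A ^+ 2 -> \sum_(i < n) b i ^+ 2 <= B ^+ 2 ->
  \sum_(i < n) a i * b i <= A * B.
Proof.
rewrite le_eqVlt => /predU1P[<- _|A0].
  rewrite expr0n /= mul0r => /sum_sq0 a0 _.
  by rewrite big1// => i _; rewrite a0 ?mul0r.
rewrite le_eqVlt => /predU1P[<- _|B0].
  rewrite expr0n /= mulr0 => /sum_sq0 b0.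
  by rewrite big1// => i _; rewrite b0 ?mulr0.
move=> aA bB.
have key i : a i * b i <= A * B / 2 * (a i ^+ 2 / A ^+ 2 + b i ^+ 2 / B ^+ 2).
  have -> : A * B / 2 * (a i ^+ 2 / A ^+ 2 + b i ^+ 2 / B ^+ 2) =
     a i * b i + A * B / 2 * (a i / A - b i / B) ^+ 2.
    by field; rewrite !gt_eqF.
  by rewrite lerDl mulr_ge0 ?sqr_ge0// divr_ge0// mulr_ge0 ?ltW.
apply: (@le_trans _ _ (\sum_(i < n) (A * B / 2 * (a i ^+ 2 / A ^+ 2 + b i ^+ 2 / B ^+ 2)))).
  by apply: ler_sum => i _; exact: key.
rewrite -mulr_sumr big_split /=.
rewrite -!mulr_suml (@le_trans _ _ (A * B / 2 * (1 + 1)))//; last first.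
  by rewrite mulrDr !mulr1 -splitr.
rewrite ler_wpM2l//; first by rewrite divr_ge0// mulr_ge0 ?ltW.
by rewrite lerD// ler_pdivrMr ?mul1r// exprn_gt0.
Qed.

(** Minkowski's inequality, from [cauchy_schwarz] applied to the cross term. *)
Lemma sq_sum_le (n : nat) (a b : nat -> R) A B : 0 <= A -> 0 <= B ->
  \sum_(i < n) a i ^+ 2 <= A ^+ 2 -> \sum_(i < n) b i ^+ 2 <= B ^+ 2 ->
  \sum_(i < n) (a i + b i) ^+ 2 <= (A + B) ^+ 2.
Proof.
move=> A0 B0 aA bB; have ab := cauchy_schwarz A0 B0 aA bB.
rewrite (eq_bigr (fun i : 'I_n => a i ^+ 2 + 2 * (a i * b i) + b i ^+ 2)); last first.
  by move=> i _; ring.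
rewrite !big_split /= -mulr_sumr.
move: aA bB ab; move: (\sum_(i < n) a i ^+ 2) (\sum_(i < n) b i ^+ 2) => x y.
move: (\sum_(i < n) _) => t; nra.
Qed.

End cauchy_schwarz.

Section square_summable.
Context (R : realType) (V : completeNormedModType R[i]).
Local Notation U := (bop V).
Implicit Types (x y : ser U) (A B C : R) (z : R[i]).

Definition l2le x B := forall N, \sum_(n < N) opnorm (x n) ^+ 2 <= B ^+ 2.

Lemma l2leD x y A B : 0 <= A -> 0 <= B -> l2le x A -> l2le y B -> l2le (x + y) (A + B).
Proof.
move=> A0 B0 xA yB N; apply: le_trans (sq_sum_le (a := nser x) (b := nser y) A0 B0 (xA N) (yB N)).
apply: ler_sum => i _; rewrite lerXn2r// ?nnegrE ?opnorm_ge0 ?addr_ge0 ?opnorm_ge0//.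
by rewrite serD opnormD.
Qed.

Lemma l2leW x A B : 0 <= A -> A <= B -> l2le x A -> l2le x B.
Proof.
move=> A0 AB xA N; rewrite (le_trans (xA N))// lerXn2r// nnegrE//.
exact: le_trans AB.
Qed.

Lemma l2le_sum (n : nat) (x : nat -> ser U) (A : nat -> R) : (forall i, 0 <= A i) ->
  (forall i, (i < n)%N -> l2le (x i) (A i)) ->
  l2le (\sum_(i < n) x i) (\sum_(i < n) A i).
Proof.
move=> A0; elim: n => [|n IH] xA.
  by rewrite !big_ord0 => N; rewrite big1 ?expr0n// => i _; rewrite opnorm0 expr0n.
rewrite !big_ord_recr /=; apply: l2leD => //; first exact: sumr_ge0.
- by apply: IH => i ni; apply: xA; rewrite ltnS ltnW.
- exact: xA.
Qed.

Lemma l2le_term x B n : 0 <= B -> l2le x B -> opnorm (x n) <= B.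
Proof.
move=> B0 /(_ n.+1); rewrite big_ord_recr /= => h.
rewrite -(@ler_pXn2r _ 2%N) ?nnegrE ?opnorm_ge0//.
by apply: le_trans h; rewrite lerDr; apply: sumr_ge0 => i _; exact: sqr_ge0.
Qed.

Lemma l2le_mono0 (T : U) : l2le (sermono 0 T) (opnorm T).
Proof.
move=> [|N]; first by rewrite big_ord0 sqr_ge0.
by rewrite big_ord_recl big1 ?addr0// => i _; rewrite /sermono /= opnorm0 expr0n.
Qed.

(* On the line spanned by P operators are scalars, so that Parseval's identity applies. *)
Variable P : U.
Definition on_line x := forall n, exists c : R[i], x n = c *: P.
Hypothesis PP : P * P = P.

Lemma on_lineM x y : on_line x -> on_line y -> on_line (x * y).
Proof.
move=> xP yP n; have [c xc] := choice xP; have [d yd] := choice yP.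
exists (\sum_(i < n.+1) c i * d (n - i)%N).
rewrite serM scaler_suml; apply: eq_bigr => i _.
by rewrite xc yd -bop_scalerAl -bop_scalerAr PP scalerA.
Qed.

Lemma on_lineC x y : on_line x -> on_line y -> x * y = y * x.
Proof.
move=> xP yP; have [c xc] := choice xP; have [d yd] := choice yP.
apply/funext => n; rewrite serM serMr; apply: eq_bigr => i _.
by rewrite xc yd -!bop_scalerAl -!bop_scalerAr !scalerA mulrC.
Qed.

Lemma on_lineD x y : on_line x -> on_line y -> on_line (x + y).
Proof.
by move=> xP yP n; have [c xc] := xP n; have [d yd] := yP n; exists (c + d);
  rewrite serD xc yd scalerDl.
Qed.

Lemma on_lineB x y : on_line x -> on_line y -> on_line (x - y).
Proof.
by move=> xP yP n; have [c xc] := xP n; have [d yd] := yP n; exists (c - d);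
  rewrite serB xc yd scalerBl.
Qed.

Lemma on_line_twist z x : on_line x -> on_line (twist z x).
Proof.
by move=> xP n; have [c xc] := xP n; exists (z ^+ n * c); rewrite /twist xc scalerA.
Qed.

Lemma on_line_trunc N x : on_line x -> on_line (trunc N x).
Proof.
move=> xP n; rewrite /trunc; case: ifP => // _.
by exists 0; rewrite scale0r.
Qed.

Lemma line_parseval M x : on_line x ->
  \sum_(j < M) opnorm (\sum_(n < M) (zeta R M ^+ j) ^+ n *: x n) ^+ 2 =
  M%:R * \sum_(n < M) opnorm (x n) ^+ 2.
Proof.
move=> xP; have [c xc] := choice xP.
transitivity (opnorm P ^+ 2 *
   \sum_(j < M) cabs (\sum_(n < M) (zeta R M ^+ j) ^+ n * c n) ^+ 2).
  rewrite mulr_sumr; apply: eq_bigr => j _.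
  rewrite (eq_bigr (fun n : 'I_M => ((zeta R M ^+ j) ^+ n * c n) *: P)).
    by rewrite -scaler_suml opnormZ exprMn mulrC.
  by move=> n _; rewrite xc scalerA.
rewrite parseval mulrCA; congr (_ * _); rewrite mulr_sumr; apply: eq_bigr => n _.
by rewrite xc opnormZ exprMn mulrC.
Qed.

(** Parseval turns multiplication by a function bounded by [C] on the circle into a bounded operator
    on l^2. Both series are truncated at [N'] and sampled at more than [2 N'] roots of unity, so
    that nothing wraps around; truncating [x] costs the extra 1. *)
Lemma l2leM x y A B C : on_line x -> on_line y -> l1le x A -> 0 <= B -> l2le y B ->
  (forall z, cabs z = 1 -> opnorm (ev x z) <= C) -> l2le (x * y) ((C + 1) * B).
Proof.
move=> xP yP xA B0 yB xC N.
have C0 : 0 <= C by apply: le_trans (opnorm_ge0 _) (xC 1 (cabs1 R)).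
have [N1 HN1] := psum_tail (nser_ge0 x) xA (ltr01 : (0 : R) < 1).
pose N' := maxn N N1; pose x' := trunc N' x; pose y' := trunc N' y.
pose M := (N' + N').+1.
have N'M : (N' <= M)%N by rewrite /M leqW// leq_addr.
have NM : (N <= M)%N by rewrite (leq_trans _ N'M)// leq_maxl.
have x'P : on_line x' by exact: on_line_trunc.
have y'P : on_line y' by exact: on_line_trunc.
rewrite (eq_bigr (fun n : 'I_N => opnorm ((x' * y') n) ^+ 2)); last first.
  move=> n _; congr (opnorm _ ^+ 2).
  have nN : (n < N')%N by rewrite (leq_trans (ltn_ord n))// leq_maxl.
  by apply: (@ser_eq_trunc _ _ _ _ _ n) => // m mn;
    rewrite /x' /y' /trunc (leq_ltn_trans mn nN).
apply: (@le_trans _ _ (\sum_(n < M) opnorm ((x' * y') n) ^+ 2)).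
  have a0 i : 0 <= opnorm ((x' * y') i) ^+ 2 by exact: sqr_ge0.
  exact: (@psum_mono _ (fun n => opnorm ((x' * y') n) ^+ 2) _ _ a0 NM).
have Mr : (0 : R) < M%:R by rewrite ltr0n.
rewrite -(ler_pM2l Mr) -line_parseval; last exact: on_lineM.
have osumE (w : ser U) z : osum (twist z w) M = \sum_(n < M) z ^+ n *: w n by [].
have supp w (k : nat) : (N' <= k)%N -> osum (trunc N' w) k = osum w N'.
  move=> N'k; rewrite /osum -(big_mkord xpredT (trunc N' w)) -(big_mkord xpredT w).
  rewrite (big_cat_nat (n := N'))//= [X in _ + X]big_nat_cond [X in _ + X]big1 ?addr0.
    by rewrite [LHS]big_nat_cond [RHS]big_nat_cond; apply: eq_bigr => i;
      rewrite /trunc => /andP[/andP[_ ->]].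
  by move=> i /andP[/andP[N'i _] _]; rewrite trunc_ge.
have twtr z w : twist z (trunc N' w) = trunc N' (twist z w).
  by apply/funext => n; rewrite /twist /trunc; case: ifP; rewrite ?scaler0.
have prodE z : osum (twist z (x' * y')) M = osum (twist z x') M * osum (twist z y') M.
  rewrite twistM osumM_eq /osum mulr_suml; apply: eq_bigr => i _.
  have [iN|Ni] := ltnP i N'; last by rewrite {1 3}/twist /x' trunc_ge// scaler0 !mul0r.
  congr (_ * _); rewrite /y' !twtr -!/(osum _ _) !supp//.
  by rewrite leq_subRL ?(leq_trans (ltnW iN))// /M addnC leqW// leq_add2l ltnW.
apply: (@le_trans _ _ (\sum_(j < M) (C + 1) ^+ 2 * opnorm (\sum_(n < M) (zeta R M ^+ j) ^+ n *: y' n) ^+ 2)).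
  apply: ler_sum => j _; rewrite -!osumE prodE -exprMn.
  have C1 : 0 <= C + 1 by rewrite addr_ge0.
  rewrite lerXn2r// ?nnegrE ?opnorm_ge0 ?mulr_ge0 ?opnorm_ge0//.
  apply: opnorm_le_mul => //.
  have z1 : cabs (zeta R M ^+ j) = 1 by rewrite cabs_zetaX.
  rewrite /x' twtr supp//.
  have tl : opnorm (ev x (zeta R M ^+ j) - osum (twist (zeta R M ^+ j) x) N') <= 1.
    apply: (ev_tail xA) => [|m Nm]; first by rewrite z1.
    by apply: HN1 => //; rewrite /N' leq_maxr.
  rewrite opnormB in tl.
  by rewrite (le_trans (opnorm_leD _ (ev x (zeta R M ^+ j))))// lerD// xC.
rewrite -mulr_sumr line_parseval// mulrCA ler_wpM2l ?(ltW Mr)// exprMn.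
rewrite ler_wpM2l ?sqr_ge0//.
apply: (@le_trans _ _ (\sum_(n < M) opnorm (y n) ^+ 2)) => //.
apply: ler_sum => n _; rewrite /y' /trunc; case: ifP => // _.
by rewrite opnorm0 expr0n sqr_ge0.
Qed.

End square_summable.

(** * Rotation and differentiation of double series *)

Section derivations.
(* In a double series the outer index is the power of w in sum_l w^l x^l, the inner one
   the power of z. *)
Context (R : realType) (V : completeNormedModType R[i]).
Local Notation U := (bop V).
Local Notation SS := (ser (ser U)).
Implicit Types (x y : ser U) (X Y : SS) (z : R[i]).

Definition Twist z X : SS := fun l => twist z (X l).

Lemma TwistM z X Y : Twist z (X * Y) = Twist z X * Twist z Y.
Proof.
apply/funext => l; rewrite /Twist !serM.
apply/funext => n; rewrite /twist !ser_sum scaler_sumr; apply: eq_bigr => i _.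
by rewrite -/(twist z (X i * Y (l - i)%N) n) twistM.
Qed.

Lemma TwistD z X Y : Twist z (X + Y) = Twist z X + Twist z Y.
Proof.
by apply/funext => l; apply/funext => n; rewrite /Twist /twist !serD scalerDr.
Qed.

(** The Euler operator z d/dz on generating functions. *)
Definition nder x : ser U := fun n => n%:R *: x n.
Definition Nder X : SS := fun l => nder (X l).

Lemma nderM x y : nder (x * y) = nder x * y + x * nder y.
Proof.
apply/funext => n; rewrite /nder serD !serM scaler_sumr -big_split /=.
apply: eq_bigr => i _; rewrite -bop_scalerAl -bop_scalerAr -scalerDl.
by rewrite -natrD subnKC// -ltnS.
Qed.

Lemma NderM X Y : Nder (X * Y) = Nder X * Y + X * Nder Y.
Proof.
apply/funext => l; rewrite serD !serM -big_split /=.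
transitivity (\sum_(i < l.+1) nder (X i * Y (l - i)%N)).
  by apply/funext => n; rewrite /Nder serM /nder !ser_sum scaler_sumr.
by apply: eq_bigr => i _; rewrite nderM.
Qed.

Lemma NderD X Y : Nder (X + Y) = Nder X + Nder Y.
Proof.
by apply/funext => l; apply/funext => n; rewrite /Nder /nder !serD scalerDr.
Qed.

Definition cst (T : U) : SS := sermono 0 (sermono 0 T).

Lemma Twist_cst z T : Twist z (cst T) = cst T.
Proof.
apply/funext => -[|l]; first exact: twist_mono0.
by apply/funext => n; rewrite /Twist /cst /sermono /= /twist scaler0.
Qed.

Lemma Nder_cst T : Nder (cst T) = 0.
Proof.
apply/funext => -[|l]; apply/funext => -[|n];
  by rewrite /Nder /cst /nder /sermono /= ?scale0r ?scaler0.
Qed.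

Lemma cstM S T : cst (S * T) = cst S * cst T.
Proof. by rewrite /cst !sermonoM. Qed.

Section geometric_identities.
Variables (P : U) (G q : SS).
Hypotheses (PG : cst P * G = G) (GP : G * cst P = G).
Hypotheses (Gl : G = cst P + q * G) (Gr : G = cst P + G * q).

(** By the hypotheses [(cst P - q) * G = cst P = G * (cst P - q)], so [G] is an inverse relative to
    the unit [cst P]. This is then the resolvent identity, and [Nder_geom] the derivative of an
    inverse. *)
Lemma Twist_geom z : Twist z G - G = Twist z G * (Twist z q - q) * G.
Proof.
have tGr : Twist z G = cst P + Twist z G * Twist z q.
  by rewrite {1}Gr TwistD TwistM Twist_cst.
have tGP : Twist z G * cst P = Twist z G by rewrite -{2}GP TwistM Twist_cst.
have e1 : Twist z G * Twist z q = Twist z G - cst P by rewrite {2}tGr addrC addKr.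
have e2 : q * G = G - cst P by rewrite {2}Gl addrC addKr.
rewrite mulrBr mulrBl e1 -mulrA e2 mulrBl PG mulrBr tGP.
by rewrite opprB [RHS]addrC addrA subrK.
Qed.

Lemma Nder_geom : Nder G = G * Nder q * G.
Proof.
have e1 : Nder G = Nder q * G + q * Nder G.
  by rewrite {1}Gl NderD Nder_cst add0r NderM.
have PN : cst P * Nder G = Nder G.
  by rewrite -{2}PG NderM Nder_cst mul0r add0r.
have e2 : G * q = G - cst P by rewrite {2}Gr addrC addKr.
have : G * Nder G = G * Nder q * G + (G - cst P) * Nder G.
  by rewrite {1}e1 mulrDr !mulrA e2.
rewrite mulrBl PN addrA => /eqP; rewrite eq_sym subr_eq => /eqP h.
by apply: (addIr (G * Nder G)); rewrite addrC.
Qed.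

End geometric_identities.
End derivations.

(** * Coefficient bounds relative to a weight *)

Section weighted.
Context (R : realType) (V : completeNormedModType R[i]).
Local Notation U := (bop V).
Local Notation SS := (ser (ser U)).
Variables (al : ser R) (K : R).
Hypotheses (K1 : 1 <= K) (al0 : forall n, 0 < al n).
Hypothesis al_dbl : forall n j, (j <= n)%N -> (n <= j + j)%N -> al j <= K * al n.
Implicit Types (x y : ser U) (z : R[i]).

Let K0 : 0 < K. Proof. exact: lt_le_trans K1. Qed.

Definition ale x (A : R) := forall n, opnorm (x n) <= A * al n.

Lemma ale_ge0 x A : ale x A -> 0 <= A.
Proof.
move=> /(_ 0%N) h; rewrite -(pmulr_lge0 _ (al0 0)).
exact: le_trans (opnorm_ge0 _) h.
Qed.

Lemma aleW x A B : A <= B -> ale x A -> ale x B.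
Proof. by move=> AB xA n; rewrite (le_trans (xA n))// ler_wpM2r// ltW. Qed.

Lemma aleD x y A B : ale x A -> ale y B -> ale (x + y) (A + B).
Proof.
by move=> xA yB n; rewrite serD (le_trans (opnormD _ _))// mulrDl lerD.
Qed.

Lemma ale_mono0 T : ale (sermono 0 T) (opnorm T / al 0%N).
Proof.
move=> [|n]; first by rewrite /sermono /= divfK// gt_eqF.
by rewrite /sermono /= opnorm0 mulr_ge0 ?divr_ge0 ?opnorm_ge0// ltW.
Qed.

(** In each term one of the two indices is at least [n / 2], and doubling replaces its weight by
    [K * al n]; the other factor is summed in l^1. *)
Lemma aleM x y A B A1 B1 : ale x A -> l1le x A1 -> ale y B -> l1le y B1 ->
  ale (x * y) (K * (A * B1 + A1 * B)).
Proof.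
move=> xA xA1 yB yB1 n.
have A0 := ale_ge0 xA; have B0 := ale_ge0 yB.
rewrite (le_trans (nserM x y n))// serM.
have an0 : 0 <= al n by rewrite ltW.
apply: (@le_trans _ _ (\sum_(i < n.+1)
   (A * (K * al n) * nser y (n - i)%N + nser x i * (B * (K * al n))))).
  apply: ler_sum => i _; have iN : (i <= n)%N by rewrite -ltnS.
  have [h|h] := leqP n (i + i)%N.
    apply: ler_wpDr; first by rewrite mulr_ge0 ?nser_ge0// mulr_ge0// mulr_ge0// ltW.
    rewrite ler_wpM2r ?nser_ge0// (le_trans (xA i))// ler_wpM2l//.
    exact: al_dbl.
  apply: ler_wpDl; first by rewrite mulr_ge0 ?nser_ge0// mulr_ge0// mulr_ge0// ltW.
  rewrite ler_wpM2l ?nser_ge0// (le_trans (yB _))// ler_wpM2l//.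
  by apply: al_dbl; [exact: leq_subr|lia].
rewrite big_split /= -mulr_sumr -mulr_suml.
have h1 : \sum_(i < n.+1) nser y (n - i)%N <= B1.
  rewrite (reindex_inj rev_ord_inj) /= (le_trans _ (yB1 n.+1))// /psum ler_sum// => i _.
  by rewrite subSS subKn// -ltnS.
have h2 := xA1 n.+1; rewrite /psum in h2.
have h3 : 0 <= K * al n by rewrite mulr_ge0// ltW.
apply: (@le_trans _ _ (A * (K * al n) * B1 + A1 * (B * (K * al n)))).
  apply: lerD; first by rewrite ler_wpM2l// mulr_ge0.
  by rewrite ler_wpM2r// mulr_ge0.
by rewrite le_eqVlt; apply/orP; left; apply/eqP; ring.
Qed.

Lemma aleX x A A1 k : ale x A -> l1le x A1 -> exists B, ale (x ^+ k) B.
Proof.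
move=> xA xA1; elim: k => [|k [B IH]].
  by exists (opnorm (1 : U) / al 0%N); rewrite expr0 -sermono1; exact: ale_mono0.
by exists (K * (A * A1 ^+ k + A1 * B)); rewrite exprS; apply: aleM => //; exact: l1leX.
Qed.

Lemma sum_half_div (k n : nat) : (0 < k)%N ->
  \sum_(j < n) (2^-1 : R) ^+ (j %/ k) <= 2 * k%:R.
Proof.
move=> k0; pose a : ser R := fun j => 2^-1 ^+ (j %/ k)%N.
have a0 j : 0 <= a j by rewrite exprn_ge0// invr_ge0.
have nnk : (n <= n * k)%N by rewrite leq_pmulr.
apply: (le_trans (psum_mono a0 nnk)).
have blk q : psum a (q * k)%N = (2 - 2 * 2^-1 ^+ q) * k%:R.
  elim: q => [|q IH]; first by rewrite mul0n psum0 expr0 mulr1 subrr mul0r.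
  rewrite mulSn addnC /psum big_split_ord /= -/(psum a (q * k)) IH.
  rewrite (eq_bigr (fun=> 2^-1 ^+ q)); last first.
    by move=> i _; rewrite /a divnMDl// divn_small// addn0.
  by rewrite sumr_const card_ord -[_ *+ k]mulr_natr exprS; field.
by rewrite blk ler_wpM2r// gerBl mulr_ge0// exprn_ge0// invr_ge0.
Qed.

(** [aleM] costs a factor [K] per product, which cannot be iterated on [D] directly. The power
    [H = D ^+ k] has l^1 norm at most [4^-1 / K], so that the recursion for the weighted constants
    of [H ^+ q] contracts; [G] is chosen to absorb its inhomogeneous term at the rate [2^-1]. *)
Lemma pow_weighted D (A C kap : R) : ale D A -> 0 <= kap -> kap < 1 -> 0 <= C ->
  (forall k, l1le (D ^+ k) (C * kap ^+ k)) ->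
  exists c : nat -> R, [/\ forall k, 0 <= c k,
    exists S, forall n, \sum_(k < n) c k <= S,
    forall k, l1le (D ^+ k) (c k) & forall k, ale (D ^+ k) (c k)].
Proof.
move=> DA kap0 kap1 C0 Dk.
have e0 : 0 < 4^-1 / (K * (C + 1)) by rewrite divr_gt0// mulr_gt0// ltr_wpDl.
have [k0 Hk0] := expr_small kap0 kap1 e0.
pose k := maxn k0 1; have k1 : (0 < k)%N by rewrite leq_maxr.
pose H := D ^+ k.
have hH : C * kap ^+ k <= 4^-1 / K.
  apply: (@le_trans _ _ ((C + 1) * (4^-1 / (K * (C + 1))))).
    by apply: ler_pM => //; [exact: exprn_ge0|rewrite lerDl|exact/Hk0/leq_maxl].
  rewrite le_eqVlt; apply/orP; left; apply/eqP; field.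
  by rewrite !gt_eqF// ltr_wpDl.
have hH4 : C * kap ^+ k <= 4^-1.
  by rewrite (le_trans hH)// ler_piMr// invf_le1.
have D1 : l1le D (C * kap) by have := Dk 1%N; rewrite !expr1.
have [A1 HA1] := aleX k DA D1; have A10 := ale_ge0 HA1.
pose G := 4 * K * A1 + opnorm (1 : U) / al 0%N.
have o0 : 0 <= opnorm (1 : U) / al 0%N by rewrite divr_ge0 ?opnorm_ge0// ltW.
have KA0 : 0 <= K * A1 by rewrite mulr_ge0// ltW.
have G0 : 0 <= G by rewrite addr_ge0// -mulrA mulr_ge0.
have H1 q : l1le (H ^+ q) (4^-1 ^+ q).
  by apply: l1leX; exact: l1leW hH4 (Dk k).
have Ha q : ale (H ^+ q) (G * 2^-1 ^+ q).
  elim: q => [|q IH].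
    rewrite !expr0 mulr1 -sermono1; apply: aleW (ale_mono0 1).
    by rewrite /G lerDr -mulrA mulr_ge0.
  rewrite exprSr; apply: aleW (aleM IH (H1 q) HA1 (l1leW hH (Dk k))).
  have q4 : (4^-1 : R) ^+ q <= 2^-1 ^+ q by rewrite lerXn2r ?nnegrE ?invr_ge0 ?ler0n// lef_pV2 ?posrE// ler_nat.
  have -> : K * (G * 2^-1 ^+ q * (4^-1 / K) + 4^-1 ^+ q * A1) =
      4^-1 * G * 2^-1 ^+ q + (K * A1) * 4^-1 ^+ q by field; rewrite gt_eqF.
  have h1 := ler_wpM2l KA0 q4.
  have h2 : (4 * (K * A1)) * 2^-1 ^+ q <= G * 2^-1 ^+ q.
    by rewrite ler_wpM2r ?exprn_ge0 ?invr_ge0// /G mulrA lerDl.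
  rewrite exprS; move: h1 h2; move: (2^-1 ^+ q) (4^-1 ^+ q) (K * A1) => a b c.
  lra.
have DAi i := aleX i DA D1.
have [F HF] := choice DAi; have F0 i := ale_ge0 (HF i).
pose S1 := \sum_(i < k) F i; pose S2 := \sum_(i < k) C * kap ^+ i.
pose b := K * (G * S2 + S1) + S2.
have S10 : 0 <= S1 by apply: sumr_ge0.
have Ck0 i : 0 <= C * kap ^+ i by rewrite mulr_ge0// exprn_ge0.
have S20 : 0 <= S2 by apply: sumr_ge0.
have b0 : 0 <= K * (G * S2 + S1) by rewrite mulr_ge0 ?addr_ge0 ?mulr_ge0// ltW.
have half0 q : 0 <= (2^-1 : R) ^+ q by rewrite exprn_ge0// invr_ge0.
have FS i : (i < k)%N -> F i <= S1.
  move=> ik; rewrite /S1 (bigD1 (Ordinal ik))//= lerDl.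
  by apply: sumr_ge0.
have CS i : (i < k)%N -> C * kap ^+ i <= S2.
  move=> ik; rewrite /S2 (bigD1 (Ordinal ik))//= lerDl.
  by apply: sumr_ge0.
have q42 q : (4^-1 : R) ^+ q <= 2^-1 ^+ q by rewrite lerXn2r ?nnegrE ?invr_ge0 ?ler0n// lef_pV2 ?posrE// ler_nat.
have DE j : D ^+ j = H ^+ (j %/ k) * D ^+ (j %% k).
  by rewrite {1}(divn_eq j k) exprD mulnC exprM.
exists (fun j => b * 2^-1 ^+ (j %/ k)); split.
- by move=> j; rewrite mulr_ge0// addr_ge0.
- exists (b * (2 * k%:R)) => n; rewrite -mulr_sumr ler_wpM2l ?addr_ge0//.
  exact: sum_half_div.
- move=> j; rewrite DE; have jk : (j %% k < k)%N by rewrite ltn_mod.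
  apply: l1leW (l1leM (H1 _) (Dk _)); rewrite mulrC; apply: ler_pM => //.
  by rewrite (le_trans (CS _ jk))// /b lerDr.
- move=> j; rewrite DE; have jk : (j %% k < k)%N by rewrite ltn_mod.
  apply: aleW (aleM (Ha _) (H1 _) (HF _) (Dk _)).
  apply: (@le_trans _ _ (K * (G * S2 + S1) * 2^-1 ^+ (j %/ k))); last first.
    by rewrite ler_wpM2r// /b lerDl.
  rewrite -[leRHS]mulrA ler_wpM2l ?(ltW K0)// [leRHS]mulrDl; apply: lerD.
    by rewrite mulrAC ler_wpM2r// ler_wpM2l// CS.
  by rewrite mulrC; apply: ler_pM => //; exact: FS.
Qed.

End weighted.

Section angles.
Variable R : realType.

(** For [n / 2 <= m <= n] the angle [m pi / n] lies in [[pi / 2, pi]], where the cosine is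
    nonpositive. *)
Lemma expiX_pi_lower (n m : nat) : (1 <= n)%N -> (n <= m + m)%N -> (m <= n)%N ->
  1 <= cabs (expi (pi / n%:R : R) ^+ m - 1).
Proof.
move=> n1 nm mn; rewrite expiX; set t := m%:R * (pi / n%:R).
have n0 : (0 : R) < n%:R by rewrite ltr0n.
have t1 : pi / 2 <= t.
  rewrite /t mulrCA ler_wpM2l ?pi_ge0// ler_pdivlMr// mulrC ler_pdivrMr//.
  by rewrite -natrM ler_nat muln2 -addnn.
have t2 : t <= pi.
  by rewrite /t mulrCA ler_piMr ?pi_ge0// ler_pdivrMr// mul1r ler_nat.
have ct : cos t <= 0.
  have := @cos_ge0_pihalf R (pi - t).
  rewrite addrC cosDpi cosN => h; rewrite -oppr_ge0; apply: h.
  by have := @pi_ge0 R; lra.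
rewrite cabsB; apply: le_trans (norm_Re_le _); rewrite /=.
by rewrite ger0_norm; lra.
Qed.

Lemma expiX_pi_upper (n m : nat) : (1 <= n)%N ->
  cabs (expi (pi / n%:R : R) ^+ m - 1) <= 4 * Num.min 1 (m%:R / n%:R).
Proof.
move=> n1; have n0 : (0 : R) < n%:R by rewrite ltr0n.
have w1 : cabs (expi (pi / n%:R : R)) <= 1 by rewrite cabs_expi.
have pn0 : 0 <= pi / n%:R :> R by rewrite divr_ge0 ?pi_ge0.
rewrite minr_pMr// le_min mulr1; apply/andP; split.
  have := cabsD (expi (pi / n%:R : R) ^+ m) (- 1).
  by rewrite cabsN cabs1 cabsX cabs_expi expr1n; lra.
have := cabs_subX m w1 (_ : cabs (1 : R[i]) <= 1); rewrite cabs1 expr1n => /(_ (lexx 1)).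
have := @cabs_1B_expi R _ pn0.
rewrite cabsB => /(_ _) h1 h2; rewrite (le_trans h2)// mulrA [4 * _]mulrC -mulrA.
rewrite ler_wpM2l// (le_trans (h1 _))//.
  by rewrite ler_pdivrMr// ler_peMr ?pi_ge0// ler1n.
by rewrite ler_wpM2r ?invr_ge0//; have := @pihalf_lt2 R; lra.
Qed.

End angles.

Lemma dyad_cond (a t : nat) : (t < a)%N ->
  (a + a <= a.+1 + t + (a.+1 + t))%N && (a.+1 + t <= a + a)%N.
Proof. lia. Qed.

Lemma half_cond (n t : nat) : (t <= n)%N -> (n - t + (n - t) < n)%N -> (n <= t + t)%N.
Proof. lia. Qed.

(** * Square-sum estimate for the corner *)

Section renewal_estimate.
Context (R : realType) (V : completeNormedModType R[i]).
Local Notation U := (bop V).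
Local Notation SS := (ser (ser U)).
Variables (al : ser R) (K : R).
Hypotheses (K1 : 1 <= K) (al0 : forall n, 0 < al n).
Hypothesis al_dbl : forall n j, (j <= n)%N -> (n <= j + j)%N -> al j <= K * al n.
Hypothesis al_sq : forall N n, (1 <= n)%N ->
  \sum_(m < N) (al m * Num.min 1 (m%:R / n%:R)) ^+ 2 <= K * al n.
Hypothesis al_dyad : forall k,
  \sum_(i < k) Num.sqrt ((2 ^ i)%:R * al (2 ^ i)%N) <= K.
Variables (P : U) (G q : SS) (c : nat -> R) (S C0 : R).
Hypotheses (PP : P * P = P) (G0 : G 0%N = sermono 0 P).
Hypotheses (PG : cst P * G = G) (GP : G * cst P = G).
Hypotheses (Gl : G = cst P + q * G) (Gr : G = cst P + G * q).
Hypotheses (Gline : forall l, on_line P (G l)) (qline : forall k, on_line P (q k)).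
Hypotheses (c0 : forall k, 0 <= c k) (cS : forall n, \sum_(k < n) c k <= S).
Hypothesis qc : forall k, ale al (q k) (c k).
Hypothesis Gl1 : forall l, exists A, l1le (G l) A.
Hypothesis Gsup : forall l z, cabs z = 1 -> opnorm (ev (G l) z) <= C0.

Let K0 : 0 < K. Proof. exact: lt_le_trans K1. Qed.
Let S0 : 0 <= S. Proof. by have := cS 0; rewrite big_ord0. Qed.
Let C00 : 0 <= C0.
Proof. by apply: le_trans (opnorm_ge0 _) (Gsup 0 (cabs1 R)). Qed.
Let C1 := C0 + 1.
Let C10 : 0 <= C1. Proof. exact: addr_ge0. Qed.
Let s (n : nat) := Num.sqrt (K * al n).
Let s0 n : 0 <= s n. Proof. exact: sqrtr_ge0. Qed.
Let s2 n : s n ^+ 2 = K * al n.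
Proof. by rewrite sqr_sqrtr// mulr_ge0// ltW. Qed.

Let om (n : nat) := expi (pi / n%:R : R).
Let om1 n : cabs (om n) = 1. Proof. exact: cabs_expi. Qed.

Let tw n (x : ser U) := twist (om n) x.

Let tw_sup n l z : cabs z = 1 -> opnorm (ev (tw n (G l)) z) <= C0.
Proof.
move=> z1; rewrite (_ : ev _ z = ev (G l) (z * om n)); last first.
  rewrite /ev; congr tsum; apply/funext => m.
  by rewrite /tw /twist scalerA exprMn.
by apply: Gsup; rewrite cabsM z1 om1 mul1r.
Qed.

Let l2_Gl l x B : 0 <= B -> on_line P x -> l2le x B -> l2le (G l * x) (C1 * B).
Proof.
move=> B0 xP xB; have [A lA] := Gl1 l.
by apply: (l2leM PP (Gline l) xP lA B0 xB) => z; exact: Gsup.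
Qed.

Let l2_tGl n l x B : 0 <= B -> on_line P x -> l2le x B -> l2le (tw n (G l) * x) (C1 * B).
Proof.
move=> B0 xP xB; have [A lA] := Gl1 l.
apply: (l2leM PP (on_line_twist _ (Gline l)) xP _ B0 xB) => [|z]; last exact: tw_sup.
by apply: (l1le_twist (B := A)) lA; rewrite om1.
Qed.

Let dq n k := tw n (q k) - q k.
Let dq_line n k : on_line P (dq n k).
Proof. by apply: on_lineB => //; exact: on_line_twist. Qed.

(** The rotation changes the coefficient [m] by a factor [O(min(1, m / n))], and [al_sq] bounds the
    resulting sum. *)
Let dq_l2 n k : (1 <= n)%N -> l2le (dq n k) (4 * c k * s n).
Proof.
move=> n1 N; apply: (@le_trans _ _ ((4 * c k) ^+ 2 *
   \sum_(m < N) (al m * Num.min 1 (m%:R / n%:R)) ^+ 2)).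
  rewrite mulr_sumr; apply: ler_sum => m _.
  have mn0 : 0 <= Num.min 1 (m%:R / n%:R) :> R by rewrite le_min ler01 divr_ge0.
  have a0 := ltW (al0 m).
  rewrite -exprMn lerXn2r// ?nnegrE ?opnorm_ge0// ?mulr_ge0//.
  rewrite /dq /tw serB /twist -{2}[q k m]scale1r -scalerBl opnormZ.
  apply: (@le_trans _ _ ((4 * Num.min 1 (m%:R / n%:R)) * (c k * al m))).
    by apply: ler_pM; rewrite ?cabs_ge0 ?opnorm_ge0 ?expiX_pi_upper// qc.
  by rewrite le_eqVlt; apply/orP; left; apply/eqP; ring.
by rewrite [leRHS]exprMn s2 ler_wpM2l ?sqr_ge0// al_sq.
Qed.

Let D0 := C1 * (C1 * (4 * S)).
Let D00 : 0 <= D0. Proof. by rewrite !mulr_ge0. Qed.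
Let dG_line n l : on_line P (tw n (G l) - G l).
Proof. by apply: on_lineB => //; exact: on_line_twist. Qed.

Let sum_line (n : nat) (x : nat -> ser U) : (forall i, on_line P (x i)) ->
  on_line P (\sum_(i < n) x i).
Proof.
move=> xP; elim: n => [|n IH]; last by rewrite big_ord_recr /=; exact: on_lineD.
by rewrite big_ord0 => m; exists 0; rewrite scale0r.
Qed.

(** In [Twist_geom] the two outer factors act on l^2 with norm [C1]. The sum over the degree of [q]
    converges by [cS]; the remaining free degree takes [l + 1] values, whence the factor. *)
Let dG_l2 n l : (1 <= n)%N -> l2le (tw n (G l) - G l) (l.+1%:R * (D0 * s n)).
Proof.
move=> n1; have -> : tw n (G l) - G l = (Twist (om n) G - G) l by [].
rewrite (Twist_geom PG GP Gl Gr) -mulrA serM.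
have inner j : l2le (((Twist (om n) q - q) * G) j) (C1 * (4 * S) * s n).
  rewrite serM.
  apply: (@l2leW _ _ _ (\sum_(k < j.+1) C1 * (4 * c k * s n))).
  - by apply: sumr_ge0 => k _; rewrite !mulr_ge0.
  - rewrite (eq_bigr (fun k : 'I_j.+1 => C1 * 4 * s n * c k)); last by move=> k _; ring.
    rewrite -mulr_sumr (_ : C1 * (4 * S) * s n = C1 * 4 * s n * S); last by ring.
    by rewrite ler_wpM2l ?cS// !mulr_ge0.
  apply: (l2le_sum (x := fun k => (Twist (om n) q - q) k * G (j - k)%N)
    (A := fun k => C1 * (4 * c k * s n))) => k; first by rewrite !mulr_ge0.
  move=> _; rewrite -(on_lineC (Gline _) (dq_line n k)).
  by apply: l2_Gl; [rewrite !mulr_ge0|exact: dq_line|exact: dq_l2].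
have inner_line j : on_line P (((Twist (om n) q - q) * G) j).
  rewrite serM; apply: (@sum_line j.+1 (fun k => (Twist (om n) q - q) k * G (j - k)%N)) => k.
  exact: (on_lineM PP (dq_line n k)).
apply: (@l2leW _ _ _ (\sum_(i < l.+1) (C1 * (C1 * (4 * S) * s n)))).
- by apply: sumr_ge0 => i _; rewrite !mulr_ge0.
- by rewrite sumr_const card_ord -[_ *+ _]mulr_natl /D0 !mulrA.
apply: (l2le_sum (x := fun i => Twist (om n) G i * ((Twist (om n) q - q) * G) (l - i)%N)
    (A := fun=> C1 * (C1 * (4 * S) * s n))) => i; first by rewrite !mulr_ge0.
by move=> _; apply: l2_tGl => //; rewrite !mulr_ge0.
Qed.

Let D1 := C1 * D0.
Let D10 : 0 <= D1. Proof. exact: mulr_ge0. Qed.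
Let dGG_l2 n i j : (1 <= n)%N ->
  l2le (tw n (G i * G j) - G i * G j) ((i + j).+2%:R * (D1 * s n)).
Proof.
move=> n1; rewrite /tw twistM -/(tw _ _) -/(tw _ _).
have -> : tw n (G i) * tw n (G j) - G i * G j =
   tw n (G i) * (tw n (G j) - G j) + G j * (tw n (G i) - G i).
  rewrite (on_lineC (Gline j) (dG_line n i)) mulrBr mulrBl addrA subrK//.
have -> : (i + j).+2%:R * (D1 * s n) =
    C1 * (j.+1%:R * (D0 * s n)) + C1 * (i.+1%:R * (D0 * s n)).
  by rewrite /D1 -addSn -addnS natrD; ring.
have h k : 0 <= k.+1%:R * (D0 * s n) by rewrite !mulr_ge0.
apply: l2leD; rewrite ?mulr_ge0//.
- by apply: l2_tGl => //; exact: dG_l2.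
- by apply: l2_Gl => //; exact: dG_l2.
Qed.

(** The restriction to [[n / 2, n]], where rotation moves each coefficient by at least its own
    norm. *)
Let blk n (x : ser U) m : R := if (n <= m + m)%N && (m <= n)%N then nser x m else 0.

Let blk_l2 n x B N : (1 <= n)%N -> l2le (tw n x - x) B ->
  \sum_(m < N) blk n x m ^+ 2 <= B ^+ 2.
Proof.
move=> n1 xB; apply: le_trans (xB N); apply: ler_sum => m _.
rewrite /blk; case: ifPn => [/andP[nm mn]|_]; last by rewrite expr0n sqr_ge0.
rewrite lerXn2r// ?nnegrE ?opnorm_ge0//.
rewrite serB /tw /twist -{2}[x m]scale1r -scalerBl opnormZ.
by rewrite ler_peMl ?opnorm_ge0// expiX_pi_lower.
Qed.

Let C5 := C1 * (C1 * opnorm P) + D1 * Num.sqrt K * K.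
Let C50 : 0 <= C5.
Proof. by rewrite addr_ge0// !mulr_ge0// ?opnorm_ge0 ?sqrtr_ge0// ltW. Qed.

Let P_line : on_line P (sermono 0 P).
Proof. by move=> [|n]; [exists 1; rewrite scale1r|exists 0; rewrite scale0r]. Qed.

(** On the dyadic block [(2^k, 2^(k+1)]] Cauchy-Schwarz turns the square sum into an l^1 bound of
    order [sqrt (2^(k+1) al(2^(k+1)))], and [al_dyad] adds these up. The coefficient 0, which
    rotations do not move, is bounded through the l^2 norm instead. *)
Let GG_l1 i j : l1le (G i * G j) ((i + j).+2%:R * C5).
Proof.
set H := G i * G j; set w : R := (i + j).+2%:R.
have w1 : 1 <= w by rewrite ler1n.
have w0 : 0 <= w by [].
have GjP : G j * sermono 0 P = G j.
  have := congr1 (fun X : SS => X j) GP; rewrite /= serMr big_ord_recl big1.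
    by rewrite addr0 subn0.
  by move=> k _; rewrite /cst /sermono /= mulr0.
have H0 : nser H 0%N <= C1 * (C1 * opnorm P).
  have p0 := opnorm_ge0 P.
  apply: (l2le_term (B := C1 * (C1 * opnorm P))); first by rewrite !mulr_ge0.
  rewrite /H -GjP; apply: l2_Gl; first by rewrite mulr_ge0.
    exact: (on_lineM PP (Gline j) P_line).
  by apply: l2_Gl => //; exact: l2le_mono0.
have sq (k : nat) : Num.sqrt (2 ^ k)%:R * (w * (D1 * s (2 ^ k)%N)) =
    Num.sqrt ((2 ^ k)%:R * al (2 ^ k)%N) * (w * (D1 * Num.sqrt K)).
  rewrite /s !sqrtrM ?(ltW K0) ?ler0n//; ring.
have dy k : psum (nser H) (2 ^ k).+1 <= C1 * (C1 * opnorm P) +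
    (\sum_(t < k.+1) Num.sqrt ((2 ^ t)%:R * al (2 ^ t)%N)) * (w * (D1 * Num.sqrt K)).
  elim: k => [|k IH].
    rewrite expn0 !psumS psum0 add0r big_ord_recl big_ord0 addr0.
    apply: lerD => //; rewrite -sq expn0 sqrtr1 mul1r.
    have B0 : 0 <= w * (D1 * s 1%N) by rewrite !mulr_ge0.
    have := blk_l2 2 (leqnn 1) (dGG_l2 i j (leqnn 1)).
    rewrite !big_ord_recl big_ord0 /= /blk /= expr0n add0r addr0.
    by rewrite ler_pXn2r// nnegrE// nser_ge0.
  have E : (2 ^ k.+1).+1 = ((2 ^ k).+1 + 2 ^ k)%N by rewrite expnS mul2n -addnn.
  rewrite E /psum big_split_ord /= -/(psum _ _) [X in _ <= _ + X * _]big_ord_recr /=.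
  rewrite [X in _ <= _ + X]mulrDl addrA.
  apply: lerD => //.
  have n1 : (1 <= 2 ^ k.+1)%N by rewrite expn_gt0.
  have B0 : 0 <= w * (D1 * s (2 ^ k.+1)%N) by rewrite !mulr_ge0.
  have r0 : (0 : R) <= Num.sqrt (2 ^ k.+1)%:R by rewrite sqrtr_ge0.
  have h1 : \sum_(t < 2 ^ k) nser H ((2 ^ k).+1 + t)%N ^+ 2 <= (w * (D1 * s (2 ^ k.+1)%N)) ^+ 2.
    apply: le_trans (blk_l2 (2 ^ k.+1).+1 n1 (dGG_l2 i j n1)).
    rewrite E big_split_ord /=; apply: ler_wpDl; first by apply: sumr_ge0 => t _; exact: sqr_ge0.
    apply: ler_sum => t _; rewrite /blk.
    have -> : (2 ^ k.+1 <= (2 ^ k).+1 + t + ((2 ^ k).+1 + t))%N && ((2 ^ k).+1 + t <= 2 ^ k.+1)%N.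
      by rewrite expnS mul2n -addnn; exact: dyad_cond.
    by [].
  have h2 : \sum_(t < 2 ^ k) (1 : R) ^+ 2 <= Num.sqrt (2 ^ k.+1)%:R ^+ 2.
    rewrite (eq_bigr (fun=> 1)); last by move=> t _; rewrite expr1n.
    rewrite sumr_const card_ord sqr_sqrtr// ler_nat leq_exp2l//.
  have h3 := cauchy_schwarz (a := fun t => nser H ((2 ^ k).+1 + t)%N) (b := fun=> 1) B0 r0 h1 h2.
  rewrite -sq [leRHS]mulrC; apply: le_trans h3.
  by apply: ler_sum => t _; rewrite mulr1.
move=> N; have NN : (N <= (2 ^ N).+1)%N by rewrite leqW// ltnW// ltn_expl.
rewrite (le_trans (psum_mono (nser_ge0 H) NN))// (le_trans (dy N))//.
rewrite /C5 mulrDr; apply: lerD.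
  by rewrite ler_peMl// !mulr_ge0// opnorm_ge0.
have -> : w * (D1 * Num.sqrt K * K) = K * (w * (D1 * Num.sqrt K)) by ring.
rewrite ler_wpM2r ?al_dyad// !mulr_ge0// sqrtr_ge0//.
Qed.

Let G_l1 l : l1le (G l) (l.+2%:R * C5).
Proof.
have -> : G l = G 0%N * G l.
  have := congr1 (fun X : SS => X l) PG; rewrite /= serM big_ord_recl big1.
    by rewrite addr0 subn0 G0.
  by move=> k _; rewrite /cst /sermono /= mul0r.
exact: (GG_l1 0 l).
Qed.

(** If the index [n - t] of [G i * G j] is at least [n / 2], both factors have controlled square
    sums and Cauchy-Schwarz produces [s n ^+ 2 = K * al n]. Otherwise [t >= n / 2], doubling bounds
    [t * al t] by [n * (K * al n)], and [GG_l1] sums the other factor. *)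
Let term_bound n k i j : (1 <= n)%N ->
  opnorm ((nder (q k) * (G i * G j)) n) <=
  c k * (n%:R * (K * al n) * ((i + j).+2%:R * (D1 + C5))).
Proof.
move=> n1; set H := G i * G j; set w : R := (i + j).+2%:R.
have w0 : 0 <= w by [].
have n0 : (0 : R) < n%:R by rewrite ltr0n.
have an0 := al0 n.
rewrite (le_trans (nserM _ _ _))// serM.
pose a t : R := n%:R * (al t * Num.min 1 (t%:R / n%:R)).
apply: (@le_trans _ _ (\sum_(t < n.+1)
   c k * (a t * blk n H (n - t)%N + n%:R * (K * al n) * nser H (n - t)%N))).
  apply: ler_sum => t _; have tn : (t <= n)%N by rewrite -ltnS.
  have nn : nser (nder (q k)) t <= c k * (t%:R * al t).
    rewrite /nser /nder opnormZ cabs_nat mulrCA ler_wpM2l//; exact: qc.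
  rewrite (le_trans (ler_wpM2r (nser_ge0 _ _) nn))// -[leLHS]mulrA ler_wpM2l//.
  have mn : Num.min 1 (t%:R / n%:R) = t%:R / n%:R :> R.
    by rewrite min_r// ler_pdivrMr// mul1r ler_nat.
  have aE : a t = t%:R * al t by rewrite /a mn; field; rewrite gt_eqF.
  have [h|h] := leqP n (n - t + (n - t)).
    rewrite /blk h leq_subr /= aE lerDl !mulr_ge0 ?nser_ge0// ?ltW//.
  apply: ler_wpDl.
    rewrite aE !mulr_ge0 ?(ltW (al0 t))// /blk; case: ifP => // _; exact: nser_ge0.
  rewrite ler_wpM2r ?nser_ge0//; apply: ler_pM => //; rewrite ?(ltW (al0 t)) ?ler_nat//.
  by apply: al_dbl => //; exact: half_cond.
rewrite -mulr_sumr ler_wpM2l// big_split /= mulrDr mulrDr; apply: lerD.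
  have A0 : 0 <= n%:R * s n by rewrite mulr_ge0// ltW.
  have B0 : 0 <= w * (D1 * s n) by rewrite !mulr_ge0.
  have h1 : \sum_(t < n.+1) a t ^+ 2 <= (n%:R * s n) ^+ 2.
    rewrite (eq_bigr (fun t : 'I_n.+1 => n%:R ^+ 2 * (al t * Num.min 1 (t%:R / n%:R)) ^+ 2)).
      by rewrite -mulr_sumr exprMn s2 ler_wpM2l ?sqr_ge0// al_sq.
    by move=> t _; rewrite /a exprMn.
  have h2 : \sum_(t < n.+1) blk n H (n - t)%N ^+ 2 <= (w * (D1 * s n)) ^+ 2.
    apply: le_trans (blk_l2 n.+1 n1 (dGG_l2 i j n1)).
    rewrite [leRHS](reindex_inj rev_ord_inj) /=.
    by apply: ler_sum => t _; rewrite subSS.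
  apply: le_trans (cauchy_schwarz (b := fun t => blk n H (n - t)%N) A0 B0 h1 h2) _.
  rewrite -s2 expr2 le_eqVlt; apply/orP; left; apply/eqP; ring.
rewrite -mulr_sumr ler_wpM2l//; first by rewrite !mulr_ge0// ltW.
apply: le_trans (GG_l1 i j n.+1).
rewrite [leRHS]/psum (reindex_inj rev_ord_inj) /=.
by apply: ler_sum => t _; rewrite subSS subKn// -ltnS.
Qed.

Lemma renewal_estimate : exists2 C : R, 0 <= C & forall l,
  ale al (G l) (C * l.+2%:R ^+ 2) /\ l1le (G l) (C * l.+2%:R).
Proof.
pose C6 := S * K * (D1 + C5) + C5 / al 0%N + C5.
have a0 := al0 0.
have DC0 : 0 <= D1 + C5 by exact: addr_ge0.
have h1 : 0 <= S * K * (D1 + C5) by apply: mulr_ge0 => //; apply: mulr_ge0 => //; exact: ltW.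
have h2 : 0 <= C5 / al 0%N by rewrite divr_ge0// ltW.
exists C6; first by do 2 apply: addr_ge0 => //.
move=> l; split; last first.
  by apply: l1leW (G_l1 l); rewrite mulrC ler_wpM2r// /C6 lerDr addr_ge0.
have l2 : (1 : R) <= l.+2%:R by rewrite ler1n.
case=> [|n].
  rewrite (le_trans (l1le_term 0 (G_l1 l)))//.
  apply: (@le_trans _ _ (C5 / al 0%N * l.+2%:R ^+ 2 * al 0%N)); last first.
    rewrite ler_wpM2r ?(ltW a0)// ler_wpM2r ?sqr_ge0// /C6.
    by move: h1 h2 C50; lra.
  rewrite mulrAC divfK ?gt_eqF// mulrC ler_wpM2l// expr2 ler_peMr//.
have n0 : (0 : R) < n.+1%:R by rewrite ltr0n.
have E : n.+1%:R *: G l n.+1 = (Nder G) l n.+1 by [].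
have NE : opnorm (n.+1%:R *: G l n.+1) <=
    l.+1%:R * (S * (n.+1%:R * (K * al n.+1) * (l.+2%:R * (D1 + C5)))).
  rewrite E (Nder_geom PG Gl Gr) -mulrA serM ser_sum.
  rewrite (le_trans (opnorm_sum _ _ _))//.
  set W := n.+1%:R * (K * al n.+1) * (l.+2%:R * (D1 + C5)).
  have W0 : 0 <= W.
    by apply: mulr_ge0; apply: mulr_ge0 => //; apply: mulr_ge0; exact: ltW.
  apply: (@le_trans _ _ (\sum_(i < l.+1) S * W)); last first.
    by rewrite sumr_const card_ord -[_ *+ _]mulr_natl.
  apply: ler_sum => i _; rewrite serM mulr_sumr ser_sum.
  rewrite (le_trans (opnorm_sum _ _ _))//.
  apply: (@le_trans _ _ (\sum_(k < (l - i).+1) c k * W)); last first.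
    by rewrite -mulr_suml ler_wpM2r.
  apply: ler_sum => k _.
  have il : (i <= l)%N by rewrite -ltnS.
  have kl : (k <= l - i)%N by rewrite -ltnS.
  have nline : on_line P (nder (q k)).
    by move=> m; have [d qd] := qline k m; exists (m%:R * d); rewrite /nder qd scalerA.
  (* Series on the line commute, so the two copies of [G] can be brought together. *)
  rewrite mulrA (on_lineC (Gline i) nline) -mulrA.
  rewrite (le_trans (term_bound _ _ _ _))// ler_wpM2l// /W ler_wpM2l//.
    by rewrite !mulr_ge0// ltW.
  apply: ler_wpM2r => //; rewrite ler_nat !ltnS.
  by rewrite -leq_subRL// leq_subr.
move: NE; rewrite opnormZ cabs_nat.
have -> : l.+1%:R * (S * (n.+1%:R * (K * al n.+1) * (l.+2%:R * (D1 + C5)))) =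
   n.+1%:R * (S * K * (D1 + C5) * (l.+1%:R * l.+2%:R) * al n.+1) by ring.
rewrite ler_pM2l// => /le_trans; apply.
rewrite ler_wpM2r ?(ltW (al0 _))//; apply: ler_pM => //.
  by rewrite /C6 -addrA lerDl addr_ge0.
by rewrite expr2 ler_wpM2r// ler_nat.
Qed.

End renewal_estimate.

(** * Elimination of the complementary block *)

Section power_estimate.
Context (R : realType) (V : completeNormedModType R[i]).
Local Notation U := (bop V).
Local Notation SS := (ser (ser U)).
Variables (al : ser R) (K : R).
Hypotheses (K1 : 1 <= K) (al0 : forall n, 0 < al n).
Hypothesis al_dbl : forall n j, (j <= n)%N -> (n <= j + j)%N -> al j <= K * al n.
Implicit Types (x y : ser U) (X Y : SS).

Let K0 : 0 < K. Proof. exact: lt_le_trans K1. Qed.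

(** One constant for both bounds makes them submultiplicative together, up to [2 * K]. *)
Definition wle x A := ale al x A /\ l1le x A.

Lemma wle_ge0 x A : wle x A -> 0 <= A.
Proof. by case=> _ /l1le_ge0. Qed.

Lemma wleW x A B : A <= B -> wle x A -> wle x B.
Proof. by move=> AB [xa xl]; split; [exact: (aleW al0) xa|exact: l1leW xl]. Qed.

Lemma wleM x y A B : wle x A -> wle y B -> wle (x * y) (2 * K * A * B).
Proof.
move=> xA yB; have A0 := wle_ge0 xA; have B0 := wle_ge0 yB.
case: xA yB => [xa xl] [ya yl]; split.
  by apply: (aleW al0) (aleM K1 al0 al_dbl xa xl ya yl); lra.
apply: l1leW (l1leM xl yl); rewrite -[leRHS]mulrA ler_peMl ?mulr_ge0//.
by move: K1; lra.
Qed.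

Lemma wleD x y A B : wle x A -> wle y B -> wle (x + y) (A + B).
Proof. by move=> [xa xl] [ya yl]; split; [exact: aleD|exact: l1leD]. Qed.

Lemma wle_sum (n : nat) (x : nat -> ser U) (A : nat -> R) :
  (forall i, (i < n)%N -> wle (x i) (A i)) ->
  wle (\sum_(i < n) x i) (\sum_(i < n) A i).
Proof.
elim: n => [|n IH] xA.
  rewrite !big_ord0; split=> m; first by rewrite mul0r opnorm0.
  by rewrite /psum big1// => i _; exact: opnorm0.
rewrite !big_ord_recr /=; apply: wleD; last exact: xA.
by apply: IH => i ni; apply: xA; rewrite ltnS ltnW.
Qed.

Lemma wle_mono0 T : exists A, wle (sermono 0 T) A.
Proof.
exists (opnorm T / al 0%N + opnorm T); have a0 := al0 0; have T0 := opnorm_ge0 T.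
split; first by apply: (aleW al0) (ale_mono0 al0 T); rewrite lerDl.
by apply: l1leW (l1le_mono 0 T); rewrite lerDr divr_ge0// ltW.
Qed.

Lemma wle1 : exists A, wle 1 A.
Proof. by rewrite -sermono1; exact: wle_mono0. Qed.

Lemma wleX x A k : wle x A -> exists B, wle (x ^+ k) B.
Proof.
move=> xA; elim: k => [|k [B IH]]; first by rewrite expr0; exact: wle1.
by exists (2 * K * A * B); rewrite exprS; exact: wleM.
Qed.

Lemma cst_mull T X l : (cst T * X) l = sermono 0 T * X l.
Proof.
rewrite serM big_ord_recl big1 ?addr0 ?subn0// => k _.
by rewrite /cst /sermono /= mul0r.
Qed.

Lemma cst_mulr T X l : (X * cst T) l = X l * sermono 0 T.
Proof.
rewrite serMr big_ord_recl big1 ?addr0 ?subn0// => k _.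
by rewrite /cst /sermono /= mulr0.
Qed.

(** The resolvent [(1 - w x)^-1], with [w] the outer variable. *)
Definition geo x : SS := fun k => x ^+ k.

Lemma geo_l x : (1 - sermono 1 x) * geo x = 1.
Proof.
apply/funext => n; rewrite mulrBl mul1r serB sermonoMl ser1E /geo.
by case: n => [|n]; rewrite /= ?expr0 ?subr0// subn1/= -exprS subrr.
Qed.

Lemma geo_r x : geo x * (1 - sermono 1 x) = 1.
Proof.
apply/funext => n; rewrite mulrBr mulr1 serB sermonoMr ser1E /geo.
by case: n => [|n]; rewrite /= ?expr0 ?subr0// subn1/= -exprSr subrr.
Qed.

Hypothesis al_sq : forall N n, (1 <= n)%N ->
  \sum_(m < N) (al m * Num.min 1 (m%:R / n%:R)) ^+ 2 <= K * al n.
Hypothesis al_dyad : forall k,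
  \sum_(i < k) Num.sqrt ((2 ^ i)%:R * al (2 ^ i)%N) <= K.

Section renewal_decomposition.
Variables (T : ser U) (P : U) (B C0 : R).
Hypotheses (PP : P * P = P) (TB : wle T B).
Hypothesis rk : forall X : U, exists c : R[i], P * X * P = c *: P.
Hypothesis Tsup : forall z l, cabs z = 1 -> opnorm (ev T z ^+ l) <= C0.
Hypothesis Dsup : forall z, cabs z = 1 -> opnorm ((1 - P) * ev T z * (1 - P)) <= 2^-1.

Local Notation Q := (1 - P).
Local Notation p := (sermono 0 P).
Local Notation q := (sermono 0 Q).
Local Notation cP := (cst P).
Local Notation cQ := (cst Q).

Let PQ : P * Q = 0. Proof. by rewrite mulrBr mulr1 PP subrr. Qed.
Let QP : Q * P = 0. Proof. by rewrite mulrBl mul1r PP subrr. Qed.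
Let QQ : Q * Q = Q. Proof. by rewrite mulrBr mulr1 QP subr0. Qed.

Let cPQ1 : cP + cQ = 1.
Proof. by rewrite /cst -!sermonoD addrC subrK !sermono1. Qed.
Let cPP : cP * cP = cP. Proof. by rewrite -cstM PP. Qed.
Let W : SS := sermono 1 T.
Let Res := geo T.
(** [E] is [(1 - cQ W)^-1] and [F] is [(1 - W cQ)^-1]: they collect the paths through the range of
    [Q]. [Qs] is the first return to the range of [P], and [Gl], [Gr] below are the two renewal
    equations for [G]. *)
Let E := geo (q * T).
Let F := geo (T * q).
Let G := cP * Res * cP.
Let Qs := cP * W * E * cP.

Let cQW : cQ * W = sermono 1 (q * T). Proof. by rewrite /cst sermonoM. Qed.
Let WcQ : W * cQ = sermono 1 (T * q). Proof. by rewrite /cst sermonoM. Qed.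

Let ResE : Res = 1 + W * Res.
Proof.
by apply/eqP; rewrite -subr_eq; apply/eqP; rewrite -{1}[Res]mul1r -mulrBl geo_l.
Qed.
Let ResE' : Res = 1 + Res * W.
Proof.
by apply/eqP; rewrite -subr_eq; apply/eqP; rewrite -{1}[Res]mulr1 -mulrBr geo_r.
Qed.
Let EE : E = 1 + cQ * W * E.
Proof.
by apply/eqP; rewrite -subr_eq cQW; apply/eqP; rewrite -{1}[E]mul1r -mulrBl geo_l.
Qed.
Let WEF : W * E = F * W.
Proof.
have : (1 - W * cQ) * W = W * (1 - cQ * W) by rewrite mulrBl mul1r mulrBr mulr1 mulrA.
move=> /(congr1 (fun X => F * X * E)); rewrite WcQ cQW.
by rewrite !mulrA geo_r mul1r -[F * W * _ * E]mulrA geo_l mulr1.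
Qed.
Let Y := cP * W * Res.
Let Z := Res * W * cP.

Let ResY : Res = E + E * Y.
Proof.
have h : (1 - cQ * W) * Res = 1 + Y.
  have h0 : W * Res = Y + cQ * W * Res.
    by rewrite /Y -[cP * W * _]mulrA -[cQ * W * _]mulrA -mulrDl cPQ1 mul1r.
  by rewrite mulrBl mul1r {1}ResE h0 addrA addrK.
have : E * ((1 - cQ * W) * Res) = E * (1 + Y) by rewrite h.
by rewrite mulrA cQW geo_r mul1r mulrDr mulr1.
Qed.

Let ResZ : Res = F + Z * F.
Proof.
have h : Res * (1 - W * cQ) = 1 + Z.
  have h0 : Res * W = Z + Res * (W * cQ) by rewrite /Z mulrA -mulrDr cPQ1 mulr1.
  by rewrite mulrBr mulr1 {1}ResE' h0 addrA addrK.
have : Res * (1 - W * cQ) * F = (1 + Z) * F by rewrite h.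
by rewrite -mulrA WcQ geo_l mulr1 mulrDl mul1r.
Qed.

Let GcY : G = cP + Y * cP.
Proof. by rewrite /G ResE mulrDr mulr1 mulrDl cPP !mulrA. Qed.

Let GcZ : G = cP + cP * Z.
Proof. by rewrite /G ResE' mulrDr mulr1 mulrDl cPP !mulrA. Qed.

Let PG : cP * G = G. Proof. by rewrite /G !mulrA cPP. Qed.
Let GP : G * cP = G. Proof. by rewrite /G -!mulrA cPP. Qed.

Let Gl : G = cP + Qs * G.
Proof.
have PY : cP * Y = Y by rewrite /Y !mulrA cPP.
have QsP : Qs * cP = Qs by rewrite /Qs -!mulrA cPP.
rewrite {1}GcY; congr (_ + _).
have YE : Y = cP * W * E + Qs * Y.
  by rewrite {1}/Y ResY mulrDr mulrA /Qs -[_ * cP * Y]mulrA PY.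
by rewrite GcY mulrDr QsP {1}YE mulrDl mulrA.
Qed.

Let Gr : G = cP + G * Qs.
Proof.
have ZP : Z * cP = Z by rewrite /Z -!mulrA cPP.
have QsE : Qs = cP * F * W * cP by rewrite /Qs -[cP * W * E]mulrA WEF mulrA.
have PQs : cP * Qs = Qs by rewrite /Qs !mulrA cPP.
rewrite {1}GcZ; congr (_ + _).
have ZE : Z = F * W * cP + Z * Qs.
  rewrite {1}/Z ResZ !mulrDl; congr (_ + _).
  by rewrite QsE !mulrA ZP.
by rewrite GcZ mulrDl PQs {1}ZE mulrDr !mulrA -QsE.
Qed.

(** Splits the paths at their first and last visit to the range of [P]; the term [E * cQ] collects
    those that never visit it. [E] and [F] have summable constants, so the growth in [l] is that of
    [G]. *)
Let ResEGF : Res = E * cQ + E * (G * F).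
Proof.
have h1 : cP * Res = G * F.
  have PZP : cP * Z * cP = cP * Z by rewrite /Z -!mulrA cPP.
  by rewrite GcZ mulrDl -mulrA -mulrDr -ResZ.
have h2 : 1 + Y = cQ + cP * Res.
  by rewrite ResE mulrDr mulr1 mulrA -/Y addrA [cQ + cP]addrC cPQ1.
by rewrite -h1 -mulrDr -h2 mulrDr mulr1 -ResY.
Qed.

Let D := q * T * q.

Let E_S k : E k.+1 = D ^+ k * (q * T).
Proof.
rewrite /E /geo; elim: k => [|k IH]; first by rewrite expr1 expr0 mul1r.
rewrite exprSr IH exprSr /D -!mulrA; congr (_ * _).
by rewrite !mulrA -[q * T * q * q]mulrA sermonoM QQ.
Qed.

Let F_S k : F k.+1 = (T * q) * D ^+ k.
Proof.
rewrite /F /geo; elim: k => [|k IH]; first by rewrite expr1 expr0 mulr1.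
rewrite exprS IH exprS /D !mulrA; congr (_ * _).
by rewrite -[T * q * q]mulrA sermonoM QQ.
Qed.

Lemma renewal_powers : exists C, forall l, wle (T ^+ l) (C * l.+2%:R ^+ 2).
Proof.
have [bq qB] := wle_mono0 Q; have [bp pB] := wle_mono0 P; have [b1 oB] := wle1.
have DB : wle D (2 * K * (2 * K * bq * B) * bq) by do 2 apply: wleM => //.
(* The rate [3 / 4] only has to lie strictly between [2^-1], the bound on the circle, and 1. *)
have [Cd Cd0 HD] : exists2 C : R, 0 <= C & forall k, l1le (D ^+ k) (C * (3 / 4) ^+ k).
  apply: (@l1_pow_decay _ _ D _ 2^-1 (3 / 4) DB.2); last by lra.
  move=> z z1; have z1' : cabs z <= 1 by rewrite z1.
  rewrite /D (evM z1' (l1leM qB.2 TB.2) qB.2) (evM z1' qB.2 TB.2) !ev_mono0.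
  exact: Dsup.
have [c [c0 [S HS] Dc1 Dca]] : exists c : nat -> R, [/\ forall k, 0 <= c k,
    exists S, forall n, \sum_(k < n) c k <= S,
    forall k, l1le (D ^+ k) (c k) & forall k, ale al (D ^+ k) (c k)].
  have k340 : (0 : R) <= 3 / 4 by [].
  have k341 : (3 / 4 : R) < 1 by lra.
  exact: (pow_weighted K1 al0 al_dbl DB.1 k340 k341 Cd0 HD).
have Dc k : wle (D ^+ k) (c k) by split.
have S0 : 0 <= S by have := HS 0; rewrite big_ord0.
have K20 : 0 <= 2 * K by rewrite mulr_ge0// ltW.
have B0 := wle_ge0 TB; have bq0 := wle_ge0 qB; have bp0 := wle_ge0 pB.
have b10 := wle_ge0 oB.
pose M := 2 * K * (2 * K * bq * B).
have M0 : 0 <= M by rewrite !mulr_ge0 ?(ltW K0).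
pose e k := if k is k'.+1 then M * c k' else b1.
have e0 k : 0 <= e k by case: k => [|k] //=; rewrite mulr_ge0.
have eS n : \sum_(k < n) e k <= b1 + M * S.
  case: n => [|n]; first by rewrite big_ord0 addr_ge0// mulr_ge0.
  by rewrite big_ord_recl /= lerD2l -mulr_sumr ler_wpM2l ?HS.
have Ee k : wle (E k) (e k).
  case: k => [|k]; first by rewrite /E /geo expr0.
  rewrite E_S; apply: wleW (wleM (Dc k) (wleM qB TB)).
  by rewrite /= /M le_eqVlt; apply/orP; left; apply/eqP; ring.
have Fe k : wle (F k) (e k).
  case: k => [|k]; first by rewrite /F /geo expr0.
  rewrite F_S; apply: wleW (wleM (wleM TB qB) (Dc k)).
  by rewrite /= /M le_eqVlt; apply/orP; left; apply/eqP; ring.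
pose M2 := 2 * K * (2 * K * (2 * K * bp * B)) * bp.
have M20 : 0 <= M2 by rewrite !mulr_ge0 ?(ltW K0).
pose f k := if k is k'.+1 then M2 * e k' else 0.
have Qsf k : wle (Qs k) (f k).
  rewrite /Qs cst_mulr -[cP * W * E]mulrA cst_mull sermonoMl.
  case: k => [|k] /=.
    rewrite mulr0 mul0r; split=> m; first by rewrite mul0r opnorm0.
    by rewrite /psum big1// => i _; exact: opnorm0.
  rewrite subn1 mulrA; apply: wleW (wleM (wleM (wleM pB TB) (Ee k)) pB).
  by rewrite /M2 le_eqVlt; apply/orP; left; apply/eqP; ring.
have f0 k : 0 <= f k by exact: wle_ge0 (Qsf k).
have fS n : \sum_(k < n) f k <= M2 * (b1 + M * S).
  case: n => [|n]; first by rewrite big_ord0 mulr_ge0// addr_ge0// mulr_ge0.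
  by rewrite big_ord_recl /= add0r -mulr_sumr ler_wpM2l ?eS.
have line X l : on_line P ((cP * X * cP) l).
  move=> n; have [d dE] := rk (X l n); exists d.
  by rewrite cst_mulr cst_mull sermonoMr sermonoMl /= !subn0.
have pT l : G l = p * T ^+ l * p by rewrite /G cst_mulr cst_mull.
have [C HC0 HC] : exists2 C : R, 0 <= C & forall l,
    ale al (G l) (C * l.+2%:R ^+ 2) /\ l1le (G l) (C * l.+2%:R).
  apply: (renewal_estimate K1 al0 al_dbl al_sq al_dyad (q := Qs) (c := f)
    (C0 := opnorm P * C0 * opnorm P) PP _ PG GP Gl Gr) => //.
  - by rewrite pT expr0 mulr1 sermonoM PP.
  - by move=> l; exact: line.
  - by move=> k; rewrite /Qs -[cP * W * E]mulrA; exact: line.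
  - by move=> k; case: (Qsf k).
  - move=> l; exists (bp * B ^+ l * bp); rewrite pT.
    by apply: l1leM pB.2; apply: l1leM pB.2 _; exact: l1leX TB.2.
  move=> l z z1; have z1' : cabs z <= 1 by rewrite z1.
  have Tl := @l1leX _ _ T B l TB.2.
  rewrite pT (evM z1' (l1leM pB.2 Tl) pB.2) (evM z1' pB.2 Tl) !ev_mono0 (evX _ z1' TB.2).
  by do 2 apply: opnorm_le_mul => //; exact: Tsup.
have Gw l : wle (G l) (C * l.+2%:R ^+ 2).
  have [ga gl] := HC l; split=> //; apply: l1leW gl.
  by rewrite ler_wpM2l// expr2 ler_peMr// ler1n.
pose S' := b1 + M * S.
have S'0 : 0 <= S' by rewrite addr_ge0// mulr_ge0.
exists (2 * K * S' * bq + 2 * K * (2 * K * (C * S') * S')).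
move=> l; have -> : T ^+ l = E l * q + \sum_(i < l.+1) E i * (G * F) (l - i)%N.
  by rewrite -cst_mulr -serM -serD -ResEGF.
rewrite mulrDl; apply: wleD.
  have l1 : 1 <= l.+2%:R ^+ 2 :> R by rewrite exprn_ege1// ler1n.
  apply: wleW (wleM (Ee l) qB).
  apply: (@le_trans _ _ (2 * K * S' * bq)); last first.
    by rewrite ler_peMr// !mulr_ge0// ltW.
  rewrite ler_wpM2r// ler_wpM2l// (le_trans _ (eS l.+1))//.
  by rewrite big_ord_recr /= lerDr; apply: sumr_ge0.
pose g := C * l.+2%:R ^+ 2; have g0 : 0 <= g by rewrite mulr_ge0// sqr_ge0.
have GF j : (j <= l)%N -> wle ((G * F) j) (2 * K * g * S').
  move=> jl; rewrite serM.
  apply: (@wleW _ (\sum_(i < j.+1) (2 * K * g * e (j - i)%N))).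
    rewrite -mulr_sumr ler_wpM2l ?mulr_ge0 ?(ltW K0)//.
    rewrite (reindex_inj rev_ord_inj) /= (le_trans _ (eS j.+1))// ler_sum// => i _.
    by rewrite subSS subKn// -ltnS.
  apply: (wle_sum (x := fun i => G i * F (j - i)%N) (A := fun i => 2 * K * g * e (j - i)%N)).
  move=> i ij; apply: wleM (Fe _); apply: wleW (Gw i); rewrite /g ler_wpM2l//.
  by apply: lerXn2r; rewrite ?nnegrE ?ler0n// ler_nat !ltnS (leq_trans _ jl).
apply: (@wleW _ (\sum_(i < l.+1) (2 * K * e i * (2 * K * g * S')))).
  rewrite -mulr_suml -mulr_sumr.
  apply: (@le_trans _ _ (2 * K * S' * (2 * K * g * S'))).
    apply: ler_wpM2r; first exact: mulr_ge0 (mulr_ge0 K20 g0) S'0.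
    by apply: ler_wpM2l => //; exact: eS.
  by rewrite /g le_eqVlt; apply/orP; left; apply/eqP; ring.
apply: (wle_sum (x := fun i => E i * (G * F) (l - i)%N)
  (A := fun i => 2 * K * e i * (2 * K * g * S'))) => i il.
by apply: wleM => //; apply: GF; exact: leq_subr.
Qed.

End renewal_decomposition.

(** The decomposition is applied to [x ^+ m]. The remainder of [l] modulo [m] adds one of finitely
    many factors, all bounded by [S]. *)
Lemma power_estimate (x : ser U) (P : U) (B C0 : R) (m : nat) : (0 < m)%N ->
  wle x B -> P * P = P -> (forall X : U, exists c : R[i], P * X * P = c *: P) ->
  (forall z l, cabs z <= 1 -> opnorm (ev x z ^+ l) <= C0) ->
  (forall z, cabs z <= 1 -> opnorm ((1 - P) * ev x z ^+ m * (1 - P)) <= 2^-1) ->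
  exists C, forall l, wle (x ^+ l) (C * l.+2%:R ^+ 2).
Proof.
move=> m0 xB PP rk xC xD; have [B' TB] := wleX m xB.
have evT z : cabs z = 1 -> ev (x ^+ m) z = ev x z ^+ m.
  by move=> z1; apply: evX xB.2; rewrite z1.
have [|z z1|C HC] := @renewal_powers (x ^+ m) P B' C0 PP TB rk.
- by move=> z l z1; rewrite evT// -exprM xC// z1.
- by rewrite evT// xD// z1.
have xk k := wleX k xB; have [F HF] := choice xk.
have F0 k : 0 <= F k by exact: wle_ge0 (HF k).
pose S := \sum_(i < m) F i; have S0 : 0 <= S by exact: sumr_ge0.
have C00 : 0 <= C.
  have := wle_ge0 (HC 0); rewrite pmulr_lge0//.
exists (2 * K * C * S) => l; rewrite (divn_eq l m) exprD mulnC exprM.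
have lm : (l %% m < m)%N by rewrite ltn_mod.
apply: wleW (wleM (HC (l %/ m)%N) (HF (l %% m)%N)).
rewrite [leRHS]mulrAC; apply: ler_pM => //.
- by rewrite mulr_ge0 ?mulr_ge0 ?sqr_ge0 ?(ltW K0).
- rewrite mulrA ler_wpM2l ?mulr_ge0 ?(ltW K0)//.
  apply: lerXn2r; rewrite ?nnegrE ?ler0n// ler_nat !ltnS.
  by rewrite mulnC -divn_eq leq_div.
by rewrite /S (bigD1 (Ordinal lm))//= lerDl; exact: sumr_ge0.
Qed.

End power_estimate.

(** * Slow variation *)

Section uniform_convergence.
Variable R : realType.
Local Notation mu := (@lebesgue_measure R).

(** The image of the measure under a translation agrees with it on half-open intervals, hence
    everywhere by uniqueness. *)
Lemma lebesgue_measure_shift (A : set R) (u : R) : measurable A ->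
  mu ((fun x => x - u) @^-1` A) = mu A.
Proof.
move=> mA; have mf : measurable_fun [set: measurableTypeR R] (fun x : measurableTypeR R => x - u : measurableTypeR R).
  exact: measurable_funB.
pose nu : {measure set (measurableTypeR R) -> \bar R} := measure_function_pushforward__canonical__measure_function_Measure mu mf.
have := @lebesgue_measure_unique R nu _ A mA; move=> ->//.
move=> X /ocitvP[->|[[a b] /= ab ->]]; first by rewrite !measure0.
rewrite /nu /= /pushforward.
have -> : (fun x : R => x - u) @^-1` `]a, b] = `](a + u), (b + u)]%classic.
  by apply/seteqP; split=> x /=; rewrite !in_itv/= ltrBrDr lerBlDr.
rewrite !lebesgue_measure_itv /= !lte_fin ab ltrD2r ab.
by rewrite -!EFinB; congr (_%:E); ring.
Qed.

(** The sets of [v] for which the bound holds from [N] on increase to [[0, 2]], so their measures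
    tend to 2 and eventually exceed [3 / 2]. *)
Lemma good_set (h : R -> R) (x : nat -> R) (e : R) : measurable_fun [set: R] h ->
  (forall u e : R, 0 < e -> exists X : R, forall t, X <= t -> `|h (t + u) - h t| <= e) ->
  (forall n, n%:R <= x n) -> 0 < e ->
  exists N, exists A : set R, [/\ measurable A, A `<=` `[0, 2]%classic, ((3 / 2)%:E < mu A)%E &
    forall v, A v -> forall m, (N <= m)%N -> `|h (x m + v) - h (x m)| <= e].
Proof.
move=> mh sv xn e0.
pose B m : set R := [set v | `|h (x m + v) - h (x m)| <= e].
pose A N : set R := `[0, 2]%classic `&` \bigcap_m (B (m + N)%N).
have mB m : measurable (B m).
  have mg : measurable_fun [set: R] (fun v => `|h (x m + v) - h (x m)|).
    apply: measurableT_comp => //; apply: measurable_funB => //.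
    by apply: measurableT_comp => //; exact: measurable_funD.
  have := measurable_fun_ler mg (measurable_cst e : measurable_fun [set: R] (fun=> e)).
  move=> /(_ measurableT [set true] I); rewrite setTI.
  by congr measurable; apply/seteqP; split.
have mA N : measurable (A N).
  by apply: measurableI => //; apply: bigcapT_measurable => m; exact: mB.
have ndA : nondecreasing_seq A.
  move=> N M NM; apply/subsetPset => v [v02 Bv]; split=> // m _.
  by have := Bv (m + (M - N))%N I; rewrite -addnA subnK.
have UA : \bigcup_N A N = `[0, 2]%classic.
  apply/seteqP; split=> [v [N _ []]//|v v02].
  have [X HX] := sv v e e0.
  exists (Num.bound `|X|) => //; split=> // m _; apply: HX.
  rewrite (le_trans (ler_norm X))// (le_trans _ (xn _))//.
  rewrite (le_trans (ltW (archi_boundP (normr_ge0 X))))// ler_nat.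
  exact: leq_addl.
have muA : mu \o A @ \oo --> 2%:E.
  have -> : 2%:E = mu (\bigcup_N A N).
    by rewrite UA lebesgue_measure_itv /= lte_fin ltr0n -EFinB subr0.
  by apply: nondecreasing_cvg_mu => //; rewrite UA.
have lt2 : ((3 / 2)%:E < (2 : R)%:E)%E by rewrite lte_fin; lra.
have [N _ HN] := muA _ (open_ereal_gt' lt2).
exists N, (A N); split=> //.
- by move=> v [].
- exact: (HN N (leqnn N)).
move=> v [_ Bv] m Nm; have := Bv (m - N)%N I.
by rewrite subnK.
Qed.

(* Karamata's uniform convergence theorem, in additive form: otherwise the bound would fail
   at x_m + u_m along a sequence, while it holds for most v both between x_m and x_m + v
   and between x_m + u_m and x_m + v. *)
Lemma uniform_convergence (h : R -> R) : measurable_fun [set: R] h ->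
  (forall u e : R, 0 < e -> exists X : R, forall t, X <= t -> `|h (t + u) - h t| <= e) ->
  forall e, 0 < e -> exists X : R, forall t u, X <= t -> 0 <= u -> u <= 1 ->
    `|h (t + u) - h t| <= e.
Proof.
move=> mh sv e e0; apply: contrapT => nX.
have bad (n : nat) : exists p : R * R, [/\ n%:R <= p.1, 0 <= p.2, p.2 <= 1 &
    e < `|h (p.1 + p.2) - h p.1|].
  apply: contrapT => np; apply: nX; exists n%:R => t u nt u0 u1.
  by rewrite leNgt; apply/negP => eh; apply: np; exists (t, u).
have [p Hp] := choice bad.
pose x n := (p n).1; pose y n := (p n).1 + (p n).2.
have xn n : n%:R <= x n by have [] := Hp n.
have yn n : n%:R <= y n by have [h1 h2 _ _] := Hp n; rewrite /y; lra.
have e2 : 0 < e / 2 by rewrite divr_gt0.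
have [N [A [mA A02 A32 HA]]] := good_set mh sv xn e2.
have [M [B [mB B02 B32 HB]]] := good_set mh sv yn e2.
pose m := maxn N M; pose u := (p m).2.
have [_ u0 u1 bad_m] := Hp m.
pose B' := (fun v : R => v - u) @^-1` B.
have mB' : measurable B'.
  have mf : measurable_fun [set: R] (fun v : R => v - u).
    exact: measurable_funB.
  by have := mf measurableT B mB; rewrite setTI.
have disj : A `&` B' = set0.
  apply/seteqP; split=> // v [Av B'v].
  have h1 := HA v Av m (leq_maxl _ _); have h2 := HB _ B'v m (leq_maxr _ _).
  have E : y m + (v - u) = x m + v by rewrite /y /x /u; ring.
  rewrite E in h2; move: bad_m; rewrite -/(x m) -/u -/(y m) ltNge => /negP; apply.
  rewrite (_ : h (x m + u) - h (x m) = (h (x m + v) - h (x m)) - (h (x m + v) - h (y m))).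
    rewrite (le_trans (ler_normB _ _))//; lra.
  by rewrite /y -/(x m) -/u; ring.
(* As [0 <= u <= 1], both sets lie in [[0, 3]], which has no room for two disjoint sets of measure
   above [3 / 2]. *)
have AB3 : A `|` B' `<=` `[0, 3]%classic.
  move=> v [/A02|/B02] /=; rewrite !in_itv /= => /andP[h1 h2]; apply/andP; split;
    move: u0 u1; rewrite -/u; lra.
have : (mu (A `|` B') <= 3%:E)%E.
  have -> : 3%:E = mu `[0, 3]%classic.
    by rewrite lebesgue_measure_itv /= lte_fin ltr0n -EFinB subr0.
  by apply: le_measure => //; rewrite inE //; exact: measurableU.
have muB' : mu B' = mu B by exact: lebesgue_measure_shift.
rewrite measureU// [X in (_ + X <= _)%E]muB' leNgt => /negP; apply.
by rewrite (_ : 3%:E = ((3 / 2)%:E + (3 / 2)%:E)%E) ?lteD// -EFinD; congr (_%:E); field.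
Qed.

End uniform_convergence.

Section regular_variation.
Variables (R : realType) (h : R -> R).
Hypothesis mh : measurable_fun [set: R] h.
Hypothesis shift : forall u e : R, 0 < e ->
  exists X : R, forall t, X <= t -> `|h (t + u) - h t| <= e.

(** The way from [t] to [t + u] is covered by at most [u + 1] steps of length at most 1, each
    costing [e]. This is Potter's bound in logarithmic form. *)
Lemma increment_bound (e : R) : 0 < e -> exists X : R, forall t u,
  X <= t -> 0 <= u -> `|h (t + u) - h t| <= e * (u + 1).
Proof.
move=> e0; have [X HX] := uniform_convergence mh shift e0; exists X.
suff H n : forall t u, X <= t -> 0 <= u -> u <= n%:R -> `|h (t + u) - h t| <= e * n%:R.
  move=> t u Xt u0; have un := archi_boundP u0.
  have [n /andP[n1 n2]] : exists n : nat, (u <= n%:R) && (n%:R <= u + 1).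
    exists (Num.truncn u).+1; have /andP[a b] := truncn_itv u0.
    by rewrite (ltW b) -natr1 lerD2r.
  by rewrite (le_trans (H n t u Xt u0 n1))// ler_pM2l.
elim: n => [|n IH] t u Xt u0 un.
  by have -> : u = 0 by [apply/le_anti/andP]; rewrite addr0 subrr normr0 mulr0.
have [u1|u1] := leP u 1.
  by rewrite (le_trans (HX _ _ Xt u0 u1))// ler_pMr// ler1n.
have E : h (t + u) - h t = (h ((t + 1) + (u - 1)) - h (t + 1)) + (h (t + 1) - h t).
  by rewrite (_ : t + 1 + (u - 1) = t + u) ?addrA ?subrK//; ring.
rewrite E (le_trans (ler_normD _ _))// -natr1 mulrDr mulr1 lerD ?HX//.
by apply: IH; rewrite -?natr1 in un *; lra.
Qed.

End regular_variation.

Section log_increments.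
Variable R : realType.

Lemma ln_natS_ge (n : nat) : (0 < n)%N -> n.+1%:R^-1 <= ln (n.+1%:R : R) - ln n%:R.
Proof.
move=> n0; have N0 : (0 : R) < n%:R by rewrite ltr0n.
have S0 : (0 : R) < n.+1%:R by rewrite ltr0n.
have H : n%:R / n.+1%:R <= expR (- (n.+1%:R^-1)) :> R.
  have -> : n%:R / n.+1%:R = 1 - n.+1%:R^-1 :> R.
    by apply: (mulIf (lt0r_neq0 S0)); rewrite mulrBl divfK ?mulVf ?gt_eqF// mul1r -natr1 addrK.
  exact: expR_ge1Dx.
by have := H; rewrite -ler_ln ?posrE ?expR_gt0 ?divr_gt0// expRK ln_div ?posrE// lerNr opprB.
Qed.

Lemma ln_natS_le (n : nat) : (0 < n)%N -> ln (n.+1%:R : R) - ln n%:R <= n%:R^-1.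
Proof.
move=> n0; have N0 : (0 : R) < n%:R by rewrite ltr0n.
have H : n.+1%:R / n%:R <= expR (n%:R^-1) :> R.
  by rewrite -natr1 mulrDl divff ?gt_eqF// mul1r expR_ge1Dx.
by have := H; rewrite -ler_ln ?posrE ?expR_gt0 ?divr_gt0 ?ltr0n// expRK ln_div ?posrE ?ltr0n.
Qed.

(** The summand is [n^-(1 + r)], at most [r^-1] times the decrement of [n^-r], and these decrements
    telescope. *)
Lemma sum_decay (r : R) : 0 < r ->
  exists S, forall N, \sum_(1 <= n < N) expR (- (1 + r) * ln n%:R) <= S.
Proof.
move=> r0; exists (1 + r^-1).
have step n : (0 < n)%N -> expR (- (1 + r) * ln n.+1%:R) <=
    r^-1 * (expR (- r * ln n%:R) - expR (- r * ln n.+1%:R)).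
  move=> n0; have N0 : (0 : R) < n.+1%:R by rewrite ltr0n.
  have -> : - r * ln n%:R = - r * ln n.+1%:R + r * (ln (n.+1%:R : R) - ln n%:R) by ring.
  have -> : - (1 + r) * ln n.+1%:R = - r * ln n.+1%:R + - ln (n.+1%:R : R) by ring.
  rewrite !expRD expRN lnK ?posrE// -{3}[expR (- r * _)]mulr1 -mulrBr mulrCA.
  rewrite ler_pM2l ?expR_gt0// mulrC ler_pdivlMr// mulrC lerBrDl.
  by rewrite (le_trans _ (expR_ge1Dx _))// lerD2l ler_pM2l// ln_natS_ge.
case=> [|N]; first by rewrite big_geq// addr_ge0// invr_ge0 ltW.
case: N => [|N]; first by rewrite big_geq// addr_ge0// invr_ge0 ltW.
suff H : \sum_(1 <= n < N.+2) expR (- (1 + r) * ln n%:R) <=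
    1 + r^-1 * (1 - expR (- r * ln N.+1%:R)).
  rewrite (le_trans H)// lerD2l -[leRHS]mulr1 ler_wpM2l ?invr_ge0 ?(ltW r0)//.
elim: N => [|N IH].
  by rewrite big_nat1 ln1 !mulr0 expR0 subrr mulr0 addr0.
rewrite big_nat_recr//= (le_trans (lerD IH (step N.+1 isT)))//.
by rewrite le_eqVlt; apply/orP; left; apply/eqP; ring.
Qed.

End log_increments.

Section slow_variation.
Variables (R : realType) (L : R -> R).
Hypothesis hL : slowly_varying L.

Let h t := ln (L (expR t)).

Lemma measurable_log : measurable_fun [set: R] h.
Proof.
have [mL _ _] := hL.
apply: (measurableT_comp (@measurable_ln R)).
apply: (measurable_comp _ _ mL (@measurable_expR R)) => //.
by move=> _ [t _ <-] /=; rewrite in_itv/= andbT expR_gt0.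
Qed.

Lemma log_shift (u e : R) : 0 < e ->
  exists X : R, forall t, X <= t -> `|h (t + u) - h t| <= e.
Proof.
have [_ L0 cL] := hL; move=> e0.
have c1 : ln (L (expR u * x) / L x) @[x --> +oo] --> (0 : R).
  rewrite -(@ln1 R); apply: (continuous_cvg _ _ (cL _ (expR_gt0 u))).
  exact: continuous_ln.
have /cvgrPdist_le/(_ _ e0) [X [_ HX]] := c1.
exists X => t Xt; have := HX (expR t).
rewrite /= sub0r normrN -expRD [u + t]addrC ln_div ?posrE ?L0 ?expR_gt0//; apply.
by rewrite (le_lt_trans Xt)// (lt_le_trans _ (expR_ge1Dx t))// ltrDr.
Qed.

End slow_variation.

(** * The weights L(n) / n^(1 + beta) *)

Section weights.
Variables (R : realType) (L : R -> R) (beta : R).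
Hypotheses (hL : slowly_varying L) (hbeta : 0 < beta < 1).

(** The value 1 at index 0 keeps the weight positive, so that bounds by it can also cover series
    with a constant term. *)
Definition weight (n : nat) : R :=
  if n is 0%N then 1 else L n%:R / n%:R `^ (1 + beta).

Let g t := ln (L (expR t)) - (1 + beta) * t.

Lemma weight_gt0 n : 0 < weight n.
Proof.
case: n => [|n]; first exact: ltr01.
have [_ L0 _] := hL; by rewrite /= divr_gt0// ?L0 ?powR_gt0.
Qed.

Lemma weightE n : (0 < n)%N -> weight n = expR (g (ln n%:R)).
Proof.
case: n => // n _; have [_ L0 _] := hL; have N0 : (0 : R) < n.+1%:R by rewrite ltr0n.
by rewrite /g expRB !lnK ?posrE ?L0//= /powR gt_eqF.
Qed.

Let h t := ln (L (expR t)).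

(** The shift [ln n.+1 - ln n] varies with [n], so the uniform convergence theorem is called for,
    not just the limit at one fixed ratio. *)
Lemma weight_ratioS : weight n / weight n.+1 @[n --> \oo] --> (1 : R).
Proof.
have g0 : g (ln n%:R) - g (ln n.+1%:R) @[n --> \oo] --> (0 : R).
  apply/cvgrPdist_le => e e0; have e2 : 0 < e / 2 by rewrite divr_gt0.
  have [X HX] := uniform_convergence (measurable_log hL) (log_shift hL) e2.
  near=> n; have n0 : (0 < n)%N by near: n; exists 1%N.
  have Xn : X <= ln n%:R.
    rewrite -[X]expRK ler_ln ?posrE ?expR_gt0 ?ltr0n//; near: n.
    exact: nbhs_infty_ger.
  have ne : (1 + beta) * n%:R^-1 <= e / 2.
    rewrite ler_pdivrMr ?ltr0n// mulrC -ler_pdivrMr//; near: n.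
    exact: nbhs_infty_ger.
  have n1 : n%:R^-1 <= 1 :> R by rewrite invf_le1 ?ltr0n// ler1n.
  have d1 := ln_natS_le R n0.
  have d0 : 0 <= ln n.+1%:R - ln n%:R :> R by rewrite (le_trans _ (ln_natS_ge R n0)).
  have := HX _ _ Xn d0 (le_trans d1 n1); rewrite [ln n%:R + _]addrC subrK sub0r normrN /g /=.
  move: ne d0 d1; have [b0 _] := andP hbeta.
  move: (ln (L (expR (ln n%:R)))) (ln (L (expR (ln n.+1%:R)))) (ln n%:R) (ln n.+1%:R) (n%:R^-1) => a b c d i h1 h2 h3.
  by rewrite !ler_norml => /andP[h4 h5]; apply/andP; split; nra.
have e1 : expR (g (ln n%:R) - g (ln n.+1%:R)) @[n --> \oo] --> (1 : R).
  by rewrite -[X in _ --> X](@expR0 R); apply: (continuous_cvg _ _ g0); exact: continuous_expR.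
apply: cvg_trans e1; apply: near_eq_cvg; near=> n.
have n0 : (0 < n)%N by near: n; exists 1%N.
by rewrite expRB -!weightE.
Unshelve. all: by end_near. Qed.

Lemma weight_ratio (j : nat) : weight (n - j)%N / weight n @[n --> \oo] --> (1 : R).
Proof.
suff H : weight n / weight (n + j)%N @[n --> \oo] --> (1 : R).
  rewrite -(cvg_shiftn j) (_ : [sequence _]_n = fun n => weight n / weight (n + j)%N)//.
  by apply/funext => n; rewrite /= addnK.
elim: j => [|j IH].
  rewrite (_ : (fun n => weight n / weight (n + 0)%N) = fun=> 1); first exact: cvg_cst.
  by apply/funext => n; rewrite addn0 divff// gt_eqF// weight_gt0.
have := weight_ratioS; rewrite -(cvg_shiftn j) => /(cvgM IH); rewrite mul1r => c1.
apply: cvg_trans c1; apply: near_eq_cvg; near=> n.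
by rewrite /= addnS mulrA divfK// gt_eqF// weight_gt0.
Unshelve. all: by end_near. Qed.

Lemma weight_increment (e : R) : 0 < e -> exists2 N : nat, (0 < N)%N &
  forall m n, (N <= m)%N -> (m <= n)%N ->
  weight m <= expR e * expR ((1 + beta + e) * (ln n%:R - ln m%:R)) * weight n /\
  weight n <= expR e * expR (- (1 + beta - e) * (ln n%:R - ln m%:R)) * weight m.
Proof.
move=> e0; have [X HX] := increment_bound (measurable_log hL) (log_shift hL) e0.
exists (Num.bound (expR X)).+1 => // m n Nm mn.
have m0 : (0 < m)%N by exact: leq_trans Nm.
have n0 : (0 < n)%N by exact: leq_trans mn.
have Xm : X <= ln m%:R.
  rewrite -[X]expRK ler_ln ?posrE ?expR_gt0 ?ltr0n//.
  rewrite (le_trans (ltW (archi_boundP (expR_ge0 X))))// ler_nat.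
  exact: leq_trans Nm.
have u0 : 0 <= ln n%:R - ln m%:R :> R.
  by rewrite subr_ge0 ler_ln ?posrE ?ltr0n// ler_nat.
have := HX _ _ Xm u0; rewrite [ln m%:R + _]addrC subrK !weightE// -!expRD !ler_expR /g /=.
move: (ln (L (expR (ln n%:R)))) (ln (L (expR (ln m%:R)))) (ln n%:R) (ln m%:R) => a b c d.
rewrite ler_norml => /andP[h1 h2]; split; nra.
Qed.

(** Extends [weight_increment] to all positive indices: each is replaced by its maximum with [N], at
    the price of a constant [C] dominating the ratios of weights up to [N] and of [ln N] in the
    exponent. *)
Lemma weight_potter : exists p s K, [/\ 1 < s, p < 2, 1 <= K & forall m n, (0 < m <= n)%N ->
   weight m <= K * expR (p * (ln n%:R - ln m%:R)) * weight n /\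
   weight n <= K * expR (- s * (ln n%:R - ln m%:R)) * weight m].
Proof.
have [b0 b1] := andP hbeta.
(* [e < beta] puts the decay exponent above 1, for summability; [e < 1 - beta] puts the growth
   exponent below 2, for [weight_square]. *)
have [e [e0 eb e1]] : exists e, [/\ 0 < e, e < beta & e < 1 - beta].
  by have [b2|b2] := leP beta 2^-1; [exists (beta / 2)|exists ((1 - beta) / 2)]; split; lra.
have [N N0 HN] := weight_increment e0.
pose C := \sum_(a < N.+1) \sum_(b < N.+1) weight a / weight b.
have HC a b : (a <= N)%N -> (b <= N)%N -> weight a <= C * weight b.
  move=> aN bN; rewrite -ler_pdivrMr ?weight_gt0// /C.
  rewrite (bigD1 (Ordinal (aN : (a < N.+1)%N)))//= (bigD1 (Ordinal (bN : (b < N.+1)%N)))//=.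
  rewrite -addrA lerDl addr_ge0// ?sumr_ge0// => i _; rewrite ?sumr_ge0// => *;
    by rewrite divr_ge0 ?(ltW (weight_gt0 _)).
have C1 : 1 <= C.
  by have := HC 0%N 0%N isT isT; rewrite mulr1.
have C0 : 0 < C by exact: lt_le_trans C1.
have Hmax a : weight a <= C * weight (maxn a N) /\ weight (maxn a N) <= C * weight a.
  have [aN|Na] := leqP a N; first by split; apply: HC.
  by split; rewrite ler_peMl// (ltW (weight_gt0 _)).
have lnmax a : (0 < a)%N -> ln a%:R <= ln (maxn a N)%:R :> R /\
    ln (maxn a N)%:R <= ln a%:R + ln N%:R :> R.
  move=> a0; have m0 : (0 < maxn a N)%N by rewrite leq_max a0.
  rewrite -lnM ?posrE ?ltr0n// -natrM !ler_ln ?posrE ?ltr0n ?muln_gt0 ?a0// !ler_nat.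
  by rewrite leq_maxl geq_max leq_pmulr// leq_pmull.
have lnN : 0 <= ln (N%:R : R) by rewrite ln_ge0// ler1n.
exists (1 + beta + e), (1 + beta - e), (C * C * expR e * expR (2 * ln N%:R)).
split; [lra|lra| |].
  have l2 : 0 <= 2 * ln (N%:R : R) by rewrite mulr_ge0.
  have ge1 x : 0 <= x -> 1 <= expR x :> R by move=> x0; rewrite -[leLHS]expR0 ler_expR.
  by do !apply: mulr_ege1 => //; apply: ge1 => //; exact: ltW.
move=> m n /andP[m0 mn]; have n0 : (0 < n)%N by exact: leq_trans mn.
have [m1 m2] := Hmax m; have [n1 n2] := Hmax n.
have [lm1 lm2] := lnmax _ m0; have [ln1 ln2] := lnmax _ n0.
have le_max : (maxn m N <= maxn n N)%N.
  by rewrite geq_max leq_maxr (leq_trans mn)// leq_maxl.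
have [H1 H2] := HN _ _ (leq_maxr m N) le_max.
have chain (u v u' v' E1 E2 : R) : u <= C * u' -> v' <= C * v -> 0 < v ->
    u' <= expR e * expR E1 * v' -> E1 <= 2 * ln N%:R + E2 ->
    u <= C * C * expR e * expR (2 * ln N%:R) * expR E2 * v.
  move=> uu' v'v v0 u'v' E12; rewrite (le_trans uu')//.
  have -> : C * C * expR e * expR (2 * ln N%:R) * expR E2 * v =
      C * (expR e * expR (2 * ln N%:R + E2) * (C * v)) by rewrite expRD; ring.
    rewrite ler_pM2l// (le_trans u'v')//.
  rewrite (@le_trans _ _ (expR e * expR E1 * (C * v)))//.
    by rewrite ler_wpM2l// mulr_ge0 ?expR_ge0.
  by rewrite ler_pM2r ?mulr_gt0// ler_pM2l ?expR_gt0// ler_expR.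
split.
  apply: (chain _ _ _ _ _ _ m1 n2 (weight_gt0 n) H1).
  nra.
apply: (chain _ _ _ _ _ _ n1 m2 (weight_gt0 m) H2).
nra.
Qed.

End weights.

Section weight_properties.
Variables (R : realType) (L : R -> R) (beta : R).
Hypotheses (hL : slowly_varying L) (hbeta : 0 < beta < 1).
Local Notation w := (weight L beta).

Lemma weight_decay : exists s K, [/\ 1 < s, 0 < K &
  forall n, (0 < n)%N -> w n <= K * expR (- s * ln n%:R)].
Proof.
have [p [s [K [s1 _ K1 H]]]] := weight_potter hL hbeta.
exists s, (K * w 1%N); split=> // [|n n0].
  by rewrite mulr_gt0 ?(weight_gt0 beta hL) ?(lt_le_trans ltr01).
by have [_] := H 1%N n n0; rewrite ln1 subr0 mulrAC.
Qed.

Lemma weight_sum : exists K, forall N, \sum_(n < N) w n <= K.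
Proof.
have [s [K [s1 K0 H]]] := weight_decay.
have r0 : 0 < s - 1 by rewrite subr_gt0.
have [S HS] := sum_decay r0.
have S0 : 0 <= S by have := HS 0%N; rewrite big_geq.
exists (1 + K * S) => -[|N]; first by rewrite big_ord0 addr_ge0// mulr_ge0// ltW.
rewrite -(big_mkord xpredT w) big_ltn// lerD2l (le_trans _ (ler_wpM2l (ltW K0) (HS N.+1)))//.
rewrite mulr_sumr !big_nat; apply: ler_sum => n /andP[n0 _].
by rewrite (le_trans (H n n0))// addrCA subrr addr0.
Qed.

(** The decay exponent [s > 1] makes the terms [O(2^(-(s - 1) i / 2))], a geometric series of ratio
    [q]. *)
Lemma weight_dyadic : exists K, forall k, \sum_(i < k) Num.sqrt ((2 ^ i)%:R * w (2 ^ i)%N) <= K.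
Proof.
have [s [K [s1 K0 H]]] := weight_decay.
have l2 : 0 < ln (2 : R) by rewrite ln_gt0// ltr1n.
pose q := expR (- ((s - 1) * ln 2 / 2) : R).
have q0 : 0 < q by exact: expR_gt0.
have q1 : q < 1 by rewrite -[ltRHS]expR0 ltr_expR oppr_lt0 !mulr_gt0 ?subr_gt0 ?invr_gt0.
have term i : Num.sqrt ((2 ^ i)%:R * w (2 ^ i)%N) <= Num.sqrt K * q ^+ i.
  have qi : 0 <= q ^+ i by rewrite exprn_ge0// ltW.
  have -> : Num.sqrt K * q ^+ i = Num.sqrt (K * (q ^+ i) ^+ 2).
    by rewrite sqrtrM ?(ltW K0)// sqrtr_sqr ger0_norm.
  have N0 : (0 : R) < (2 ^ i)%:R by rewrite ltr0n expn_gt0.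
  have H2 := H (2 ^ i)%N; rewrite expn_gt0 in H2.
  apply: ler_wsqrtr; rewrite (le_trans (ler_wpM2l (ltW N0) (H2 isT)))//.
  rewrite mulrCA ler_pM2l// -[X in X * _]lnK ?posrE// -expRD natrX lnXn//.
  by rewrite /q -!expRM_natl ler_expR mulr_natl; lra.
exists (Num.sqrt K * (1 - q)^-1) => k.
apply: (@le_trans _ _ (\sum_(i < k) Num.sqrt K * q ^+ i)).
  by apply: ler_sum => i _; exact: term.
rewrite -mulr_sumr ler_wpM2l ?sqrtr_ge0// -[leRHS]mul1r ler_pdivlMr ?subr_gt0//.
rewrite mulrC -opprB mulNr -subrX1 opprB gerBl exprn_ge0// ltW//.
Qed.

Lemma weight_doubling : exists K, forall n j, (j <= n)%N -> (n <= j + j)%N -> w j <= K * w n.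
Proof.
have [p [s [K [_ p2 K1 H]]]] := weight_potter hL hbeta.
exists (K * expR (2 * ln 2)) => n [|j] jn nj.
  have -> : n = 0%N by lia.
  rewrite ler_peMl ?ler01// mulr_ege1// -[leLHS]expR0 ler_expR mulr_ge0// ln_ge0 ?ler1n//.
have n0 : (0 < n)%N by exact: leq_trans jn.
have [h1 _] := H j.+1 n jn; rewrite (le_trans h1)//.
rewrite ler_pM2r ?(weight_gt0 beta hL)// ler_pM2l ?(lt_le_trans ltr01)// ler_expR.
have d2 : ln n%:R - ln j.+1%:R <= ln 2 :> R.
  rewrite lerBlDr -lnM ?posrE// ?ltr0n// ler_ln ?posrE ?mulr_gt0 ?ltr0n//.
  by rewrite -natrM ler_nat; lia.
have d0 : 0 <= ln n%:R - ln j.+1%:R :> R.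
  by rewrite subr_ge0 ler_ln ?posrE ?ltr0n// ler_nat.
by move: d2 d0; move: (ln 2) (ln n%:R - _) => a b; nra.
Qed.

(** One factor [w m] is kept for summability. The other, times the squared minimum, is at most
    [K * w n]: for [m <= n] because [(m / n)^2] outweighs [(n / m)^p] with [p < 2], for [m > n]
    because the weights decrease up to a constant. *)
Lemma weight_square : exists K, forall N n, (1 <= n)%N ->
  \sum_(m < N) (w m * Num.min 1 (m%:R / n%:R)) ^+ 2 <= K * w n.
Proof.
have [p [s [K [s1 p2 K1 H]]]] := weight_potter hL hbeta.
have [S HS] := weight_sum.
exists (K * S) => N n n0.
have wn0 : 0 < w n by exact: weight_gt0.
have n0' : 0 < n%:R :> R by rewrite ltr0n.
rewrite -mulrA (mulrC S) mulrA.
rewrite (@le_trans _ _ (K * w n * \sum_(m < N) w m))//; last first.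
  by rewrite ler_pM2l// mulr_gt0// (lt_le_trans ltr01).
rewrite mulr_sumr; apply: ler_sum => m _; have wm0 : 0 < w m by exact: weight_gt0.
have [->|m0] := posnP m.
  rewrite mul0r min_r// mulr0 expr0n/= mulr_ge0 ?(ltW wm0)// mulr_ge0 ?(ltW wn0)//.
  exact: le_trans K1.
have m0' : 0 < m%:R :> R by rewrite ltr0n.
rewrite exprMn [in leLHS]expr2 -mulrA [leLHS]mulrC ler_pM2r//.
have [mn|nm] := leqP m n.
  have [|h1 _] := H m n; first by rewrite m0.
  rewrite min_r; last by rewrite ler_pdivrMr// mul1r ler_nat.
  rewrite -[m%:R / n%:R]lnK ?posrE ?divr_gt0// ln_div ?posrE//.
  set u := ln m%:R - ln n%:R.
  rewrite (le_trans (ler_wpM2r _ h1)) ?exprn_ge0 ?expR_ge0//.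
  rewrite mulrAC ler_pM2r// -mulrA ler_piMr ?(le_trans ler01)//.
  rewrite -expRM_natl -expRD -[leRHS]expR0 ler_expR -opprB -/u.
  have u0 : u <= 0 by rewrite subr_le0 ler_ln ?posrE// ler_nat.
  by move: u u0 => u u0; nra.
have [|_ h2] := H n m; first by rewrite n0 ltnW.
rewrite min_l; last by rewrite ler_pdivlMr// mul1r ler_nat ltnW.
rewrite expr1n mulr1 (le_trans h2)// ler_pM2r// ler_piMr ?(le_trans ler01)//.
rewrite -[leRHS]expR0 ler_expR.
have : 0 <= ln m%:R - ln n%:R :> R by rewrite subr_ge0 ler_ln ?posrE// ler_nat ltnW.
by move: (_ - _) => u u0; nra.
Qed.

End weight_properties.

(** * Asymptotics of convolution powers *)

Section asymptotics.
Context (R : realType) (V : completeNormedModType R[i]).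
Local Notation U := (bop V).
Variables (al : ser R) (K : R).
Hypotheses (K1 : 1 <= K) (al0 : forall n, 0 < al n).
Hypothesis al_dbl : forall n j, (j <= n)%N -> (n <= j + j)%N -> al j <= K * al n.
Hypothesis al_ratio : forall j, al (n - j)%N / al n @[n --> \oo] --> (1 : R).
Implicit Types (x y : ser U) (T X Y : U).

Definition asym x X := (fun n => ((al n)^-1)%:C *: x n) @ \oo --> X.

Lemma asymD x y X Y : asym x X -> asym y Y -> asym (x + y) (X + Y).
Proof.
move=> /bop_cvgP xX /bop_cvgP yY; apply/bop_cvgP => e e0.
have e2 : 0 < e / 2 by rewrite divr_gt0.
have [M HM] := xX _ e2; have [N HN] := yY _ e2.
exists (maxn M N) => n; rewrite geq_max => /andP[/HM h1 /HN h2].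
by rewrite serD scalerDr opprD addrACA (le_trans (opnormD _ _))// (splitr e) lerD.
Qed.

Lemma asymN x X : asym x X -> asym (- x) (- X).
Proof.
move=> /bop_cvgP xX; apply/bop_cvgP => e /xX[N HN]; exists N => n /HN.
by rewrite serN scalerN -opprD opnormN.
Qed.

Lemma asym_delay x X i : asym x X ->
  (fun n => ((al n)^-1)%:C *: x (n - i)%N) @ \oo --> X.
Proof.
move=> xX; have ratio : (fun n => (al (n - i)%N / al n)%:C *: (1 : U)) @ \oo --> (1 : U).
  apply/bop_cvgP => e e0; have /cvgrPdist_le/(_ _ e0)[N _ HN] := al_ratio i.
  exists N => n Nn; rewrite -[X in _ - X]scale1r -scalerBl opnormZ.
  rewrite -(rmorph1 (@real_complex R)) -rmorphB cabs_real distrC.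
  by rewrite (le_trans (ler_wpM2l _ (opnorm1_le _)))// mulr1; exact: HN.
have xi : (fun n => ((al (n - i)%N)^-1)%:C *: x (n - i)%N) @ \oo --> X.
  apply/bop_cvgP => e e0; move/bop_cvgP : xX => /(_ _ e0)[N HN].
  by exists (N + i)%N => n Nn; apply: HN; lia.
have := bop_cvgM ratio xi; rewrite mul1r.
under eq_fun do rewrite -bop_scalerAl mul1r scalerA -rmorphM mulrAC divff ?gt_eqF// mul1r.
exact.
Qed.

Lemma asym_eventually x y X N : (forall n, (N <= n)%N -> x n = y n) -> asym x X -> asym y X.
Proof.
move=> xy /bop_cvgP xX; apply/bop_cvgP => e /xX[M HM].
by exists (maxn N M) => n; rewrite geq_max => /andP[Nn /HM]; rewrite xy.
Qed.

Lemma bop_cvg_cst T : (fun _ : nat => T) @ \oo --> T.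
Proof. by apply/bop_cvgP => e e0; exists 0%N => n _; rewrite subrr opnorm0 ltW. Qed.

Lemma asym_shiftl x X i c : asym x X -> asym (sermono i c * x) (c * X).
Proof.
move=> xX; apply: (@asym_eventually (fun n => c * x (n - i)%N) _ _ i).
  by move=> n; rewrite sermonoMl => ->.
have := bop_cvgM (@bop_cvg_cst c) (asym_delay i xX).
by under eq_fun do rewrite -bop_scalerAr.
Qed.

Lemma asym_shiftr x X i c : asym x X -> asym (x * sermono i c) (X * c).
Proof.
move=> xX; apply: (@asym_eventually (fun n => x (n - i)%N * c) _ _ i).
  by move=> n; rewrite sermonoMr => ->.
have := bop_cvgM (asym_delay i xX) (@bop_cvg_cst c).
by under eq_fun do rewrite -bop_scalerAl.
Qed.

Lemma truncS N x : trunc N.+1 x = trunc N x + sermono N (x N).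
Proof.
apply/funext => n; rewrite serD /trunc /sermono ltnS leq_eqVlt.
by case: (eqVneq n N) => [->|_] /=; rewrite ?ltnn ?add0r ?addr0.
Qed.

Lemma trunc0 x : trunc 0%N x = 0.
Proof. exact/funext. Qed.

Lemma asym0 : asym 0 0.
Proof. by rewrite /asym; under eq_fun do rewrite scaler0; exact: bop_cvg_cst. Qed.

Lemma asym_truncl N x y Y : asym y Y -> asym (trunc N x * y) (osum x N * Y).
Proof.
move=> yY; elim: N => [|N IH]; first by rewrite trunc0 /osum big_ord0 !mul0r; exact: asym0.
by rewrite truncS mulrDl /osum big_ord_recr mulrDl; apply: asymD; [|exact: asym_shiftl].
Qed.

Lemma asym_truncr N x y X : asym x X -> asym (x * trunc N y) (X * osum y N).
Proof.
move=> xX; elim: N => [|N IH]; first by rewrite trunc0 /osum big_ord0 !mulr0; exact: asym0.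
by rewrite truncS mulrDr /osum big_ord_recr mulrDr; apply: asymD; [|exact: asym_shiftr].
Qed.

Lemma asym_trunc N x : asym (trunc N x) 0.
Proof.
apply: (@asym_eventually 0 _ _ N) asym0 => n Nn; exact/esym/(trunc_ge _ Nn).
Qed.

Lemma l1le_tail x B e : l1le x B -> 0 < e ->
  exists N0, forall N, (N0 <= N)%N -> l1le (x - trunc N x) e.
Proof.
move=> xB e0; have [N0 HN0] := psum_tail (nser_ge0 x) xB e0; exists N0 => N NN n.
apply: (@le_trans _ _ (psum (nser (x - trunc N x)) (N + n)%N)).
  by apply: psum_mono; [exact: nser_ge0|exact: leq_addl].
apply: le_trans (HN0 N (N + n)%N NN (leq_addr _ _)).
elim: n => [|n IH]; last first.
  rewrite addnS !psumS [leRHS]addrAC lerD// /nser serB trunc_ge ?leq_addr// subr0//.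
rewrite addn0 subrr /psum big1// => i _.
by rewrite /nser serB /trunc ltn_ord subrr opnorm0.
Qed.

Lemma asymM x y A B X Y : wle al x A -> wle al y B -> asym x X -> asym y Y ->
  asym (x * y) (X * tsum y + tsum x * Y).
Proof.
move=> [xA xA1] [yB yB1] xX yY; apply/bop_cvgP => e e0.
have A0 := l1le_ge0 xA1; have B0 := l1le_ge0 yB1.
(* The errors [d], [d * |Y|], [d * |X|] and [d * K * (A + B)] then add up to [e]. *)
pose c := 1 + opnorm X + opnorm Y + K * (A + B).
have c0 : 0 < c.
  rewrite /c -!addrA ltr_wpDr// !addr_ge0 ?opnorm_ge0// mulr_ge0 ?addr_ge0//.
  exact: le_trans K1.
pose d := e / c; have d0 : 0 < d by rewrite divr_gt0.
have [N1 H1] := l1le_tail xA1 d0; have [N2 H2] := l1le_tail yB1 d0.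
have /bop_cvgP/(_ _ d0)[N3 H3] := tsum_cvg xA1.
have /bop_cvgP/(_ _ d0)[N4 H4] := tsum_cvg yB1.
pose J := (N1 + N2 + N3 + N4)%N.
pose x' := trunc J x; pose y' := trunc J y.
(* The bracket collects the terms with an index below [J]: a finite combination of shifts of [x] and
   [y], with explicit limit. In the product of the tails the l^1 norms are at most [d], so [aleM]
   makes it small relative to [al]. *)
have E : x * y = (x' * y + x * y' - x' * y') + (x - x') * (y - y').
  by rewrite mulrBl !mulrBr [x' * y + _ - _]addrAC [RHS]addrC addrA !subrK.
have main : asym (x' * y + x * y' - x' * y') (osum x J * Y + X * osum y J - osum x J * 0).
  apply: asymD; first by apply: asymD; [exact: asym_truncl|exact: asym_truncr].
  by apply: asymN; apply: asym_truncl; exact: asym_trunc.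
have x''A : ale al (x - x') A.
  move=> n; rewrite serB /x' /trunc; case: ifP => _; last by rewrite subr0.
  by rewrite subrr opnorm0 mulr_ge0// ltW.
have y''B : ale al (y - y') B.
  move=> n; rewrite serB /y' /trunc; case: ifP => _; last by rewrite subr0.
  by rewrite subrr opnorm0 mulr_ge0// ltW.
have J1 : (N1 <= J)%N by rewrite /J; lia.
have J2 : (N2 <= J)%N by rewrite /J; lia.
have J3 : (N3 <= J)%N by rewrite /J; lia.
have J4 : (N4 <= J)%N by rewrite /J; lia.
have small := aleM K1 al0 al_dbl x''A (H1 J J1) y''B (H2 J J2).
move/bop_cvgP : main => /(_ _ d0)[M HM].
exists M => n /HM {}HM; rewrite E serD scalerDr.
move: HM; rewrite mulr0 subr0; move: (_ *: _ n) => main HM.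
have s1 : opnorm (((al n)^-1)%:C *: ((x - x') * (y - y')) n) <= d * (K * (A + B)).
  rewrite opnormZ cabs_real ger0_norm ?invr_ge0 ?(ltW (al0 n))// mulrC ler_pdivrMr//.
  by rewrite (le_trans (small n))// le_eqVlt; apply/orP; left; apply/eqP; ring.
rewrite addrAC (le_trans (opnormD _ _))//.
rewrite (_ : e = d * (1 + opnorm X + opnorm Y) + d * (K * (A + B))); last first.
  by rewrite -mulrDr -/c /d divfK ?gt_eqF.
rewrite lerD//.
rewrite (le_trans (opnorm_dist _ _ (osum x J * Y + X * osum y J)))//.
rewrite (_ : d * (1 + _ + _) = d + (d * opnorm Y + d * opnorm X)); last by ring.
rewrite lerD//.
rewrite opprD [- (X * _) - _]addrC addrACA -mulrBl -mulrBr (le_trans (opnormD _ _))//.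
rewrite lerD//; first by apply: opnorm_le_mul => //; exact: H3.
by rewrite mulrC; apply: opnorm_le_mul => //; exact: H4.
Qed.
End asymptotics.

(** * Convolution powers of the renewal sequence *)

Section renewal_powers.
Context (R : realType) (V : completeNormedModType R[i]).
Local Notation U := (bop V).
Implicit Types (x : ser U) (Rop : nat -> U).

(** The value 0 at index 0 encodes [j_i >= 1]: tuples with a vanishing entry contribute nothing to
    the convolution power. *)
Definition renewal_seq Rop : ser U := fun n => if n == 0%N then 0 else Rop n.

Lemma prod_eq0 (T : pzRingType) (I : eqType) (r : seq I) (F : I -> T) i :
  i \in r -> F i = 0 -> \prod_(j <- r) F j = 0.
Proof.
elim: r => // j r IH; rewrite inE big_cons => /orP[/eqP <- ->|ir Fi].
  by rewrite mul0r.
by rewrite IH// mulr0.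
Qed.

Lemma sermono_prod l (k : 'I_l -> nat) (c : 'I_l -> U) :
  \prod_i sermono (k i) (c i) = sermono (\sum_i k i)%N (\prod_i c i).
Proof.
elim/big_rec3: _ => [|i a b d _ ->]; first by rewrite sermono1.
by rewrite sermonoM.
Qed.

(** Only the coefficients up to [n] matter, so the series may be replaced by a finite sum of
    monomials, whose power is expanded by distributivity over all functions from ['I_l] to
    ['I_n.+1]. *)
Lemma renewal_convE Rop l n : renewal_conv Rop l n = (renewal_seq Rop ^+ l) n.
Proof.
pose x' : ser U := \sum_(k < n.+1) sermono k (renewal_seq Rop k).
have xx' m : (m <= n)%N -> renewal_seq Rop m = x' m.
  move=> mn; rewrite /x' ser_sum (bigD1 (Ordinal (mn : (m < n.+1)%N)))//= /sermono eqxx.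
  rewrite big1 ?addr0// => i im; rewrite ifN//.
  by apply: contra im => /eqP mi; apply/eqP/val_inj.
have -> : (renewal_seq Rop ^+ l) n = (\prod_(i < l) x') n.
  by rewrite prodr_const card_ord (ser_eq_truncX l xx').
rewrite /x' bigA_distr_bigA ser_sum /renewal_conv.
rewrite [RHS](eq_bigr (fun f : {ffun 'I_l -> 'I_n.+1} =>
   if (\sum_i f i == n)%N then \prod_i renewal_seq Rop (f i) else 0)); last first.
  by move=> f _; rewrite sermono_prod /sermono eq_sym.
rewrite -big_mkcond/= big_mkcondr/=; apply: eq_bigr => f _.
case: ifPn => [/forallP f1|/forallPn/= [k]].
  by apply: eq_bigr => i _; rewrite /renewal_seq eqn0Ngt f1.
rewrite -eqn0Ngt => /eqP fk0.
by rewrite (@prod_eq0 _ _ _ _ k) ?mem_index_enum// /renewal_seq fk0.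
Qed.

Lemma renewal_seriesE Rop z : renewal_series Rop z = ev (renewal_seq Rop) z.
Proof.
rewrite /renewal_series /ev /tsum; congr (lim (_ @ \oo)); apply/funext => -[|n].
  by rewrite big_geq// /osum big_ord0.
rewrite /osum big_ord_recl /twist /renewal_seq/= scaler0 add0r big_add1 big_mkord.
by apply: eq_bigr.
Qed.

Lemma l1le_renewal_seq Rop : (\sum_(1 <= n <oo) (opnorm (Rop n))%:E < +oo)%E ->
  exists B, l1le (renewal_seq Rop) B.
Proof.
move=> fin; set S := (\sum_(1 <= n <oo) _)%E in fin.
have S0 : (0 <= S)%E by apply: nneseries_ge0 => n _ _; rewrite lee_fin opnorm_ge0.
have SE : S = (fine S)%:E by rewrite fineK// ge0_fin_numE.
exists (fine S) => -[|n]; first by rewrite psum0 -lee_fin -SE.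
rewrite /psum big_ord_recl {1}/nser /renewal_seq/= opnorm0 add0r -lee_fin -SE.
apply: (@le_trans _ _ (\sum_(1 <= i < n.+1) (opnorm (Rop i))%:E)%E).
  by rewrite sumEFin lee_fin big_add1 big_mkord.
by apply: nneseries_lim_ge => i _ _; rewrite lee_fin opnorm_ge0.
Qed.

Lemma asym_ale (al : ser R) x X : (forall n, 0 < al n) -> asym al x X -> exists B, ale al x B.
Proof.
move=> al0 /bop_cvgP/(_ 1 ltr01)[N HN].
pose f n := opnorm (x n) / al n.
have f0 n : 0 <= f n by rewrite divr_ge0 ?opnorm_ge0// ltW.
exists (\sum_(i < N) f i + (opnorm X + 1)) => n; rewrite -ler_pdivrMr//.
have [nN|Nn] := ltnP n N.
  by rewrite (bigD1 (Ordinal nN))//= -addrA lerDl !addr_ge0 ?opnorm_ge0// sumr_ge0.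
rewrite -[leLHS]add0r lerD ?sumr_ge0//.
rewrite (_ : _ / _ = opnorm (((al n)^-1)%:C *: x n)); last first.
  by rewrite opnormZ cabs_real ger0_norm ?invr_ge0 ?ltW// mulrC.
by rewrite (le_trans (opnorm_leD _ X))// lerD2l HN.
Qed.

Lemma twist1z x : twist 1 x = x.
Proof. by apply/funext => n; rewrite /twist expr1n scale1r. Qed.

(** [asymM] for [x * x ^+ l] gives the recursion [E_(l+1) = E R^l + R E_l]; it starts at [l = 0]
    with limit 0. *)
Lemma asymX (al : ser R) (K : R) x X B (C : nat -> R) :
  1 <= K -> (forall n, 0 < al n) ->
  (forall n j, (j <= n)%N -> (n <= j + j)%N -> al j <= K * al n) ->
  (forall j, al (n - j)%N / al n @[n --> \oo] --> (1 : R)) ->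
  wle al x B -> (forall l, wle al (x ^+ l) (C l)) -> asym al x X ->
  forall l, asym al (x ^+ l) (\sum_(0 <= i < l) ev x 1 ^+ i * X * ev x 1 ^+ (l - i - 1)).
Proof.
move=> K1 al0 dbl ratio xB xC xX; elim=> [|l IH].
  rewrite big_geq// expr0.
  by apply: (@asym_eventually _ _ al 0 1 0 1%N) (@asym0 _ V al) => -[|n].
rewrite big_nat_recl//= expr0 mul1r subn0 subn1/= exprS.
have -> : \sum_(0 <= i < l) ev x 1 ^+ i.+1 * X * ev x 1 ^+ (l.+1 - i.+1 - 1) =
    ev x 1 * \sum_(0 <= i < l) ev x 1 ^+ i * X * ev x 1 ^+ (l - i - 1).
  by rewrite mulr_sumr; apply: eq_bigr => i _; rewrite subSS exprS !mulrA.
have c1 : cabs (1 : R[i]) <= 1 by rewrite cabs1.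
have -> : ev x 1 ^+ l = tsum (x ^+ l) by rewrite -(evX _ c1 xB.2) /ev twist1z.
have {1}-> : ev x 1 = tsum x by rewrite /ev twist1z.
exact: (asymM K1 al0 dbl ratio xB (xC l) xX IH).
Qed.

End renewal_powers.

Theorem theorem4p2 (R : realType) (V : completeNormedModType R[i])
    (Rop : nat -> bop V) (beta : R) (L : R -> R) (E : bop V)
    (hR : aperiodic_renewal Rop)
    (hbeta : 0 < beta < 1)
    (hL : slowly_varying L)
    (hE : (fun n : nat => (n%:R `^ (1 + beta) / L n%:R)%:C *: Rop n) @ \oo --> E) :
  (exists2 C : R, 0 < C &
     forall n l : nat, (1 <= n)%N -> (1 <= l)%N ->
       opnorm (renewal_conv Rop l n)
         <= C * l%:R ^+ 2 * (L n%:R / n%:R `^ (1 + beta)))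
  /\
  (forall l : nat, (1 <= l)%N ->
     (fun n : nat =>
        (n%:R `^ (1 + beta) / L n%:R)%:C *: renewal_conv Rop l n) @ \oo -->
     \sum_(0 <= i < l)
        renewal_series Rop 1 ^+ i * E * renewal_series Rop 1 ^+ (l - i - 1)).
Proof.
have [fin R2 [P [[sT [rho rho1 spT]] _]]] := hR.
pose x := renewal_seq Rop; pose w := weight L beta.
have w0 n : 0 < w n by exact: weight_gt0.
have [K1 dbl] := weight_doubling hL hbeta.
have [K2 sq] := weight_square hL hbeta.
have [K3 dyad] := weight_dyadic hL hbeta.
pose K := 1 + `|K1| + `|K2| + `|K3|.
have K_ge1 : 1 <= K by rewrite /K -!addrA lerDl !addr_ge0.
have K1K : K1 <= K.
  by rewrite (le_trans (ler_norm _))// /K -addrA addrAC lerDr addr_ge0// addr_ge0.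
have K2K : K2 <= K.
  by rewrite (le_trans (ler_norm _))// /K addrAC lerDr !addr_ge0.
have K3K : K3 <= K by rewrite (le_trans (ler_norm _))// /K lerDr !addr_ge0.
have w_dbl n j : (j <= n)%N -> (n <= j + j)%N -> w j <= K * w n.
  by move=> jn nj; rewrite (le_trans (dbl n j jn nj))// ler_pM2r.
have w_sq N n : (1 <= n)%N -> \sum_(m < N) (w m * Num.min 1 (m%:R / n%:R)) ^+ 2 <= K * w n.
  by move=> n1; rewrite (le_trans (sq N n n1))// ler_pM2r.
have w_dyad k : \sum_(i < k) Num.sqrt ((2 ^ i)%:R * w (2 ^ i)%N) <= K.
  exact: le_trans K3K.
have w_ratio := weight_ratio hL hbeta.
have scale n (T : bop V) : (1 <= n)%N ->
    ((w n)^-1)%:C *: T = (n%:R `^ (1 + beta) / L n%:R)%:C *: T.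
  by case: n => // n _; rewrite /w /= invf_div.
have xE : asym w x E.
  apply/bop_cvgP => e e0; have /bop_cvgP/(_ _ e0)[N HN] := hE.
  (* Index 0 is excluded, where [w] has its conventional value. *)
  exists N.+1 => -[|n] // Nn; rewrite scale//; exact/HN/ltnW.
have [A xA] := asym_ale w0 xE; have [B xB] := l1le_renewal_seq fin.
have xD : wle w x (`|A| + `|B|).
  split; first by apply: aleW xA => //; rewrite ler_wpDr// ler_norm.
  by apply: l1leW xB; rewrite ler_wpDl// ler_norm.
have evE z : renewal_series Rop z = ev x z by exact: renewal_seriesE.
rewrite evE in sT spT.
have rad z : cabs z <= 1 -> z != 1 -> spectral_radius (ev x z) < 1.
  by move=> z1 zn1; rewrite -evE; apply: R2 => //; rewrite -cabsE lecR.
have [C0 [bounded decay]] := circle_powers xB sT rho1 spT rad.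
have [m0 Hm0] := decay 2^-1 (ltac:(by rewrite invr_gt0)).
have [PP _ _] := simple_proj sT.
have [C HC] := power_estimate K_ge1 w0 w_dbl w_sq w_dyad (isT : (0 < m0.+1)%N) xD PP
  (simple_rank sT) bounded (fun z => Hm0 m0.+1 z (leqnSn _)).
have limits := asymX K_ge1 w0 w_dbl w_ratio xD HC xE.
split; last first.
  move=> l _; have /bop_cvgP H := limits l; apply/bop_cvgP => e /H[N HN].
  exists N.+1 => n Nn; rewrite -scale ?(leq_trans _ Nn)// renewal_convE evE.
  by apply: HN; exact: ltnW.
have C_ge0 : 0 <= C.
  have [/(ale_ge0 w0)] := HC 0%N; rewrite pmulr_lge0//.
(* [(l + 2)^2 <= 9 * l^2] for [l >= 1]; the added 1 makes the constant strictly positive. *)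
exists (9 * C + 1) => [|n l n1 l1]; first by rewrite ltr_wpDl// mulr_ge0.
rewrite renewal_convE.
have [/(_ n) Hn _] := HC l; rewrite (le_trans Hn)//.
have -> : w n = L n%:R / n%:R `^ (1 + beta) by move: n1; case: (n).
rewrite ler_wpM2r//; first by have := w0 n; move: n1; case: (n) => // k _ /ltW.
apply: (@le_trans _ _ (C * (9 * l%:R ^+ 2))).
  rewrite ler_wpM2l// -natrX -natrX -natrM ler_nat; nia.
by rewrite mulrA (mulrC C) ler_wpM2r ?sqr_ge0// lerDl.
Qed.
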